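(* Let $G$ be a connected group of finite Morley rank which is $U_2^\perp$ and contains involutions. Suppose that $G$ has a definable, connected, proper subgroup $C < G$ which is a TI-subgroup and almost self-normalising. Then $\bigcup_{g \in G} C^g$ does not contain all strongly real elements of $G$.
   Context: A group of finite Morley rank (''ranked group'') is a group whose definable sets carry Morley rank; ''definable'' means first-order definable, and a definable group is connected if it has no proper definable subgroup of finite index. $G$ is $U_2^\perp$ if it contains no infinite elementary abelian $2$-subgroup. A subgroup $C$ is TI (trivial intersection) if for all $g \in G$, $C^g \neq C$ implies $C \cap C^g = 1$. $C$ is almost self-normalising if $C$ has finite index in $N_G(C)$. An element is strongly real if it is a product of two involutions. *)

(* Defs.v *)
From mathcomp Require Import all_boot.
From mathcomp Require Import boolp classical_sets functions cardinality.

Set Implicit Arguments.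
Unset Strict Implicit.
Unset Printing Implicit Defensive.

Local Open Scope classical_set_scope.
Local Open Scope group_scope.

Record language := Language {
  fun_symb : Type;
  fun_arity : fun_symb -> nat;
  rel_symb : Type;
  rel_arity : rel_symb -> nat }.

Inductive term (L : language) : Type :=
| Var of nat
| App (f : fun_symb L) of ('I_(fun_arity f) -> term L).

(* De Bruijn syntax: [All phi] binds variable 0 of [phi] and shifts the
   others. *)
Inductive formula (L : language) : Type :=
| Bot
| Eq of term L & term L
| Rel (r : rel_symb L) of ('I_(rel_arity r) -> term L)
| Imp of formula L & formula L
| All of formula L.

Record structure (L : language) (T : Type) := Structure {
  fun_interp : forall f : fun_symb L, ('I_(fun_arity f) -> T) -> T;
  rel_interp : forall r : rel_symb L, ('I_(rel_arity r) -> T) -> Prop }.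

Definition scons (T : Type) (x : T) (v : nat -> T) (n : nat) : T :=
  if n is m.+1 then v m else x.

Section Semantics.
Context (L : language) (T : Type) (M : structure L T).

Fixpoint eval (t : term L) (v : nat -> T) : T :=
  match t with
  | Var n => v n
  | App f a => fun_interp M (fun i => eval (a i) v)
  end.

Fixpoint sat (phi : formula L) (v : nat -> T) : Prop :=
  match phi with
  | Bot => False
  | Eq s t => eval s v = eval t v
  | Rel r a => rel_interp M (fun i => eval (a i) v)
  | Imp phi1 phi2 => sat phi1 v -> sat phi2 v
  | All phi1 => forall x, sat phi1 (scons x v)
  end.

(* Definability is with parameters: the assignment [v] supplies them. *)
Definition definable (X : set T) : Prop :=
  exists phi v, X = [set x | sat phi (scons x v)].

Definition definable_op2 (op : T -> T -> T) : Prop :=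
  exists phi v, forall x y z,
    op x y = z <-> sat phi (scons x (scons y (scons z v))).

(* Every set of formulas in one variable, with parameters from the finite set
   [range v], that is finitely satisfiable is realised. *)
Definition omega_saturated : Prop :=
  forall v : nat -> T, finite_set (range v) ->
  forall p : set (formula L),
    (forall q, finite_set q -> q `<=` p ->
       exists x, forall phi, q phi -> sat phi (scons x v)) ->
    exists x, forall phi, p phi -> sat phi (scons x v).

(* MR(X) >= n, for a definable subset X of an omega-saturated structure. *)
Fixpoint morley_rank_ge (n : nat) (X : set T) : Prop :=
  if n is m.+1 then
    exists Y : nat -> set T,
      trivIset [set: nat] Y /\
      forall i, [/\ definable (Y i), Y i `<=` X & morley_rank_ge m (Y i)]
  else X !=set0.

End Semantics.

Definition elementary_embedding (L : language) (T U : Type)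
    (M : structure L T) (N : structure L U) (f : T -> U) : Prop :=
  forall phi v, sat M phi v <-> sat N phi (f \o v).

(* Morley rank is computed in an omega-saturated elementary extension, and does
   not depend on which one. The rank of the universe bounds that of every
   definable set, and it is an ordinal below omega iff some natural number is
   not a lower bound of it. *)
Definition finite_morley_rank (L : language) (T : Type) (M : structure L T)
    : Prop :=
  exists (U : Type) (N : structure L U) (f : T -> U),
    [/\ elementary_embedding M N f,
        omega_saturated N &
        exists n, ~ morley_rank_ge N n [set: U]].

(* The structure [M] may be richer than the pure group structure. *)
Definition group_of_finite_morley_rank (G : groupType) (L : language)
    (M : structure L G) : Prop :=
  definable_op2 M (fun x y : G => x * y) /\ finite_morley_rank M.

Section Groups.
Context (G : groupType).
Implicit Types (A C H K : set G) (g x : G).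

Definition subgroup H : Prop :=
  [/\ H 1, forall x y, H x -> H y -> H (x * y) & forall x, H x -> H x^-1].

Definition right_coset H x : set G := [set h * x | h in H].

Definition finite_index H K : Prop :=
  finite_set [set right_coset H x | x in K].

Definition conj_set C g : set G := [set x ^ g | x in C].

Definition normaliser C : set G := [set g | conj_set C g = C].

Definition TI C : Prop :=
  forall g, conj_set C g <> C -> C `&` conj_set C g = [set 1].

Definition almost_self_normalising C : Prop := finite_index C (normaliser C).

Definition involution x : Prop := x <> 1 /\ x ^+ 2 = 1.

Definition strongly_real x : Prop :=
  exists i j, [/\ involution i, involution j & x = i * j].

Definition elementary_abelian_2 A : Prop :=
  [/\ subgroup A, forall x y, A x -> A y -> x * y = y * x &
      forall x, A x -> x ^+ 2 = 1].

Definition U2perp : Prop :=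
  ~ exists A, elementary_abelian_2 A /\ infinite_set A.

Definition connected (L : language) (M : structure L G) K : Prop :=
  forall H, definable M H -> subgroup H -> H `<=` K -> finite_index H K ->
    H = K.

End Groups.

(* Main.v *)
Require Import Defs.
From HB Require Import structures.
From mathcomp Require Import all_boot.
From mathcomp Require Import boolp classical_sets functions cardinality.

(* Ranks are computed in an omega-saturated elementary extension, where the
   universe is again a group. Counting the rank drops of an element along a
   chain of parameters replaces additivity of the Morley rank; together with the
   symmetry of independence it shows that a family of sets Y^g, disjoint for
   distinct cosets of a definable subgroup H covered by finitely many translates
   of Y, has generic union. In particular the union X of the conjugates of C is
   generic.

   An involution i outside X would commute with no other involution, and the
   elements y outside X with C(y) <= C(i) would give a second generic set,
   disjoint from X. So every involution lies in a conjugate of C; an involution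
   that normalises a conjugate D without lying in it has finitely many fixed
   points on D, hence inverts D. It follows that each D is abelian with a single
   involution, that distinct involutions i, j commute with a unique common
   involution (a projective plane with a polarity without absolute points), and
   that a product of three involutions is a product of two, whence G = X.

   Finally, if a and b lie in the conjugates of two commuting involutions, the
   class of a * b depends only on the classes of a and b, as the hypotenuse of a
   right triangle depends only on its legs. This composition is associative and
   cancellative, and 1 is its only unit, so the powers of any other element form
   an infinite chain for divisibility, against stability. *)

(** The group SO_3(R), with [C] the rotations about an axis, satisfies every purely algebraic
    hypothesis, and all its elements are strongly real and lie in conjugates of [C]. Algebra alone
    therefore leads to a plane and not to a contradiction; the last step has to use that no infinite
    linear order is definable. [U2perp] serves to make squaring finite-to-one on the conjugates of
    [C], once these are known to be abelian; divisibility then yields the rotations that carry one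
    point of the plane to another. The second obstacle is the passage to the saturated extension.
    Connectedness, finite index and the absence of infinite elementary abelian 2-subgroups are not
    first-order. They are transferred through bounds: a set is covered by [n] cosets, for a fixed
    [n]. For this reason predicates are handled in pairs, one in each structure, defined by the same
    formula; with both structures equal this is ordinary definability over a base. *)

Set Implicit Arguments.
Unset Strict Implicit.
Unset Printing Implicit Defensive.

Local Open Scope classical_set_scope.

(** * Renaming and parametric definability *)

Section Renaming.
Context (L : language).

Fixpoint trename (s : nat -> nat) (t : term L) : term L :=
  match t with
  | Var n => Var L (s n)
  | App f a => App (fun i => trename s (a i))
  end.

Definition up_ren (s : nat -> nat) (n : nat) : nat :=
  if n is m.+1 then (s m).+1 else 0.

Fixpoint frename (s : nat -> nat) (phi : formula L) : formula L :=
  match phi with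
  | Bot => Bot L
  | Eq t u => Eq (trename s t) (trename s u)
  | Rel r a => Rel (fun i => trename s (a i))
  | Imp p q => Imp (frename s p) (frename s q)
  | All p => All (frename (up_ren s) p)
  end.

Context (T : Type) (M : structure L T).

Lemma eval_rename s t v : eval M (trename s t) v = eval M t (v \o s).
Proof.
elim: t => [n|f a IH] //=; congr (fun_interp _ _).
by apply: funext => i; apply: IH.
Qed.

Lemma scons_up (x : T) v s : scons x v \o up_ren s = scons x (v \o s).
Proof. by apply: funext => -[]. Qed.

Lemma sat_rename s phi v : sat M (frename s phi) v <-> sat M phi (v \o s).
Proof.
elim: phi s v => [|t u|r a|p IHp q IHq|p IHp] s v //=.
- by rewrite !eval_rename.
- suff -> : (fun i => eval M (trename s (a i)) v) =
            (fun i => eval M (a i) (v \o s)) by [].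
  by apply: funext => i; apply: eval_rename.
- by have := IHp s v; have := IHq s v; tauto.
- split=> H x; have := H x; rewrite IHp scons_up //.
Qed.

Lemma sat_rename_eq s phi v w : v \o s = w ->
  sat M (frename s phi) v <-> sat M phi w.
Proof. by move=> <-; apply: sat_rename. Qed.

Lemma eval_bound (t : term L) : exists k, forall v w : nat -> T,
  (forall n, n < k -> v n = w n) -> eval M t v = eval M t w.
Proof.
elim: t => [n|f a IH] /=; first by exists n.+1 => v w; apply.
have [k Hk] := choice IH.
exists (\max_i k i) => v w E; congr (fun_interp _ _).
apply: funext => i; apply: Hk => n ltn; apply: E.
exact: leq_trans ltn (leq_bigmax i).
Qed.

Lemma sat_bound (phi : formula L) : exists k, forall v w : nat -> T,
  (forall n, n < k -> v n = w n) -> sat M phi v <-> sat M phi w.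
Proof.
elim: phi => [|t u|r a|p [k Hk] q [l Hl]|p [k Hk]] /=.
- by exists 0.
- have [k Hk] := eval_bound t; have [l Hl] := eval_bound u.
  exists (maxn k l) => v w E.
  by rewrite (Hk v w) ?(Hl v w) // => n ltn; apply: E; rewrite leq_max ltn ?orbT.
- have [k Hk] := choice (fun i => eval_bound (a i)).
  exists (\max_i k i) => v w E.
  suff -> : (fun i => eval M (a i) v) = (fun i => eval M (a i) w) by [].
  apply: funext => i; apply: Hk => n ltn; apply: E.
  exact: leq_trans ltn (leq_bigmax i).
- exists (maxn k l) => v w E.
  have := Hk v w; have := Hl v w.
  have Ek n : n < k -> v n = w n by move=> ltn; apply: E; rewrite leq_max ltn.
  have El n : n < l -> v n = w n
    by move=> ltn; apply: E; rewrite leq_max ltn orbT.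
  by move=> /(_ El) ? /(_ Ek) ?; tauto.
- exists k => v w E; split=> H x; have := H x; rewrite (Hk _ (scons x w)) //;
    by case=> [|n] //= /ltnW; apply: E.
Qed.

End Renaming.

(** * Predicates defined by the same formula in two structures *)

Definition inter (T : Type) (v e : nat -> T) (n : nat) : T :=
  if odd n then e n./2 else v n./2.

Section TwoStructures.
Context (L : language) (T U : Type) (M : structure L T) (N : structure L U).

(* One formula, with parameters [e] in [M] and [e'] in [N], defines [P] in [M]
   and [Q] in [N]; variables are at the even positions, parameters at the odd
   ones. *)
Definition codef (e : nat -> T) (e' : nat -> U)
    (P : (nat -> T) -> Prop) (Q : (nat -> U) -> Prop) : Prop :=
  exists phi, (forall v, P v <-> sat M phi (inter v e)) /\
              (forall v, Q v <-> sat N phi (inter v e')).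

Context (e : nat -> T) (e' : nat -> U).
Implicit Types (P : (nat -> T) -> Prop) (Q : (nat -> U) -> Prop).
Local Notation codefe := (codef e e').

Lemma codef_ext P P' Q Q' : (forall v, P v <-> P' v) -> (forall v, Q v <-> Q' v) ->
  codefe P Q -> codefe P' Q'.
Proof.
by move=> EP EQ [phi [H1 H2]]; exists phi; split=> v; rewrite -?EP -?EQ.
Qed.

Lemma codef_imp P P' Q Q' : codefe P Q -> codefe P' Q' ->
  codefe (fun v => P v -> P' v) (fun v => Q v -> Q' v).
Proof.
move=> [p [p1 p2]] [q [q1 q2]]; exists (Imp p q); split=> v /=.
  by have := p1 v; have := q1 v; tauto.
by have := p2 v; have := q2 v; tauto.
Qed.

Lemma codef_false : codefe (fun=> False) (fun=> False).
Proof. by exists (Bot L). Qed.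

Lemma codef_not P Q : codefe P Q -> codefe (fun v => ~ P v) (fun v => ~ Q v).
Proof. by move=> /codef_imp /(_ codef_false). Qed.

Lemma codef_true : codefe (fun=> True) (fun=> True).
Proof. by apply: codef_ext (codef_not codef_false) => v; tauto. Qed.

Lemma codef_and P P' Q Q' : codefe P Q -> codefe P' Q' ->
  codefe (fun v => P v /\ P' v) (fun v => Q v /\ Q' v).
Proof.
move=> H H'; apply: codef_ext (codef_not (codef_imp H (codef_not H'))) => v;
  split; try tauto; move=> h; apply: contrapT; tauto.
Qed.

Lemma codef_or P P' Q Q' : codefe P Q -> codefe P' Q' ->
  codefe (fun v => P v \/ P' v) (fun v => Q v \/ Q' v).
Proof.
move=> H H'; apply: codef_ext (codef_imp (codef_not H) H') => v;
  split; try tauto; move=> h; apply: contrapT; tauto.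
Qed.

Lemma codef_iff P P' Q Q' : codefe P Q -> codefe P' Q' ->
  codefe (fun v => P v <-> P' v) (fun v => Q v <-> Q' v).
Proof. by move=> H H'; apply: codef_and; apply: codef_imp. Qed.

Lemma codef_all (P : T -> (nat -> T) -> Prop) (Q : U -> (nat -> U) -> Prop) :
  codefe (fun w => P (w 0) (fun n => w n.+1)) (fun w => Q (w 0) (fun n => w n.+1)) ->
  codefe (fun v => forall x, P x v) (fun v => forall x, Q x v).
Proof.
move=> [phi [H1 H2]].
(* [All] puts the bound variable at position 0 and shifts the rest by one, which exchanges the
   parities; [rho] brings the variables back to even positions. *)
pose rho n := if odd n then n.+1 else n.-1.
have E X x (v d : nat -> X) :
    scons x (inter v d) \o rho = inter (scons x v) d.
  apply: funext => n; rewrite /rho /inter /=.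
  case: (boolP (odd n)) => [on|]; first by rewrite /= on.
  case: n => [|n] //=; case: n => [|n] //=.
  by rewrite !negbK => /negbTE->.
exists (All (frename rho phi)); split=> v /=.
  split=> H x.
    by apply/(sat_rename_eq _ _ (E _ x v e)); apply/H1 => /=; apply: H.
  by have /(sat_rename_eq _ _ (E _ x v e)) /H1 := H x.
split=> H x.
  by apply/(sat_rename_eq _ _ (E _ x v e')); apply/H2 => /=; apply: H.
by have /(sat_rename_eq _ _ (E _ x v e')) /H2 := H x.
Qed.

Lemma codef_ex (P : T -> (nat -> T) -> Prop) (Q : U -> (nat -> U) -> Prop) :
  codefe (fun w => P (w 0) (fun n => w n.+1)) (fun w => Q (w 0) (fun n => w n.+1)) ->
  codefe (fun v => exists x, P x v) (fun v => exists x, Q x v).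
Proof.
move=> H; apply: codef_ext (codef_not (codef_all
  (P := fun x v => ~ P x v) (Q := fun x v => ~ Q x v) (codef_not H))) => v.
  by split=> [/existsNP[x /contrapT]|[x h] /(_ x)]; [exists x|].
by split=> [/existsNP[x /contrapT]|[x h] /(_ x)]; [exists x|].
Qed.

Lemma codef_reindex (s : nat -> nat) P Q : codefe P Q ->
  codefe (fun v => P (fun n => v (s n))) (fun v => Q (fun n => v (s n))).
Proof.
move=> [phi [H1 H2]].
pose rho n := if odd n then n else (s n./2).*2.
have E X (v d : nat -> X) : inter v d \o rho = inter (fun n => v (s n)) d.
  apply: funext => n; rewrite /rho /inter /=.
  case: (boolP (odd n)) => [->//|_].
  by rewrite odd_double doubleK.
exists (frename rho phi); split=> v.
  by rewrite (sat_rename_eq _ _ (E _ v e)).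
by rewrite (sat_rename_eq _ _ (E _ v e')).
Qed.

Lemma codef_eqvar i j : codefe (fun v => v i = v j) (fun v => v i = v j).
Proof.
by exists (Eq (Var L i.*2) (Var L j.*2)); split=> v /=;
  rewrite /inter !odd_double !doubleK.
Qed.

Lemma codef_eqparam i j : codefe (fun v => v i = e j) (fun v => v i = e' j).
Proof.
by exists (Eq (Var L i.*2) (Var L j.*2.+1)); split=> v /=;
  rewrite /inter /= !odd_double /= doubleK uphalf_double.
Qed.

(** A function is represented by its graph, with the value at position 0, so operations that are not
    symbols of the language can be used as terms. *)
Definition cofun (t : (nat -> T) -> T) (t' : (nat -> U) -> U) : Prop :=
  codefe (fun v => v 0 = t (fun n => v n.+1)) (fun v => v 0 = t' (fun n => v n.+1)).

Lemma cofun_var k : cofun (fun v => v k) (fun v => v k).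
Proof. exact: (codef_eqvar 0 k.+1). Qed.

Lemma cofun_param k : cofun (fun=> e k) (fun=> e' k).
Proof. exact: codef_eqparam. Qed.

Lemma cofun_reindex s t t' : cofun t t' ->
  cofun (fun v => t (fun n => v (s n))) (fun v => t' (fun n => v (s n))).
Proof.
by move=> /(codef_reindex (fun n => if n is m.+1 then (s m).+1 else 0)).
Qed.

Lemma codef_app1 (R : T -> Prop) (R' : U -> Prop) t t' :
  codefe (fun v => R (v 0)) (fun v => R' (v 0)) -> cofun t t' ->
  codefe (fun v => R (t v)) (fun v => R' (t' v)).
Proof.
move=> HR Ht.
have := codef_ex (P := fun z v => z = t v /\ R z) (Q := fun z v => z = t' v /\ R' z)
  (codef_and Ht HR).
by apply: codef_ext => v; split=> [[z [->]]|h] //;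
  [exists (t v)|exists (t' v)].
Qed.

Lemma codef_subst (P : T -> (nat -> T) -> Prop) (Q : U -> (nat -> U) -> Prop) t t' :
  codefe (fun w => P (w 0) (fun n => w n.+1)) (fun w => Q (w 0) (fun n => w n.+1)) ->
  cofun t t' -> codefe (fun v => P (t v) v) (fun v => Q (t' v) v).
Proof.
move=> HP Ht.
have := codef_ex (P := fun z v => z = t v /\ P z v) (Q := fun z v => z = t' v /\ Q z v)
  (codef_and Ht HP).
by apply: codef_ext => v; split=> [[z [->]]|h] //; [exists (t v)|exists (t' v)].
Qed.

Lemma codef_app2 (R : T -> T -> Prop) (R' : U -> U -> Prop) t t' s s' :
  codefe (fun v => R (v 0) (v 1)) (fun v => R' (v 0) (v 1)) -> cofun t t' -> cofun s s' ->
  codefe (fun v => R (t v) (s v)) (fun v => R' (t' v) (s' v)).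
Proof.
move=> HR Ht Hs.
have Hs1 := cofun_reindex S Hs.
have HR' := codef_reindex (fun n => if n is 0 then 1 else if n is 1 then 0 else n) HR.
have := codef_ex (P := fun z v => z = t v /\ exists y, y = s v /\ R z y)
  (Q := fun z v => z = t' v /\ exists y, y = s' v /\ R' z y)
  (codef_and Ht (codef_ex (P := fun y v => y = s (fun n => v n.+1) /\ R (v 0) y)
    (Q := fun y v => y = s' (fun n => v n.+1) /\ R' (v 0) y) (codef_and Hs1 HR'))).
apply: codef_ext => v; split=> [[z [-> [y [->]]]]|h] //.
  by exists (t v); split=> //; exists (s v).
by exists (t' v); split=> //; exists (s' v).
Qed.

Lemma codef_eq t t' s s' : cofun t t' -> cofun s s' ->
  codefe (fun v => t v = s v) (fun v => t' v = s' v).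
Proof. exact: (codef_app2 (R := eq) (R' := eq) (codef_eqvar 0 1)). Qed.

Lemma cofun_op2 op op' t t' s s' :
  codefe (fun v => v 0 = op (v 1) (v 2)) (fun v => v 0 = op' (v 1) (v 2)) ->
  cofun t t' -> cofun s s' ->
  cofun (fun v => op (t v) (s v)) (fun v => op' (t' v) (s' v)).
Proof.
move=> Hop Ht Hs; rewrite /cofun.
have Ht1 := cofun_reindex S (cofun_reindex S Ht).
have Hs1 := cofun_reindex S Hs.
have Ho := codef_reindex (fun n => if n is 0 then 2 else if n is 1 then 0
  else if n is 2 then 1 else n) Hop.
have := codef_ex (P := fun y v => y = s (fun n => v n.+1) /\
    exists z, z = t (fun n => v n.+1) /\ v 0 = op z y)
  (Q := fun y v => y = s' (fun n => v n.+1) /\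
    exists z, z = t' (fun n => v n.+1) /\ v 0 = op' z y)
  (codef_and Hs1 (codef_ex
    (P := fun z v => z = t (fun n => v n.+2) /\ v 1 = op z (v 0))
    (Q := fun z v => z = t' (fun n => v n.+2) /\ v 1 = op' z (v 0))
    (codef_and Ht1 Ho))).
apply: codef_ext => v; split=> [[z [-> [y [->]]]]|h] //.
  by exists (s (fun n => v n.+1)); split=> //; exists (t (fun n => v n.+1)).
by exists (s' (fun n => v n.+1)); split=> //; exists (t' (fun n => v n.+1)).
Qed.

Lemma cofun_fun op op' t t' :
  codefe (fun v => v 0 = op (v 1)) (fun v => v 0 = op' (v 1)) -> cofun t t' ->
  cofun (fun v => op (t v)) (fun v => op' (t' v)).
Proof.
move=> Hop Ht.
have Ht1 := cofun_reindex S Ht.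
have Ho := codef_reindex (fun n => if n is 0 then 1 else if n is 1 then 0 else n) Hop.
have := codef_ex (P := fun z v => z = t (fun n => v n.+1) /\ v 0 = op z)
  (Q := fun z v => z = t' (fun n => v n.+1) /\ v 0 = op' z) (codef_and Ht1 Ho).
apply: codef_ext => v; split=> [[z [->]]|h] //.
  by exists (t (fun n => v n.+1)).
by exists (t' (fun n => v n.+1)).
Qed.

End TwoStructures.

Lemma codef_param L T U (M : structure L T) (N : structure L U) (s : nat -> nat)
    e e' d d' P Q :
  e = d \o s -> e' = d' \o s -> codef M N e e' P Q -> codef M N d d' P Q.
Proof.
move=> -> -> [phi [H1 H2]].
pose rho n := if odd n then (s n./2).*2.+1 else n.
have E X (v c : nat -> X) : inter v c \o rho = inter v (c \o s).
  apply: funext => n; rewrite /rho /inter /=.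
  case: (boolP (odd n)) => [_|/negbTE->//].
  by rewrite /= odd_double /= uphalf_double.
exists (frename rho phi); split=> v.
  by rewrite (sat_rename_eq _ _ (E _ v d)).
by rewrite (sat_rename_eq _ _ (E _ v d')).
Qed.

Local Open Scope group_scope.

(** Decidable equality lets finite sets of formulas be treated as sequences. *)
HB.instance Definition _ (L : language) := gen_eqMixin (formula L).

(** * Ranks and types in an omega-saturated group *)

Section Saturated.
Context (L : language) (G : groupType) (N : structure L G) (Am : seq G).
Implicit Types (A B E : seq G) (X Y Z : set G) (phi psi : formula L).

(* The fixed parameters [Am], which later define the multiplication, belong
   to every base. *)
Definition base_env A : nat -> G := nth 1 (A ++ Am).

Definition pred_over A (P : (nat -> G) -> Prop) : Prop := codef N N (base_env A) (base_env A) P P.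

(* All even positions, i.e. all variables, are set to [x]. *)
Definition defset phi A : set G := [set x | sat N phi (inter (fun=> x) (base_env A))].

Definition def_over A X : Prop := exists phi, X = defset phi A.

Lemma def_overP A X : def_over A X <-> pred_over A (fun v => X (v 0%N)).
Proof.
split=> [[phi ->]|[phi [H _]]].
  by apply: (codef_reindex (fun=> 0%N) (P := fun v => sat N phi (inter v (base_env A)))
    (Q := fun v => sat N phi (inter v (base_env A)))); exists phi.
by exists phi; apply/seteqP; split=> x /= /(H (fun=> x)).
Qed.

Lemma base_env_sub A B : {subset A <= B} ->
  base_env A = base_env B \o (fun n => index (base_env A n) (B ++ Am)).
Proof.
move=> sAB; apply: funext => n /=; rewrite {2}/base_env.
have [lt|ge] := ltnP n (size (A ++ Am)).
  rewrite nth_index // mem_cat.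
  have : base_env A n \in A ++ Am by rewrite mem_nth.
  by rewrite mem_cat => /orP[/sAB->//|->]; rewrite orbT.
rewrite /base_env (nth_default _ ge).
(* Beyond its end [base_env A] returns the default [1]. Either [1] occurs in [B ++ Am], or its index
   is past the end and gives the default again. *)
have [i|/memNindex->] := boolP (1 \in B ++ Am); first by rewrite nth_index.
by rewrite nth_default.
Qed.

Lemma pred_over_sub A B P : {subset A <= B} -> pred_over A P -> pred_over B P.
Proof. by move=> /base_env_sub E; exact: (codef_param E E). Qed.

Lemma def_over_sub A B X : {subset A <= B} -> def_over A X -> def_over B X.
Proof. by move=> s; rewrite !def_overP; apply: pred_over_sub. Qed.

Lemma cofun_const A a : a \in A -> cofun N N (base_env A) (base_env A) (fun=> a) (fun=> a).
Proof.
move=> aA; have := cofun_param N N (base_env A) (base_env A) (index a (A ++ Am)).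
by rewrite /base_env nth_index // mem_cat aA.
Qed.

Let rho n := if odd n then n./2.+1 else 0%N.
Let rho' n := if n is m.+1 then m.*2.+1 else 0%N.

Lemma scons_renE x A : scons x (base_env A) \o rho = inter (fun=> x) (base_env A).
Proof. by apply: funext => n; rewrite /rho /inter /=; case: ifP. Qed.

Lemma inter_renE x A : inter (fun=> x) (base_env A) \o rho' = scons x (base_env A).
Proof.
apply: funext => -[|n] //=; rewrite /inter /= odd_double /=.
by rewrite uphalf_double.
Qed.

Lemma defset_scons phi A x : sat N phi (scons x (base_env A)) <-> defset (frename rho' phi) A x.
Proof. by rewrite /defset /= (sat_rename_eq _ _ (inter_renE x A)). Qed.

Lemma scons_XS phi A x : defset phi A x <-> sat N (frename rho phi) (scons x (base_env A)).
Proof. by rewrite (sat_rename_eq _ _ (scons_renE x A)). Qed.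

Lemma base_env_cons a A : base_env (a :: A) = scons a (base_env A).
Proof. by apply: funext => -[]. Qed.

Lemma def_over_definable A X : def_over A X -> definable N X.
Proof.
move=> [phi ->]; exists (frename rho phi), (base_env A).
by apply/seteqP; split=> x /scons_XS.
Qed.

(** A formula reads only finitely many values of its assignment, so a finite base suffices. *)
Lemma definable_def_over X : definable N X -> exists A, def_over A X.
Proof.
move=> [phi [v ->]]; have [k Hk] := sat_bound N phi.
exists (mkseq v k), (frename rho' phi); apply/seteqP; split=> x /=.
  rewrite -defset_scons; apply: (proj1 (Hk _ _ _)) => -[|n] //= /ltnW ltn.
  by rewrite /base_env nth_cat size_mkseq ltn nth_mkseq.
rewrite -defset_scons; apply: (proj2 (Hk _ _ _)) => -[|n] //= /ltnW ltn.
by rewrite /base_env nth_cat size_mkseq ltn nth_mkseq.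
Qed.

Definition fnot phi := Imp phi (Bot L).
Definition fand phi psi := fnot (Imp phi (fnot psi)).

Lemma defset_and phi psi A : defset (fand phi psi) A = defset phi A `&` defset psi A.
Proof.
apply/seteqP; split=> x; rewrite /defset /setI /=; last by case=> ? ?; apply.
by move=> h; split; apply: contrapT => h'; apply: h => ? //; apply: h'.
Qed.

Lemma defset_true A : defset (fnot (Bot L)) A = setT.
Proof. by apply/seteqP; split=> x // _; apply. Qed.

Lemma def_overT A : def_over A setT.
Proof. by exists (fnot (Bot L)); rewrite defset_true. Qed.

Lemma def_overI A X Y : def_over A X -> def_over A Y -> def_over A (X `&` Y).
Proof. by move=> [p ->] [q ->]; exists (fand p q); rewrite defset_and. Qed.

Lemma def_overC A X : def_over A X -> def_over A (~` X).
Proof. by move=> [p ->]; exists (fnot p). Qed.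

Lemma def_overD A X Y : def_over A X -> def_over A Y -> def_over A (X `\` Y).
Proof. by move=> h1 h2; rewrite setDE; apply: def_overI => //; apply: def_overC. Qed.

Lemma def_over2 X Y : definable N X -> definable N Y ->
  exists A, def_over A X /\ def_over A Y.
Proof.
move=> /definable_def_over[A hA] /definable_def_over[B hB]; exists (A ++ B); split.
  by apply: def_over_sub hA => x; rewrite mem_cat => ->.
by apply: def_over_sub hB => x; rewrite mem_cat => ->; rewrite orbT.
Qed.

Lemma definableI X Y : definable N X -> definable N Y -> definable N (X `&` Y).
Proof. by move=> /def_over2 h /h[A [? ?]]; apply: (@def_over_definable A); apply: def_overI. Qed.

Lemma definableC X : definable N X -> definable N (~` X).
Proof. by move=> /definable_def_over[A ?]; apply: (@def_over_definable A); apply: def_overC. Qed.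

Lemma definableD X Y : definable N X -> definable N Y -> definable N (X `\` Y).
Proof. by move=> h1 h2; rewrite setDE; apply: definableI => //; apply: definableC. Qed.

Lemma definableU X Y : definable N X -> definable N Y -> definable N (X `|` Y).
Proof.
move=> h1 h2; rewrite -(setCK (X `|` Y)) setCU.
by apply: definableC; apply: definableI; apply: definableC.
Qed.

Lemma definableT : definable N setT.
Proof. exact: def_over_definable (def_overT [::]). Qed.

Lemma common_base k (P : nat -> set G) : (forall l, l < k -> definable N (P l)) ->
  exists e, forall l, l < k -> def_over e (P l).
Proof.
elim: k => [|k IH] H; first by exists [::].
have [|e He] := IH; first by move=> l lk; apply: H; apply: ltnW.
have [f Hf] := definable_def_over (H k (ltnSn k)).
exists (e ++ f) => l; rewrite ltnS leq_eqVlt => /orP[/eqP->|lk].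
  by apply: def_over_sub Hf => x; rewrite mem_cat => ->; rewrite orbT.
by apply: def_over_sub (He l lk) => x; rewrite mem_cat => ->.
Qed.

(** * Morley rank and degree *)

Local Notation mr := (morley_rank_ge N).

Lemma mr_sub m X Y : X `<=` Y -> mr m X -> mr m Y.
Proof.
case: m => [|m] sXY /=; first by case=> x /sXY; exists x.
move=> [F [tF HF]]; exists F; split=> // i; have [? s ?] := HF i.
by split=> //; apply: subset_trans s sXY.
Qed.

Lemma mrW m X : mr m.+1 X -> mr m X.
Proof. by move=> [F [_ /(_ 0%N)[_ s]]]; apply: mr_sub. Qed.

Lemma mr_le m n X : m <= n -> mr n X -> mr m X.
Proof.
elim: n => [|n IH]; first by rewrite leqn0 => /eqP->.
by rewrite leq_eqVlt => /orP[/eqP->//|/IH{}IH] /mrW.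
Qed.

Lemma mr0 m X : mr m X -> X !=set0.
Proof. exact: (@mr_le 0). Qed.

(** Each member of a family witnessing rank [m.+1] keeps rank [m] in [X] or in [Y], and one of the
    two happens infinitely often. *)
Lemma mr_union m X Y : definable N X -> definable N Y ->
  mr m (X `|` Y) -> mr m X \/ mr m Y.
Proof.
elim: m X Y => [|m IH] X Y dX dY /=.
  by move=> [x [xX|xY]]; [left|right]; exists x.
move=> [F [tF HF]].
pose I := [set i | mr m (F i `&` X)].
have dis i : mr m (F i `&` X) \/ mr m (F i `&` Y).
  have [dF sF mF] := HF i; apply: IH; try exact: definableI.
  by apply: mr_sub mF => x xF; have [?|?] := sF _ xF; [left|right].
have sub (Z : set G) (g : nat -> nat) : injective g -> definable N Z ->
    (forall i, mr m (F (g i) `&` Z)) -> mr m.+1 Z.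
  move=> gi dZ H; exists (fun i => F (g i) `&` Z); split.
    move=> i j _ _ [x [[? _] [? _]]]; apply: gi; apply: tF => //.
    by exists x.
  by move=> i; have [dF sF mF] := HF (g i); split=> //; apply: definableI.
have [fI|] := pselect (exists k, forall i, k <= i -> ~ I i).
  case: fI => k Hk; right; apply: (sub _ (addn k)) => //; first exact: addnI.
  by move=> i; have [/(Hk _ (leq_addr _ _))|] := dis (k + i)%N.
move=> nI; left.
have next k : exists i, k <= i /\ I i.
  apply: contrapT => h; apply: nI; exists k => i ki Ii; apply: h; by exists i.
have [g Hg] := choice next.
pose h := fix h n := if n is n'.+1 then g (h n').+1 else g 0%N.
have hlt n : h n < h n.+1 by have [] := Hg (h n).+1.
have hmono : {homo h : i j / i < j} by apply: homo_ltn => //; exact: ltn_trans.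
apply: (sub _ h) => //.
  move=> i j E; case: (ltngtP i j) => // /hmono; by rewrite E ltnn.
case=> [|n]; first by have [_] := Hg 0%N.
by have [_] := Hg (h n).+1.
Qed.

(** When [X] has rank exactly [m], the largest such [n] is its Morley degree. *)
Fixpoint splits m n X : Prop :=
  if n is n'.+1 then
    exists Y, [/\ definable N Y, Y `<=` X, mr m Y & splits m n' (X `\` Y)]
  else True.

Lemma splits_sub m n X Y : X `<=` Y -> splits m n X -> splits m n Y.
Proof.
elim: n X Y => [|n IH] X Y sXY //= [Z [dZ sZ mZ H]].
exists Z; split=> //; first exact: subset_trans sZ sXY.
by apply: IH H; apply: setSD.
Qed.

Lemma mrS_spl_n m n X : mr m.+1 X -> splits m n X.
Proof.
elim: n X => [|n IH] X //= [F [tF HF]].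
have [d0 s0 m0] := HF 0%N; exists (F 0%N); split=> //.
apply: IH; exists (F \o S); split.
  by move=> i j _ _ h; apply: succn_inj; apply: tF.
move=> i; have [di si mi] := HF i.+1; split=> // x xF; split; first exact: si.
by move=> x0; suff : i.+1 = 0%N by []; apply: tF => //; exists x.
Qed.

Lemma splits_union m a b X Y : definable N X -> definable N Y ->
  splits m (a + b) (X `|` Y) -> splits m a X \/ splits m b Y.
Proof.
move En : (a + b)%N => n; elim: n a b En X Y => [|n IH] a b En X Y dX dY.
  by case: a En => // _ _; left.
case: a En => [|a] En; first by left.
case: b En => [|b] En; first by right.
move=> [W [dW sW mW H]].
have dXW := definableD dX dW; have dYW := definableD dY dW.
have {}H : splits m n ((X `\` W) `|` (Y `\` W)) by rewrite -setDUl.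
have [mX|mY] : mr m (W `&` X) \/ mr m (W `&` Y).
  apply: mr_union; try exact: definableI.
  by apply: mr_sub mW => x xW; have [?|?] := sW _ xW; [left|right].
- have [|h|h] := IH a b.+1 _ _ _ dXW dYW H; first by case: En; rewrite addnS.
    left; exists (W `&` X); split=> //; first exact: definableI.
    by apply: splits_sub h => x [xX xW]; split=> // -[].
  by right; apply: splits_sub h => x [].
- have [|h|h] := IH a.+1 b _ _ _ dXW dYW H; first by case: En; rewrite addnS.
    by left; apply: splits_sub h => x [].
  right; exists (W `&` Y); split=> //; first exact: definableI.
  by apply: splits_sub h => x [xX xW]; split=> // -[].
Qed.

(** Arbitrarily long finite splittings give an infinite one, by always continuing inside a part
    where the splittings stay unbounded. *)
Lemma splits_mrS m X : definable N X -> (forall n, splits m n X) -> mr m.+1 X.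
Proof.
move=> dX uX; pose unb Z := definable N Z /\ forall n, splits m n Z.
(* Let [W] and [W'] be disjoint pieces of rank [m]. If [W] is unbounded, continue in [W] and keep
   [W']; otherwise [splits_union] shows that [Z] without [W] is unbounded, and [W] is kept. *)
have step Z : exists p : set G * set G, unb Z ->
    [/\ unb p.1, definable N p.2, p.1 `<=` Z, p.2 `<=` Z `\` p.1 & mr m p.2].
  have [uZ|] := pselect (unb Z); last by exists (set0, set0).
  have [dZ /(_ 2%N) /= [W [dW sW mW [W' [dW' sW' mW' _]]]]] := uZ.
  have [uW|nW] := pselect (unb W).
    exists (W, W') => _; split=> //=; exact: subset_trans sW' (@subset_refl _ _).
  exists (Z `\` W, W) => _ /=; have dZW := definableD dZ dW.
  split=> //; last by move=> x xW; split; [exact: sW|case].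
  split=> // n; apply: contrapT => nn; apply: nW; split=> // k.
  have [|//|//] := @splits_union m n k (Z `\` W) W dZW dW.
  by case: uZ => _ /(_ (n + k)%N); apply: splits_sub => x xZ;
    have [?|?] := pselect (W x); [right|left].
have [F HF] := choice step.
pose Zs n := iter n (fun Z => (F Z).1) X.
have uZ n : unb (Zs n) by elim: n => [|n IH] //; case: (HF _ IH).
have sZ n k : Zs (n + k)%N `<=` Zs n.
  elim: k => [|k IH]; first by rewrite addn0.
  by rewrite addnS => x xZ; apply: IH; case: (HF _ (uZ (n + k)%N)) => _ _ s _ _; apply: s.
exists (fun n => (F (Zs n)).2); split.
  have lt i j : i < j -> (F (Zs i)).2 `&` (F (Zs j)).2 = set0.
    move=> ij; apply/seteqP; split=> // x [xi xj].
    have [_ _ _ s _] := HF _ (uZ i); have [_] := s _ xi; apply.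
    apply: (sZ i.+1 (j - i.+1)%N); rewrite subnKC //.
    by have [_ _ _ s' _] := HF _ (uZ j); case: (s' _ xj).
  move=> i j _ _ [x xij]; case: (ltngtP i j) => // /lt E.
    by have : set0 x by rewrite -E.
  by have : set0 x by rewrite -E; case: xij.
move=> i; have [_ d _ s mi] := HF _ (uZ i); split=> //.
by move=> x /s [xZ _]; apply: (sZ 0%N i).
Qed.

Definition deg1 m (P : set G) : Prop :=
  [/\ definable N P, mr m P &
      forall Z, definable N Z -> mr m (P `&` Z) -> mr m (P `\` Z) -> False].

(** Cut as long as some piece is not of degree one; the bound [n] on the degree stops the process.
    The second clause says that what is left over has rank below [m]. *)
Lemma decomp m n X : definable N X -> ~ splits m n X ->
  exists k (P : nat -> set G), (forall l, l < k -> deg1 m (P l) /\ P l `<=` X) /\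
    forall Z, definable N Z -> mr m (Z `&` X) -> exists2 l, l < k & mr m (Z `&` P l).
Proof.
elim: n X => [|n IH] X dX nX; first by case: nX.
have [mX|mX] := pselect (mr m X); last first.
  by exists 0%N, (fun=> X); split=> // Z _ /mr_sub h; case: mX; apply: h.
have [dgX|ndg] := pselect (deg1 m X).
  exists 1%N, (fun=> X); split=> [l _|Z dZ mZ]; last by exists 0%N.
  by split.
have [Z [dZ m1 m2]] : exists Z, [/\ definable N Z, mr m (X `&` Z) & mr m (X `\` Z)].
  apply: contrapT => h; apply: ndg; split=> // Z dZ m1 m2; apply: h; by exists Z.
have d1 := definableI dX dZ; have d2 := definableD dX dZ.
have [|k1 [P1 [H1 C1]]] := IH _ d1.
  move=> h; apply: nX; exists (X `\` Z); split=> //; do ?by move=> x [].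
  by apply: splits_sub h => x [? ?]; split=> // -[].
have [|k2 [P2 [H2 C2]]] := IH _ d2.
  move=> h; apply: nX; exists (X `&` Z); split=> //; do ?by move=> x [].
  by apply: splits_sub h => x [? ?]; split=> // -[].
exists (k1 + k2)%N, (fun l => if l < k1 then P1 l else P2 (l - k1)%N); split.
  move=> l lk; case: ltnP => [l1|l1].
    by have [? s] := H1 _ l1; split=> // x /s [].
  have [|? s] := H2 (l - k1)%N; first by rewrite ltn_subLR.
  by split=> // x /s [].
move=> W dW mW.
have [h|h] : mr m (W `&` (X `&` Z)) \/ mr m (W `&` (X `\` Z)).
  apply: mr_union; try exact: definableI.
  by apply: mr_sub mW => x [xW xX]; have [?|?] := pselect (Z x); [left|right].
- have [l lk ml] := C1 _ dW h; exists l; first exact: ltn_addr.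
  by rewrite lk.
- have [l lk ml] := C2 _ dW h; exists (k1 + l)%N; first by rewrite ltn_add2l.
  by rewrite ltnNge leq_addr /= addKn.
Qed.

Lemma deg1_exists m X : definable N X -> mr m X -> ~ mr m.+1 X ->
  exists2 P, deg1 m P & P `<=` X.
Proof.
move=> dX mX nX.
have [n Hn] : exists n, ~ splits m n X.
  by apply/existsNP => h; apply: nX; apply: splits_mrS.
have [k [P [HP C]]] := decomp dX Hn.
have [|l lk _] := C setT definableT; first by rewrite setTI.
by have [? ?] := HP l lk; exists (P l).
Qed.

Lemma deg1_meet m P X Y : deg1 m P -> definable N X -> definable N Y ->
  mr m (P `&` X) -> mr m (P `&` Y) -> mr m (P `&` (X `&` Y)).
Proof.
move=> [dP mP H] dX dY mX mY.
have [|||h|h] := @mr_union m (P `&` (X `&` Y)) (P `\` Y).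
- by apply: definableI => //; apply: definableI.
- exact: definableD.
- apply: mr_sub mX => x [xP xX]; have [?|?] := pselect (Y x); by [left|right].
- by [].
- by case: (H Y).
Qed.

(** * Types, homogeneity and the rank of a type *)

Definition same_type A B : Prop :=
  size A = size B /\ forall phi, sat N phi (base_env A) <-> sat N phi (base_env B).

Lemma same_type_sym A B : same_type A B -> same_type B A.
Proof. by move=> [s H]; split=> // phi; rewrite H. Qed.

Lemma same_type_trans A B E : same_type A B -> same_type B E -> same_type A E.
Proof. by move=> [s H] [s' H']; split=> [|phi]; rewrite ?s ?H. Qed.

Lemma same_type_all A B phi : same_type A B -> (forall x, defset phi A x) -> forall x, defset phi B x.
Proof.
move=> [_ /(_ (All (frename rho phi))) /= [h _]] H x; apply/scons_XS.
by apply: h => {}x; apply/scons_XS; apply: H.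
Qed.

Lemma same_type_ex A B phi : same_type A B -> defset phi A !=set0 -> defset phi B !=set0.
Proof.
move=> E [x xA]; apply: contrapT => h.
have /(_ (same_type_sym E)) := @same_type_all B A (fnot phi).
by move=> /(_ _ x); apply=> // y yB; apply: h; exists y.
Qed.

Lemma same_type_cons A B a b : size A = size B ->
  (forall phi, defset phi A a -> defset phi B b) -> same_type (a :: A) (b :: B).
Proof.
move=> s H; split=> [/=|phi]; first by rewrite s.
rewrite !base_env_cons; split=> [/defset_scons h|h]; first by apply/defset_scons; apply: H.
apply: contrapT => h'.
apply: (H (fnot (frename rho' phi))); last exact/defset_scons.
by move/defset_scons.
Qed.

Lemma same_type_XS A B a b phi : same_type (a :: A) (b :: B) -> defset phi A a -> defset phi B b.
Proof.
by move=> [_ H] /scons_XS; rewrite -base_env_cons H base_env_cons => /scons_XS.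
Qed.

Lemma same_type_behead A B a b : same_type (a :: A) (b :: B) -> same_type A B.
Proof.
move=> [[s] H]; split=> // phi.
have E C c : base_env (c :: C) \o S = base_env C by apply: funext.
by rewrite -(sat_rename_eq _ _ (E A a)) -(sat_rename_eq _ _ (E B b)).
Qed.

Definition shift_params k phi := frename (fun n => if odd n then n + k.*2 else n)%N phi.

Lemma defset_shf phi E A : defset phi A = defset (shift_params (size E) phi) (E ++ A).
Proof.
apply/seteqP; rewrite /defset /shift_params.
suff E' x : inter (fun=> x) (base_env (E ++ A)) \o
    (fun n => if odd n then n + (size E).*2 else n)%N = inter (fun=> x) (base_env A).
  by split=> x /=; rewrite (sat_rename_eq _ _ (E' x)).
apply: funext => n /=; rewrite /inter; case: (boolP (odd n)) => o; last first.
  by rewrite (negbTE o).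
rewrite oddD odd_double addbF o halfD o odd_double /= add0n doubleK.
by rewrite /base_env -catA nth_cat ltnNge leq_addl /= addnK.
Qed.

(* The type of [a] over [A] has Morley rank at least [m]. *)
Definition rk m a A : Prop := forall phi, defset phi A a -> mr m (defset phi A).

Lemma rkP m a A : rk m a A <-> forall X, def_over A X -> X a -> mr m X.
Proof.
by split=> [H X [phi ->]|H phi] => [|h]; [exact: H|apply: H => //; exists phi].
Qed.

Lemma rk0 a A : rk 0 a A. Proof. by move=> phi h; exists a. Qed.

Lemma rk_le m n a A : m <= n -> rk n a A -> rk m a A.
Proof. by move=> mn h phi /h; apply: mr_le. Qed.

Lemma rk_sub m a A B : {subset A <= B} -> rk m a B -> rk m a A.
Proof. by move=> s /rkP h; apply/rkP => X /(def_over_sub s); apply: h. Qed.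

Hypothesis hsat : omega_saturated N.

(** The form in which saturation is used: for a family closed under intersection, finite
    satisfiability is non-emptiness of its members. *)
Lemma sat_filter A (p : set (set G)) :
  p setT -> (forall X, p X -> def_over A X) ->
  (forall X Y, p X -> p Y -> p (X `&` Y)) -> (forall X, p X -> X !=set0) ->
  exists x, forall X, p X -> X x.
Proof.
move=> pT pd pI p0.
pose q := [set frename rho phi | phi in [set phi | p (defset phi A)]].
have fr : finite_set (range (base_env A)).
  apply: (@sub_finite_set _ _ [set` 1 :: A ++ Am]); last exact: finite_seq.
  move=> x [n _ <-] /=; rewrite inE /base_env.
  have [lt|ge] := ltnP n (size (A ++ Am)); first by rewrite mem_nth // orbT.
  by rewrite nth_default // eqxx.
have [|x Hx] := hsat fr (p := q); last first.
  exists x => X pX; have [phi E] := pd _ pX; rewrite E; apply/scons_XS.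
  by apply: Hx; exists phi => //=; rewrite -E.
move=> q0 /finite_seqP[s ->] sq.
suff [X pX HX] : exists2 X, p X &
    forall x, X x -> forall phi, phi \in s -> sat N phi (scons x (base_env A)).
  by have [x xX] := p0 _ pX; exists x => phi; apply: HX.
have {}sq phi : phi \in s -> q phi by apply: sq.
elim: s sq => [|phi s IH] sq; first by exists setT.
have [X pX HX] := IH (fun psi h => sq psi (mem_behead (s := phi :: s) h)).
have [psi /= ppsi E] := sq phi (mem_head _ _).
exists (defset psi A `&` X); first exact: pI.
move=> x [xp xX] th; rewrite inE => /orP[/eqP->|]; last exact: HX.
by rewrite -E; apply/scons_XS.
Qed.

Lemma homog A B a : same_type A B -> exists b, same_type (a :: A) (b :: B).
Proof.
move=> E; pose p := [set X | exists2 phi, X = defset phi B & defset phi A a].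
have [||||b Hb] := @sat_filter B p.
- by exists (fnot (Bot L)); rewrite ?defset_true.
- by move=> X [phi -> _]; exists phi.
- move=> X Y [phi -> h] [psi -> h']; exists (fand phi psi); rewrite defset_and //.
- by move=> X [phi -> h]; apply: (same_type_ex E); exists a.
exists b; apply: same_type_cons; first by case: E.
by move=> phi h; apply: Hb; exists phi.
Qed.

Lemma homog_seq E A B : same_type A B -> exists E', size E' = size E /\ same_type (E ++ A) (E' ++ B).
Proof.
move=> AB; elim: E => [|a E [E' [s H]]]; first by exists [::].
by have [b Hb] := homog a H; exists (b :: E'); rewrite /= s.
Qed.

(** Homogeneity moves finitely many parameters at a time, whereas an infinite family witnessing the
    rank may need infinitely many. Finite splittings avoid this: their pieces are moved one by
    one. *)
Lemma mr_same_type m phi A B : same_type A B -> mr m (defset phi A) -> mr m (defset phi B).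
Proof.
elim: m phi A B => [|m IHm] phi A B AB; first exact: same_type_ex.
move=> mX; apply: splits_mrS => [|n]; first by apply: (@def_over_definable B); exists phi.
have {mX} := @mrS_spl_n m n _ mX.
elim: n phi A B AB => [|n IHn] phi A B AB //= [Y [dY sY mY H]].
have [E0 dE0] := definable_def_over dY.
have [|psi EY] := @def_over_sub E0 (E0 ++ A) Y _ dE0.
  by move=> x; rewrite mem_cat => ->.
have [E' [sE' EE]] := homog_seq E0 AB.
have X1 := defset_shf phi E0 A; have X2 := defset_shf phi E' B; rewrite sE' in X2.
exists (defset psi (E' ++ B)); split.
- by apply: (@def_over_definable (E' ++ B)); exists psi.
- rewrite X2; move=> x; apply: (@same_type_all _ _ (Imp psi (shift_params (size E0) phi)) EE) => y.
  by rewrite /defset /= => h; have : defset phi A y by [apply: sY; rewrite EY]; rewrite X1.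
- by apply: (IHm _ _ _ EE); rewrite -EY.
- have D C : defset (fand (shift_params (size E0) phi) (fnot psi)) C =
      defset (shift_params (size E0) phi) C `\` defset psi C by rewrite defset_and.
  rewrite X2 -D; apply: (IHn _ _ _ EE); by rewrite D -X1 -EY.
Qed.

Lemma rk_same_type m a b A B : same_type (a :: A) (b :: B) -> rk m a A -> rk m b B.
Proof.
move=> E h phi /(same_type_XS (same_type_sym E)) /h; apply: mr_same_type.
exact: same_type_behead E.
Qed.

(** The sets over [B] that contain a member of [F] up to rank below [m] form a filter; a point
    common to all of them avoids every set over [B] of rank below [m]. *)
Lemma ext_gen m B (F : set (set G)) : F !=set0 ->
  (forall X Y, F X -> F Y -> F (X `&` Y)) ->
  (forall X, F X -> def_over B X /\ mr m X) ->
  exists2 a, rk m a B & forall X, F X -> X a.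
Proof.
move=> [X0 FX0] FI FX.
pose p := [set X | def_over B X /\ exists2 Y, F Y & ~ mr m (Y `\` X)].
have [||||a Ha] := @sat_filter B p.
- split; first exact: def_overT.
  by exists X0 => // /mr0 [x [_]]; apply.
- by move=> X [].
- move=> X Y [dX [X' FX' nX]] [dY [Y' FY' nY]]; split; first exact: def_overI.
  exists (X' `&` Y'); first exact: FI.
  have [d1 _] := FX _ FX'; have [d2 _] := FX _ FY' => h.
  have [|||/nX//|/nY//] := @mr_union m (X' `\` X) (Y' `\` Y).
  + by apply: (@def_over_definable B); apply: def_overD.
  + by apply: (@def_over_definable B); apply: def_overD.
  apply: mr_sub h => x [[x1 x2] n].
  have [xX|] := pselect (X x); last by left.
  by right; split=> // xY; apply: n.
- move=> X [_ [Y FY n]]; apply/set0P/negP => /eqP X0'; apply: n.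
  by rewrite X0' setD0; case: (FX _ FY).
exists a.
  apply/rkP => X dX Xa; apply: contrapT => n.
  have := Ha (~` X); apply => //; split; first exact: def_overC.
  by exists X0 => //; rewrite setDE setCK => h; apply: n; apply: mr_sub h => x [].
move=> X FX'; apply: Ha; split; first by case: (FX _ FX').
by exists X => //; rewrite setDv => /mr0[].
Qed.

Lemma rk_ext m B X : def_over B X -> mr m X -> exists2 a, rk m a B & X a.
Proof.
move=> dX mX; have [|||a ra Ha] := @ext_gen m B [set X].
- by exists X.
- by move=> Y Z -> ->; rewrite /= setIid.
- by move=> Y ->.
- by exists a => //; apply: Ha.
Qed.

(** Existence of non-forking extensions: a type extends to a larger base without loss of rank. *)
Lemma rk_ext2 m a A E : rk m a A ->
  exists2 b, rk m b (E ++ A) & same_type (a :: A) (b :: A).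
Proof.
move=> ra; have [|||b rb Hb] :=
    @ext_gen m (E ++ A) [set X | exists2 phi, X = defset phi A & defset phi A a].
- by exists setT, (fnot (Bot L)); rewrite ?defset_true.
- by move=> X Y [p -> hp] [q -> hq]; exists (fand p q); rewrite defset_and.
- move=> X [p -> hp]; split; last exact: ra.
  apply: (@def_over_sub A); last by exists p.
  by move=> x xA; rewrite mem_cat xA orbT.
- by exists b => //; apply: same_type_cons => // phi h; apply: Hb; exists phi.
Qed.

Variable ntop : nat.
Hypothesis hfin : ~ mr ntop [set: G].

Lemma mr_ntop X : ~ mr ntop X.
Proof. by move=> h; apply: hfin; apply: mr_sub h. Qed.

Lemma exact_rank X : X !=set0 -> exists m, mr m X /\ ~ mr m.+1 X.
Proof.
move=> X0; apply: contrapT => h; apply: (@mr_ntop X).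
elim: ntop => [//|n IH]; apply: contrapT => h'; apply: h; by exists n.
Qed.

Lemma exact_rk a A : exists m, rk m a A /\ ~ rk m.+1 a A.
Proof.
apply: contrapT => h.
suff /(_ ntop) : forall n, rk n a A.
  move=> /rkP /(_ setT (def_overT A)) h'; apply: hfin; exact: h'.
elim=> [|n IH]; first exact: rk0.
by apply: contrapT => h'; apply: h; exists n.
Qed.

(** * Stability: no definable relation orders arbitrarily long finite sequences *)

Section Ladder.
Variable R : G -> G -> Prop.

(** Shelah's 2-rank of [X] with respect to [R]: the height of the binary trees of instances of [R]
    all of whose branches are consistent with [X]. *)
Fixpoint tr n X : Prop :=
  if n is n'.+1 then
    exists b, tr n' (X `&` [set x | R x b]) /\ tr n' (X `\` [set x | R x b])
  else X !=set0.

Lemma tr_sub n X Y : X `<=` Y -> tr n X -> tr n Y.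
Proof.
elim: n X Y => [|n IH] X Y s /=; first by case=> x /s; exists x.
by move=> [b [h1 h2]]; exists b; split;
  [apply: IH h1; apply: setSI|apply: IH h2; apply: setSD].
Qed.

Lemma trW n k X : k <= n -> tr n X -> tr k X.
Proof.
elim: n => [|n IH]; first by rewrite leqn0 => /eqP->.
rewrite leq_eqVlt => /orP[/eqP->//|/IH{}IH] [b [h _]]; apply: IH.
by apply: tr_sub h => x [].
Qed.

Lemma tr_pred_over A n (Xp : (nat -> G) -> set G) :
  pred_over A (fun v => R (v 0%N) (v 1%N)) ->
  pred_over A (fun v => Xp (fun n => v n.+1) (v 0%N)) -> pred_over A (fun v => tr n (Xp v)).
Proof.
move=> dR; elim: n Xp => [|n IH] Xp dX /=; first exact: (codef_ex dX).
apply: codef_ex.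
have dX' := codef_reindex (fun n => if n is m.+1 then m.+2 else 0%N) dX.
apply: codef_and; apply: (IH (fun w x => _)) => /=; apply: codef_and => //.
exact: codef_not.
Qed.

(** For each [n] some [b] leaves trees of height [n] on both sides; saturation finds one [b] for all
    [n]. *)
Lemma tr_split A X : pred_over A (fun v => R (v 0%N) (v 1%N)) -> def_over A X ->
  (forall n, tr n X) -> exists b, (forall n, tr n (X `&` [set x | R x b])) /\
    (forall n, tr n (X `\` [set x | R x b])).
Proof.
move=> dR /def_overP dX tX.
pose F n := [set b | tr n (X `&` [set x | R x b]) /\ tr n (X `\` [set x | R x b])].
have [||||b Hb] := @sat_filter A [set Y | Y = setT \/ exists n, Y = F n].
- by left.
- move=> Y [->|[n ->]]; first exact: def_overT.
  apply/def_overP; apply: codef_and.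
    apply: (@tr_pred_over A n (fun v => X `&` [set x | R x (v 0%N)])) => //.
    exact: codef_and.
  apply: (@tr_pred_over A n (fun v => X `\` [set x | R x (v 0%N)])) => //.
  by apply: codef_and => //; apply: codef_not.
- move=> Y Z [->|[n ->]] [->|[k ->]]; rewrite ?setIT ?setTI; first by left.
  + by right; exists k.
  + by right; exists n.
  right; exists (maxn n k); apply/seteqP; split=> b.
    by case: (leqP n k) => _ [].
  by move=> [h1 h2]; split; split; apply: trW h1 || apply: trW h2;
    rewrite ?leq_maxl ?leq_maxr.
- move=> Y [->|[n ->]]; first by exists 1.
  by have := tX n.+1.
exists b; split=> n; by have [] : F n b by apply: Hb; right; exists n.
Qed.

Lemma tr_mr A r X : pred_over A (fun v => R (v 0%N) (v 1%N)) -> def_over A X ->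
  (forall n, tr n X) -> mr r X.
Proof.
elim: r A X => [|r IH] A X dR dX tX; first exact: (tX 0%N).
apply: splits_mrS => [|n]; first exact: def_over_definable dX.
elim: n A X dR dX tX => [//|n IHn] A X dR dX tX.
have [b [t1 t2]] := tr_split dR dX tX.
have sb : {subset A <= b :: A} by move=> x; rewrite inE => ->; rewrite orbT.
have dRb : def_over (b :: A) [set x | R x b].
  apply/def_overP; apply: (codef_app2 (R := R) (R' := R)); first exact: pred_over_sub dR.
    exact: cofun_var.
  by apply: cofun_const; rewrite mem_head.
have d1 : def_over (b :: A) (X `&` [set x | R x b]) by apply: def_overI => //; apply: def_over_sub dX.
exists (X `&` [set x | R x b]); split=> //; first exact: def_over_definable d1.
  by apply: (IH (b :: A)) => //; apply: pred_over_sub dR.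
rewrite setDIr setDv set0U; apply: (IHn (b :: A)) => //; first exact: pred_over_sub dR.
by apply: def_overD => //; apply: def_over_sub dX.
Qed.

Lemma ladder_tr n (a b : nat -> G) :
  (forall i j, i < n -> j < n -> (R (a i) (b j) <-> i <= j)) ->
  forall k s X, s + 2 ^ k <= n -> (forall i, s <= i < s + 2 ^ k -> X (a i)) -> tr k X.
Proof.
move=> H; elim=> [|k IH] s X le HX /=.
  by exists (a s); apply: HX; rewrite leqnn /= expn0 addn1.
have kp : 0 < 2 ^ k by rewrite expn_gt0.
rewrite expnS mul2n -addnn addnA in le HX.
(* The last index of the first half: [b j] is related to [a i] for [i] in the first half and for no
   [i] in the second. *)
pose j := (s + 2 ^ k).-1.
have jE : j.+1 = (s + 2 ^ k)%N by rewrite prednK // ltn_addl.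
have jn : j < n by rewrite jE; apply: leq_trans le; rewrite leq_addr.
exists (b j); split.
  apply: (IH s); first by apply: leq_trans le; rewrite leq_addr.
  move=> i /andP[si is']; split; first by apply: HX; rewrite si ltn_addr.
  by apply/H => //; [apply: leq_trans le; rewrite ltn_addr|rewrite -ltnS jE].
apply: (IH (s + 2 ^ k)%N) => // i /andP[si is']; split.
  by apply: HX; rewrite is' (leq_trans (leq_addr _ _) si).
by move/H; rewrite jn (leq_trans is' le) => /(_ isT isT); rewrite leqNgt jE si.
Qed.

Lemma no_ladder A : pred_over A (fun v => R (v 0%N) (v 1%N)) ->
  ~ (forall n, exists a b : nat -> G,
      forall i j, i < n -> j < n -> (R (a i) (b j) <-> i <= j)).
Proof.
move=> dR H; apply: hfin; apply: (@tr_mr A) => //; first exact: def_overT.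
move=> n; have [a [b Hab]] := H (2 ^ n)%N.
by apply: (ladder_tr Hab (s := 0%N)); rewrite ?add0n.
Qed.

End Ladder.

Lemma exists_min (P : nat -> Prop) : (exists n, P n) ->
  exists2 n, P n & forall k, k < n -> ~ P k.
Proof.
move=> [n Pn]; have ex : exists n, `[< P n >] by exists n; apply/asboolP.
case: (ex_minnP ex) => k /asboolP Pk H; exists k => // l lk /asboolP /H.
by rewrite leqNgt lk.
Qed.

Lemma exists_max (P : nat -> Prop) b : (exists n, P n) ->
  (forall n, P n -> n <= b) -> exists2 n, P n & forall k, P k -> k <= n.
Proof.
move=> [n Pn] Hb; have ex : exists n, `[< P n >] by exists n; apply/asboolP.
have Hb' k : `[< P k >] -> k <= b by move/asboolP/Hb.
case: (ex_maxnP ex Hb') => k /asboolP Pk H; exists k => // l /asboolP; exact: H.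
Qed.

(** * Independence and its symmetry *)

Definition indep a A b : Prop := forall m, rk m a A -> rk m a (b :: A).

Lemma defset_pred_over phi A : pred_over A (fun v => defset phi (v 1%N :: A) (v 0%N)).
Proof.
pose tau n := if odd n then (if n./2 is m.+1 then m.*2.+1 else 2%N) else 0%N.
suff E v : inter v (base_env A) \o tau = inter (fun=> v 0%N) (base_env (v 1%N :: A)).
  by exists (frename tau phi); split=> v; rewrite (sat_rename_eq _ _ (E v)).
apply: funext => n; rewrite /tau /inter /= base_env_cons.
case: (boolP (odd n)) => // o; case: (n./2) => [|m] //=.
by rewrite odd_double /= uphalf_double.
Qed.

Lemma mr_pred_over m (S : G -> G -> Prop) A x x' :
  pred_over A (fun v => S (v 0%N) (v 1%N)) -> same_type (x :: A) (x' :: A) ->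
  mr m [set y | S y x] -> mr m [set y | S y x'].
Proof.
move=> [p [Hp _]] E.
pose tau n := if odd n then (n./2.+1).*2.+1 else if n == 2%N then 1%N else 0%N.
have E' z y : inter (fun=> y) (base_env (z :: A)) \o tau =
    inter (fun n => if n == 1%N then z else y) (base_env A).
  apply: funext => i; rewrite /tau /inter /= base_env_cons.
  case: (boolP (odd i)) => o /=; first by rewrite odd_double /= uphalf_double.
  have -> : (i == 2) = (i./2 == 1)%N.
    by rewrite -{1}(even_halfK o) -[2%N]/(1.*2)%N (inj_eq double_inj).
  by case: eqP.
have ES z : [set y | S y z] = defset (frename tau p) (z :: A).
  apply/seteqP; split=> y; rewrite /defset /= (sat_rename_eq _ _ (E' z y)).
    by move=> h; apply/Hp.
  by move/Hp.
by rewrite !ES; apply: mr_same_type.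
Qed.

Lemma rk_max m n a A : ~ rk n.+1 a A -> rk m a A -> m <= n.
Proof. by move=> nr r; rewrite leqNgt; apply/negP => /rk_le /(_ r). Qed.

Lemma sub_cons (a : G) A : {subset A <= a :: A}.
Proof. by move=> x; rewrite inE => ->; rewrite orbT. Qed.

Lemma sub_cons2 (a : G) A B : {subset A <= B} -> {subset a :: A <= a :: B}.
Proof. by move=> s x; rewrite !inE => /orP[->//|/s->]; rewrite orbT. Qed.

Lemma sub_catr A B : {subset B <= A ++ B}.
Proof. by move=> x; rewrite mem_cat => ->; rewrite orbT. Qed.

Lemma sub_catl A B : {subset A <= A ++ B}.
Proof. by move=> x; rewrite mem_cat => ->. Qed.

Lemma pinned_type b A be : rk be b A -> ~ rk be.+1 b A ->
  exists theta n, [/\ defset theta A b, ~ splits be n (defset theta A) &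
    forall b', defset theta A b' -> rk be b' A -> same_type (b :: A) (b' :: A)].
Proof.
move=> rb nrb.
have [th0 th0b nth0] : exists2 th, defset th A b & ~ mr be.+1 (defset th A).
  apply: contrapT => h; apply: nrb => phi hp; apply: contrapT => nm.
  by apply: h; exists phi.
have ex : exists n th, defset th A b /\ ~ splits be n (defset th A).
  have [n Hn] : exists n, ~ splits be n (defset th0 A).
    apply/existsNP => h; apply: nth0; apply: splits_mrS => //.
    by apply: (@def_over_definable A); exists th0.
  by exists n, th0.
have [n [th [thb nth]] min] := exists_min ex.
exists th, n; split=> // b' thb' rb'; apply: same_type_cons => // psi psib.
apply: contrapT => npsi.
have mD : mr be (defset (fand th (fnot psi)) A) by apply: rb'; rewrite defset_and.
case: n nth min => [[]//|n] nth /(_ n (ltnSn n)); apply.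
exists (fand th psi); split; first by rewrite defset_and.
move=> h; apply: nth; exists (defset (fand th (fnot psi)) A); split=> //.
- by apply: (@def_over_definable A); exists (fand th (fnot psi)).
- by rewrite defset_and => x [].
- by apply: splits_sub h; rewrite !defset_and => x [x1 x2]; split=> // -[_]; apply.
Qed.

(* Harrington's argument: if [b] is generic over [a] but not conversely, the
   formula witnessing the rank drop of [a] has the order property. *)
Lemma indep_sym a A b : indep b A a -> indep a A b.
Proof.
move=> ib al ra; apply: contrapT => nra.
have [phi pa np] : exists2 phi, defset phi (b :: A) a & ~ mr al (defset phi (b :: A)).
  apply: contrapT => h; apply: nra => phi hp; apply: contrapT => nm.
  by apply: h; exists phi.
pose R x y := defset phi (y :: A) x.
have dR : pred_over A (fun v => R (v 0%N) (v 1%N)) by exact: defset_pred_over.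
have dRx B x : {subset A <= B} -> def_over (x :: B) [set y | R x y].
  move=> sB; apply/def_overP; apply: (codef_app2 (R := R) (R' := R)).
  - by apply: pred_over_sub dR => y /sB; apply: sub_cons.
  - by apply: cofun_const; rewrite mem_head.
  - exact: cofun_var.
have [be [rb nrb]] := exact_rk b A.
have [th [n [thb nth uniqt]]] := pinned_type rb nrb.
have dth : definable N (defset th A) by apply: (@def_over_definable A); exists th.
(* The degree-one pieces need parameters [e]. Replacing [a] by an [a'] of the same type over [A]
   that keeps rank [al] over [e], one obtains a single piece [P l] in which all conjugates of [a']
   over [e ++ A] cut out a generic set. *)
have [k [P [HP HC]]] := decomp dth nth.
have [|e He] := @common_base k P; first by move=> l /HP[[]].
have [a' ra' Ea'] := rk_ext2 e ra.
have dRa x : definable N [set y | R x y] by apply: (@def_over_definable (x :: A)); exact: dRx.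
have dth' : pred_over A (fun v => defset th A (v 0%N)) by apply/def_overP; exists th.
have dRs B : {subset A <= B} -> pred_over B (fun v => R (v 1%N) (v 0%N)).
  move=> sB.
  exact: (codef_reindex (fun n => if n is 0%N then 1%N else 0%N) (pred_over_sub sB dR)).
have mRa : mr be ([set y | R a y] `&` defset th A).
  have /rkP := ib _ rb; apply; last by [].
  apply: def_overI; first exact: dRx.
  by apply: (def_over_sub (@sub_cons a A)); exists th.
have mRa' : mr be ([set y | R a' y] `&` defset th A).
  exact: (mr_pred_over (S := fun y x => R x y /\ defset th A y)
    (codef_and (dRs _ (fun x h => h)) dth') Ea' mRa).
have [l lk ml] := HC _ (dRa a') mRa'.
have [dgP sP] := HP _ lk; have dP : definable N (P l) by case: dgP.
have mPR x : same_type (a' :: e ++ A) (x :: e ++ A) -> mr be (P l `&` [set y | R x y]).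
  move=> E; have dPl := def_over_sub (@sub_catl e A) (He l lk).
  have h : pred_over (e ++ A) (fun v => P l (v 0%N) /\ R (v 1%N) (v 0%N)).
    by apply: codef_and; [exact/def_overP|exact: dRs (@sub_catr e A)].
  rewrite setIC in ml; apply: (mr_pred_over (S := fun y x => P l y /\ R x y) h E).
  exact: ml.
apply: (no_ladder dR) => nn.
suff [aa [bb [_ _ H]]] : exists aa bb : nat -> G,
  [/\ forall i, i < nn -> same_type (a' :: e ++ A) (aa i :: e ++ A),
      forall j, j < nn -> same_type (b :: A) (bb j :: A) &
      forall i j, i < nn -> j < nn -> (R (aa i) (bb j) <-> i <= j)].
  by exists aa, bb.
elim: nn => [|nn [aa [bb [Ha Hb Hab]]]]; first by exists (fun=> a), (fun=> b).
(* [an] keeps rank [al] over the earlier [bb j], so [R an (bb j)] fails: it defines a set of smaller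
   rank. *)
have [an ran Ean] := rk_ext2 (mkseq bb nn) ra'.
pose aa' i := if i == nn then an else aa i.
have Ha' i : i < nn.+1 -> same_type (a' :: e ++ A) (aa' i :: e ++ A).
  rewrite ltnS leq_eqVlt /aa'; case: eqP => [//|_] /=; exact: Ha.
pose Q k := [set y | forall i, i < k -> R (aa' i) y].
have dQ j : definable N (Q j).
  elim: j => [|j IH].
    suff -> : Q 0%N = setT by exact: definableT.
    by apply/seteqP; split=> y.
  suff -> : Q j.+1 = Q j `&` [set y | R (aa' j) y] by apply: definableI.
  apply/seteqP; split=> y => [H|[H H'] i].
    by split; [move=> i ij; apply: H; apply: ltnW|apply: H].
  by rewrite ltnS leq_eqVlt => /orP[/eqP->//|]; exact: H.
have mQ j : j <= nn.+1 -> mr be (P l `&` Q j).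
  elim: j => [_|j IH jn].
    have -> : Q 0%N = setT by apply/seteqP; split=> y.
    by rewrite setIT; case: dgP.
  have := deg1_meet dgP (dQ j) (dRa (aa' j)) (IH (ltnW jn)) (mPR _ (Ha' _ jn)).
  apply: mr_sub => y [yP [yQ yR]]; split=> // i.
  by rewrite ltnS leq_eqVlt => /orP[/eqP->//|]; exact: yQ.
have [E2 dE2] := definable_def_over (definableI dP (dQ nn.+1)).
(* In a set of degree one finitely many generic subsets have a generic intersection, so [bn] can be
   related to all [aa' i]; its rank and [theta] give it the type of [b]. *)
have [bn rbn [bnP bnQ]] := rk_ext (def_over_sub (@sub_catl E2 A) dE2) (mQ _ (leqnn _)).
have Ebn : same_type (b :: A) (bn :: A).
  by apply: uniqt; [exact: sP|apply: rk_sub rbn; exact: sub_catr].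
exists aa', (fun j => if j == nn then bn else bb j); split=> //.
  move=> j; rewrite ltnS leq_eqVlt; case: eqP => [//|_] /=; exact: Hb.
move=> i j; rewrite ltnS => ile; rewrite ltnS => jle.
case: eqP => [->|/eqP jn].
  by split=> // _; apply: bnQ.
have jlt : j < nn by rewrite ltn_neqAle jn jle.
rewrite /aa'; case: eqP => [->|/eqP ine].
  split=> [h|]; last by rewrite leqNgt jlt.
  exfalso; apply: np; apply: (mr_same_type (same_type_sym (Hb _ jlt))).
  have /rkP := ran; apply; last exact: h.
  apply: (@def_over_sub (bb j :: A)); last by exists phi.
  move=> x; rewrite inE !mem_cat => /orP[/eqP->|->]; last by rewrite !orbT.
  by rewrite map_f // mem_iota add0n jlt.
by apply: Hab => //; rewrite ltn_neqAle ine ile.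
Qed.

Lemma indepP a A b : indep a A b <-> indep b A a.
Proof. by split; apply: indep_sym. Qed.

(** * Chains of rank drops *)

Definition drop_at a A b : Prop := ~ indep a A b.

(* Counts the rank drops of [a] over [A], [b1 :: A], ...; the maximum over all
   chains is the Lascar rank of [a] over [A]. *)
Fixpoint drops a A bs : nat :=
  if bs is b :: bs' then `[< drop_at a A b >] + drops a (b :: A) bs' else 0.

Lemma drop_atP a A b : drop_at a A b <-> exists2 m, rk m a A & ~ rk m a (b :: A).
Proof.
split=> [/existsNP[m /not_implyP[h1 h2]]|[m h1 h2] h]; first by exists m.
by apply: h2; apply: h.
Qed.

(** Each drop costs at least one unit of Morley rank. *)
Lemma drops_bound m a A bs : ~ rk m.+1 a A -> drops a A bs <= m.
Proof.
elim: bs m A => [|b bs IH] m A nr //=.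
case: asboolP => [/drop_atP[k r nr']|_] /=.
  have km := rk_max nr r; case: k r nr' km => [|k] r nr' km.
    by case: nr'; exact: rk0.
  by rewrite add1n; apply: leq_trans km; rewrite ltnS; apply: IH.
by rewrite add0n; apply: IH => h; apply: nr; apply: rk_sub h; apply: sub_cons.
Qed.

Lemma drops_ntop a A bs : drops a A bs <= ntop.
Proof.
apply: drops_bound => h; apply: hfin; apply: mrW.
by have /rkP := h; apply=> //; exact: def_overT.
Qed.

Lemma drops_cat a A bs cs : drops a A (bs ++ cs) = (drops a A bs + drops a (catrev bs A) cs)%N.
Proof. by elim: bs A => [|b bs IH] A //=; rewrite IH addnA. Qed.

Lemma rk_eqbase m a A B : A =i B -> rk m a A <-> rk m a B.
Proof. by move=> E; split; apply: rk_sub => x; rewrite E. Qed.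

Lemma drops_le (S : seq G -> seq G -> Prop) a a' bs A A' :
  S A A' ->
  (forall A A' b, b \in bs -> S A A' -> S (b :: A) (b :: A') /\
    (drop_at a A b -> drop_at a' A' b)) ->
  drops a A bs <= drops a' A' bs.
Proof.
elim: bs A A' => [|b bs IH] A A' SA H //=.
have [SA' h] := H _ _ b (mem_head _ _) SA.
apply: leq_add; last first.
  by apply: IH => // B B' c cb; apply: H; rewrite inE cb orbT.
by case: asboolP => // /h /asboolP ->.
Qed.

Lemma drops_eqbase a A B bs : A =i B -> drops a A bs = drops a B bs.
Proof.
move=> E; apply/eqP; rewrite eqn_leq.
have sub C D : C =i D -> drops a C bs <= drops a D bs.
  move=> CD; apply: (drops_le (S := fun A B => A =i B)) => // {E CD C D}A {}B b _ E.
  have E' : b :: A =i b :: B by move=> x; rewrite !inE E.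
  split=> // /drop_atP[m h1 h2]; apply/drop_atP.
  by exists m; rewrite -?(rk_eqbase _ _ E) -?(rk_eqbase _ _ E').
by rewrite !sub // => x; rewrite E.
Qed.

(** [s] stands for the Lascar rank of [K]. The base may grow beyond [A0], since chains over
    different bases have to be compared. *)
Definition max_drops (K : set G) A0 s : Prop :=
  (exists a A bs, [/\ K a, {subset A0 <= A} & drops a A bs = s]) /\
  (forall a A bs, K a -> {subset A0 <= A} -> drops a A bs <= s).

Lemma max_drops_ex K A0 : K !=set0 -> exists s, max_drops K A0 s.
Proof.
move=> [a Ka].
have [||s H1 H2] := @exists_max (fun s =>
  exists a A bs, [/\ K a, {subset A0 <= A} & drops a A bs = s]) ntop.
- by exists (drops a A0 [::]), a, A0, [::]; split.
- by move=> n [a' [A [bs [_ _ <-]]]]; exact: drops_ntop.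
by exists s; split=> // a' A bs Ka' sA; apply: H2; exists a', A, bs.
Qed.

Lemma same_type_drop h h' V V' k : k <= size V -> same_type (h :: V) (h' :: V') ->
  same_type (h :: drop k V) (h' :: drop k V').
Proof.
move=> kV [/= [sV] H]; split=> [|phi]; first by rewrite /= !size_drop sV.
pose s n := if n is m.+1 then (m + k).+1 else 0%N.
have E h0 V0 : k <= size V0 -> base_env (h0 :: V0) \o s = base_env (h0 :: drop k V0).
  move=> kV0; apply: funext => -[|n] //=; rewrite /base_env /=.
  rewrite -{1}(cat_take_drop k V0) -catA nth_cat size_takel //.
  by rewrite ltnNge leq_addl /= addnK.
rewrite -(sat_rename_eq _ _ (E h V kV)) -(sat_rename_eq _ _ (E h' V' _)) ?H //.
by rewrite -sV.
Qed.

Lemma drops_same_type h h' cs cs' A A' : size cs = size cs' -> size A = size A' ->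
  same_type (h :: catrev cs A) (h' :: catrev cs' A') -> drops h A cs = drops h' A' cs'.
Proof.
elim: cs cs' A A' => [|b cs IH] [|b' cs'] A A' //= [sc] sA E.
congr (_ + _)%N; last by apply: IH => //=; rewrite sA.
have dE (c : seq G) B : drop (size c) (catrev c B) = B.
  by rewrite catrevE -(size_rev c) drop_size_cat.
have E1 : same_type (h :: b :: A) (h' :: b' :: A').
  have := @same_type_drop h h' _ _ (size cs) _ E; rewrite dE {2}sc dE; apply.
  by rewrite catrevE size_cat size_rev leq_addr.
have E2 : same_type (h :: A) (h' :: A').
  by have := @same_type_drop h h' _ _ 1 _ E1; rewrite /= !drop0; apply.
congr nat_of_bool; apply: asbool_equiv_eq.
split=> /drop_atP[m h1 h2]; apply/drop_atP; exists m.
- exact: rk_same_type E2 h1.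
- by move=> /(rk_same_type (same_type_sym E1)).
- exact: rk_same_type (same_type_sym E2) h1.
- by move=> /(rk_same_type E1).
Qed.

Section Copy.
Variable A0 : seq G.

Fixpoint indep_list E W : Prop :=
  if W is z :: W1 then
    (forall m, rk m z (W1 ++ A0) -> rk m z (E ++ W1 ++ A0)) /\ indep_list E W1
  else True.

(** Built from the tail: homogeneity moves the next entry along with those already copied, and
    [rk_ext2] replaces it by a realisation that loses no rank over [E]. *)
Lemma copy E W : exists W', [/\ size W' = size W, same_type (W ++ A0) (W' ++ A0) & indep_list E W'].
Proof.
elim: W => [|z W [W' [sW EW PW]]]; first by exists [::].
have [z2 E2] := homog z EW.
have [m [r nr]] := exact_rk z2 (W' ++ A0).
have [z' r' E'] := rk_ext2 E r.
exists (z' :: W'); split=> /=; [by rewrite sW|exact: same_type_trans E2 E'|split=> // k rk'].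
by apply: rk_le r'; apply: (rk_max nr); apply: rk_same_type (same_type_sym E') rk'.
Qed.

(** Symmetry turns the independence of [W] from [e] into that of [e] from [W], one entry at a
    time. *)
Lemma indep_list_elem e E1 W : indep_list (e :: E1) W ->
  forall m, rk m e (E1 ++ A0) -> rk m e (E1 ++ W ++ A0).
Proof.
elim: W => [|z W IH] //= [Pz PW] m r.
have /indep_sym i : indep z (E1 ++ W ++ A0) e.
  move=> k rk'; apply: Pz; apply: rk_sub rk'; exact: sub_catr.
have := i _ (IH PW m r); apply: rk_sub => x; rewrite !(inE, mem_cat).
by case: (x == z); case: (x \in E1).
Qed.

Lemma Pind_behead e E1 W : indep_list (e :: E1) W -> indep_list E1 W.
Proof.
elim: W => [|z W IH] //= [Pz /IH PW]; split=> // m /Pz.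
by apply: rk_sub; exact: sub_cons.
Qed.

Lemma indep_list_set E h V B m : indep_list E (h :: V) -> {subset A0 <= B} ->
  {subset B <= V ++ A0} -> rk m h B -> rk m h (E ++ B).
Proof.
move=> + sA sB r; elim: E => [//|e E IH] P.
have {}IH := IH (Pind_behead P).
have /indep_sym : indep e (E ++ B) h.
  move=> k rke; have := @indep_list_elem e E (h :: V) P k.
  case: (pselect (rk k e (E ++ A0))) => [r1 /(_ r1)|n]; last first.
    case: n; apply: rk_sub rke => x; rewrite !mem_cat.
    by move=> /orP[->//|/sA->]; rewrite orbT.
  apply: rk_sub => x; rewrite !(inE, mem_cat).
  move=> /or3P[->|->//|/sB]; first by rewrite orbT.
  by rewrite mem_cat => ->; rewrite !orbT.
exact.
Qed.

(** The maximum is attained over a base containing any given [E]: move the element and its whole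
    chain to a copy independent of [E] over [A0], where all its drops survive. *)
Lemma max_drops_base K s E : def_over A0 K -> max_drops K A0 s ->
  exists h C cs, [/\ K h, {subset A0 <= C}, {subset E <= C} & drops h C cs = s].
Proof.
move=> [kap EK] [[h [A [cs [Kh sA drh]]]] maxs].
(* [catrev cs A] is the base at the end of the chain, so the copied tuple records every step of
   it. *)
have [[|h' V'] [sV EW P']] := copy E (h :: catrev cs A); first by [].
move: sV => [sV].
pose cs' := rev (take (size cs) V'); pose A' := drop (size cs) V'.
have sV' : size V' = (size cs + size A)%N.
  by rewrite sV catrevE size_cat size_rev.
have scs : size cs' = size cs by rewrite size_rev size_takel // sV' leq_addr.
have sA' : size A' = size A by rewrite size_drop sV' addKn.
have EV : V' = catrev cs' A' by rewrite catrevE revK cat_take_drop.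
have cA (c B : seq G) : catrev c B ++ A0 = catrev c (B ++ A0) by rewrite !catrevE catA.
have Kh' : K h'.
  rewrite EK in Kh *; move: EW => /= /(@same_type_drop h h' _ _ (size (catrev cs A))).
  rewrite drop_size_cat // -sV drop_size_cat //.
  by rewrite size_cat sV leq_addr => /(_ isT) /same_type_XS; apply.
have dr1 : drops h' (A' ++ A0) cs' = s.
  rewrite -drh -(@drops_eqbase h (A ++ A0) A cs); last first.
    by move=> x; rewrite mem_cat; case: (boolP (x \in A)) => //= /(contra (@sA x))/negbTE.
  apply/esym; apply: drops_same_type; rewrite ?size_cat ?sA' //.
  by rewrite -!cA -EV.
exists h', (E ++ A' ++ A0), cs'; split=> //.
- by move=> x xA; rewrite !mem_cat xA !orbT.
- exact: sub_catl.
apply/eqP; rewrite eqn_leq maxs //=; last by move=> x xA; rewrite !mem_cat xA !orbT.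
rewrite -{1}dr1.
apply: (drops_le (S := fun A B => [/\ {subset A0 <= A}, {subset A <= V' ++ A0} &
    E ++ A =i B])).
  split=> // x; first by move=> xA; rewrite mem_cat xA orbT.
  rewrite EV catrevE !mem_cat => /orP[->|->]; by rewrite !orbT.
move=> {EK sA drh sA' dr1 EV EW scs sV' sV}A1 B b bcs [s1 s2 E3].
have bV : b \in V' ++ A0.
  by move: bcs; rewrite mem_rev mem_cat => /mem_take->.
have E4 : E ++ b :: A1 =i b :: B.
  by move=> x; rewrite !(inE, mem_cat) -E3 mem_cat orbCA.
split.
  split=> //; first by move=> x /s1; exact: sub_cons.
  by move=> x; rewrite inE => /orP[/eqP->|/s2].
move=> /drop_atP[m r nr]; apply/drop_atP; exists m.
  by rewrite -(rk_eqbase _ _ E3); exact: (indep_list_set P').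
rewrite -(rk_eqbase _ _ E4) => h1; apply: nr; apply: rk_sub h1; exact: sub_catr.
Qed.

End Copy.

(** * Generic subsets of definable groups *)

Hypothesis hmul : pred_over [::] (fun v => v 0%N = v 1%N * v 2%N).

Local Notation cofunA A t := (cofun N N (base_env A) (base_env A) t t).

Lemma pred_over_nil A P : pred_over [::] P -> pred_over A P.
Proof. exact: pred_over_sub. Qed.

Lemma cofun_mul A t s : cofunA A t -> cofunA A s -> cofunA A (fun v => t v * s v).
Proof. exact: (cofun_op2 (pred_over_nil A hmul)). Qed.

Lemma cofun_one A : cofunA A (fun=> 1).
Proof.
have := codef_eq (cofun_mul (cofun_var N N (base_env A) (base_env A) 0%N) (cofun_var N N (base_env A) (base_env A) 0%N))
  (cofun_var N N (base_env A) (base_env A) 0%N).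
by apply: codef_ext => v; split=> [/(canRL (mulKg _))|->]; rewrite ?mulVg ?mulg1.
Qed.

Lemma cofun_inv A t : cofunA A t -> cofunA A (fun v => (t v)^-1).
Proof.
apply: (cofun_fun (op := fun x => x^-1) (op' := fun x => x^-1)).
have := codef_eq (cofun_mul (cofun_var N N (base_env A) (base_env A) 0%N) (cofun_var N N (base_env A) (base_env A) 1%N))
  (cofun_one A).
by apply: codef_ext => v; split=> [/(canRL (mulgK _))|->]; rewrite ?mul1g ?mulVg.
Qed.

Lemma cofun_conj A t s : cofunA A t -> cofunA A s -> cofunA A (fun v => t v ^ s v).
Proof. by move=> ht hs; apply: cofun_mul; [exact: cofun_inv|exact: cofun_mul]. Qed.

Lemma cofun_sq A t : cofunA A t -> cofunA A (fun v => t v ^+ 2).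
Proof. by move=> ht; apply: cofun_mul. Qed.

(** * Definability read off the syntax of a predicate; hypotheses in the context supply the atoms *)

Ltac memb := by rewrite ?(inE, mem_cat) ?eqxx ?orbT.
Ltac boolcases := repeat match goal with
  | |- context [?a == ?b] => case: (a == b)
  | |- context [?a \in ?b] => case: (a \in b)
  end.
Ltac subs := lazymatch goal with
  | |- {subset ?A <= ?A} => exact: (fun _ h => h)
  | |- _ => let x := fresh "x" in
            intros x; rewrite ?(inE, mem_cat); by boolcases
  end.

Ltac ftt := lazymatch goal with
  | |- cofun _ _ _ _ (fun v => v ?k) _ => exact: cofun_var
  | |- cofun _ _ _ _ (fun v => @?t v * @?s v) _ => apply: cofun_mul; ftt
  | |- cofun _ _ _ _ (fun v => (@?t v)^-1) _ => apply: cofun_inv; ftt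
  | |- cofun _ _ _ _ (fun v => @?t v ^ @?s v) _ => apply: cofun_conj; ftt
  | |- cofun _ _ _ _ (fun v => @?t v ^+ 2) _ => apply: cofun_sq; ftt
  | |- cofun _ _ _ _ (fun=> 1) _ => exact: cofun_one
  | |- cofun _ _ _ _ (fun=> ?a) _ => first [assumption|apply: cofun_const; memb]
  end.

Ltac tdgo := lazymatch goal with
  | |- codef _ _ _ _ (fun v => ~ @?P v) _ => apply: codef_not; tdgo
  | |- codef _ _ _ _ (fun v => @?P v /\ @?Q v) _ => apply: codef_and; tdgo
  | |- codef _ _ _ _ (fun v => @?P v \/ @?Q v) _ => apply: codef_or; tdgo
  | |- codef _ _ _ _ (fun v => @?P v <-> @?Q v) _ => apply: codef_iff; tdgo
  | |- codef _ _ _ _ (fun v => @?t v = @?s v) _ => apply: codef_eq; ftt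
  | |- codef _ _ _ _ (fun=> True) _ => exact: codef_true
  | |- codef _ _ _ _ (fun=> False) _ => exact: codef_false
  | |- codef _ _ _ _ (fun v => exists x, @?P v x) _ =>
      apply: codef_ex; cbn beta; tdgo
  | |- codef _ _ _ _ (fun v => @?P v -> @?Q v) _ => apply: codef_imp; tdgo
  | |- codef _ _ _ _ (fun v => forall x, @?P v x) _ =>
      apply: codef_all; cbn beta; tdgo
  | hdef_ : def_over ?B ?X |- codef _ _ _ _ (fun v => ?X (@?t v)) _ =>
      apply: (codef_app1 (R := X) (R' := X));
        [apply: (proj1 (def_overP _ _)); apply: def_over_sub hdef_; subs|ftt]
  | hdef_ : pred_over ?B (fun v => ?X (v 0%N) (v 1%N)) |-
      codef _ _ _ _ (fun v => ?X (@?t v) (@?s v)) _ =>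
      apply: (codef_app2 (R := X) (R' := X));
        [apply: pred_over_sub hdef_; subs|ftt|ftt]
  end.
Ltac td := rewrite ?def_overP;
  cbv [pred_over mkset setI setD setC setU bigcup image set1 setT]; cbn beta; tdgo.

Lemma def_over_dcl A B z X : cofunA B (fun=> z) -> {subset A <= B} ->
  def_over (z :: A) X -> def_over B X.
Proof.
move=> hz sAB [phi ->]; apply/def_overP.
apply: (codef_app2 (R := fun x z => defset phi (z :: A) x)
  (R' := fun x z => defset phi (z :: A) x)) hz => //; last exact: cofun_var.
apply: pred_over_sub sAB _; exact: defset_pred_over.
Qed.

Lemma rk_dcl m b A B z : cofunA B (fun=> z) -> {subset A <= B} ->
  rk m b B -> rk m b (z :: A).
Proof. by move=> hz s /rkP h; apply/rkP => X /(def_over_dcl hz s); apply: h. Qed.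

Lemma mr_img m (f : G -> G) B X : pred_over B (fun v => v 0%N = f (v 1%N)) ->
  (forall x y, X x -> X y -> f x = f y -> x = y) -> mr m X -> mr m (f @` X).
Proof.
move=> df; elim: m X => [|m IH] X fi; first by move=> [x Xx]; exists (f x), x.
move=> [F [tF HF]]; exists (fun i => f @` F i); split.
  move=> i j _ _ [_ [[x Fx <-] [y Fy E]]]; apply: tF => //; exists x; split=> //.
  have [_ si _] := HF i; have [_ sj _] := HF j.
  by rewrite (fi x y) //; [exact: si|exact: sj].
move=> i; have [dF sF mF] := HF i; split.
- have [C dC] := definable_def_over dF.
  have df' := pred_over_sub (@sub_catl B C) df; have dC' := def_over_sub (@sub_catr B C) dC.
  apply: (@def_over_definable (B ++ C)); apply/def_overP.
  have := codef_ex (P := fun x v => F i x /\ v 0%N = f x)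
    (Q := fun x v => F i x /\ v 0%N = f x) (codef_and (proj1 (def_overP _ _) dC')
      (codef_reindex (fun n => if n is 0%N then 1%N else if n is 1%N then 0%N else n) df')).
  by apply: codef_ext => v; split=> [[x [? ->]]|[x ? <-]]; exists x.
- by move=> _ [x /sF ? <-]; exists x.
- by apply: IH => // x y /sF ? /sF ?; apply: fi.
Qed.

Lemma rk_img m (f : G -> G) A a : injective f ->
  pred_over A (fun v => v 0%N = f (v 1%N)) -> rk m a A -> rk m (f a) A.
Proof.
move=> fi df /rkP h; apply/rkP => X dX Xfa.
have m1 : mr m [set x | X (f x)].
  apply: h => //; apply/def_overP.
  apply: (codef_app1 (R := X) (R' := X)); first exact/def_overP.
  exact: (cofun_fun df (cofun_var _ _ _ _ 0%N)).
have := mr_img df (fun x y _ _ => @fi x y) m1.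
by apply: mr_sub => _ [x h' <-].
Qed.

Lemma rk_mull m A g a : g \in A -> rk m a A -> rk m (g * a) A.
Proof. by move=> gA; apply: (rk_img (f := fun x => g * x)); [exact: mulgI|td]. Qed.

Lemma rk_mulVl m A g a : g \in A -> rk m (g * a) A -> rk m a A.
Proof.
move=> gA h; rewrite -(mulKg g a); move: h.
by apply: (rk_img (f := fun x => g^-1 * x)); [exact: mulgI|td].
Qed.

Lemma rk_mulr m A g a : g \in A -> rk m a A -> rk m (a * g) A.
Proof. by move=> gA; apply: (rk_img (f := fun x => x * g)); [exact: mulIg|td]. Qed.

Lemma rk_conj m A g a : g \in A -> rk m a A -> rk m (a ^ g) A.
Proof. by move=> gA; apply: (rk_img (f := fun x => x ^ g)); [exact: conjg_inj|td]. Qed.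

Lemma rk_conjV m A g a : g \in A -> rk m (a ^ g) A -> rk m a A.
Proof.
move=> gA h; rewrite -(conjgK g a); move: h.
by apply: (rk_img (f := fun x => x ^ g^-1)); [exact: conjg_inj|td].
Qed.

Definition ltrans g X : set G := [set y | X (g^-1 * y)].

Lemma definable_ltrans g X : definable N X -> definable N (ltrans g X).
Proof.
move=> /definable_def_over[A dA]; apply: (@def_over_definable (g :: A)).
rewrite /ltrans; td.
Qed.

Lemma ltransE g X : ltrans g X = (fun x => g * x) @` X.
Proof.
apply/seteqP; split=> x; first by exists (g^-1 * x) => //; rewrite mulVKg.
by move=> [y Xy <-]; rewrite /ltrans /= mulKg.
Qed.

Lemma mr_ltrans m g X : mr m X -> mr m (ltrans g X).
Proof.
rewrite ltransE; apply: (@mr_img _ _ [:: g]) => [|x y _ _]; last exact: mulgI.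
td.
Qed.

Lemma ltransM g h X : ltrans g (ltrans h X) = ltrans (g * h) X.
Proof. by apply/seteqP; split=> x; rewrite /ltrans /= invgM mulgA. Qed.

Lemma ltrans1 X : ltrans 1 X = X.
Proof. by apply/seteqP; split=> x; rewrite /ltrans /= invg1 mul1g. Qed.

Lemma ltransI g X Y : ltrans g (X `&` Y) = ltrans g X `&` ltrans g Y.
Proof. by []. Qed.

Lemma deg1_ltrans m g P : deg1 m P -> deg1 m (ltrans g P).
Proof.
move=> [dP mP H]; split; [exact: definable_ltrans|exact: mr_ltrans|].
move=> Z dZ m1 m2; apply: (H (ltrans g^-1 Z)); first exact: definable_ltrans.
  have := mr_ltrans g^-1 m1; rewrite ltransI ltransM mulVg ltrans1 //.
have := mr_ltrans g^-1 m2; apply: mr_sub => x.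
by rewrite /ltrans /setD /= invgK mulKg.
Qed.

Section Group.
Variables (K : set G) (A0 : seq G) (kap : nat).
Hypotheses (Ksub : subgroup K) (dK : def_over A0 K) (mK : mr kap K)
  (nK : ~ mr kap.+1 K).

Let K1 : K 1. Proof. by case: Ksub. Qed.
Let KM x y : K x -> K y -> K (x * y). Proof. by case: Ksub => _ h _; apply: h. Qed.
Let KV x : K x -> K x^-1. Proof. by case: Ksub => _ _; apply. Qed.

Lemma rkK m x A : K x -> {subset A0 <= A} -> rk m x A -> m <= kap.
Proof.
move=> Kx sA /rkP r; rewrite leqNgt; apply/negP => lt; apply: nK.
by apply: (mr_le lt); apply: r => //; apply: def_over_sub dK.
Qed.

Lemma rkK_indep x A b : K x -> {subset A0 <= A} -> rk kap x (b :: A) -> indep x A b.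
Proof. by move=> Kx sA r m rm; apply: rk_le r; apply: rkK rm. Qed.

Lemma genericK A : {subset A0 <= A} -> exists2 g, rk kap g A & K g.
Proof. by move=> sA; apply: rk_ext mK; apply: def_over_sub dK. Qed.

(* An element of maximal chain length is generic: otherwise multiplying it by
   an independent generic element produces a longer chain. *)
Lemma max_drops_generic s y A bs : max_drops K A0 s -> K y -> {subset A0 <= A} ->
  drops y A bs = s -> rk kap y A.
Proof.
move=> [_ maxs] Ky sA dy; apply: contrapT => ny.
have [|g rg Kg] := @genericK (y :: bs ++ A).
  by move=> x /sA xA; rewrite !(inE, mem_cat) xA !orbT.
have indg C : {subset A0 <= C} -> {subset C <= bs ++ A} -> indep y C g.
  move=> s1 s2; apply: indep_sym; apply: rkK_indep => //.
  by apply: rk_sub rg; apply: sub_cons2.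
suff : s < drops (g * y) A (g :: bs) by rewrite ltnNge maxs //; apply: KM.
(* The additional drop: [g * y] is generic over [A], but over [g :: A] it has only the rank of
   [y]. *)
rewrite /=; have -> : `[< drop_at (g * y) A g >] = true.
  apply/asboolP => ind; apply: ny.
  have r1 : rk kap (g * y) A.
    apply: (@rk_sub _ _ _ (y :: bs ++ A)); last by apply: rk_mulr rg; exact: mem_head.
    by move=> x xA; rewrite !(inE, mem_cat) xA !orbT.
  have := rk_mulVl (mem_head _ _) (ind _ r1).
  by apply: rk_sub; exact: sub_cons.
rewrite add1n ltnS -dy.
(* Along the chain [g] stays independent of [y], so [g * y] repeats every drop of [y] once [g] is in
   the base. *)
apply: (drops_le (S := fun A1 A' => [/\ {subset A0 <= A1}, {subset A1 <= bs ++ A} &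
   g :: A1 =i A'])).
  by split=> //; exact: sub_catr.
move=> A1 A' b bb [s1 s2 E].
have E' : g :: b :: A1 =i b :: A' by move=> x; rewrite !inE -E inE orbCA.
have s3 : {subset A0 <= b :: A1} by move=> x /s1; exact: sub_cons.
have s4 : {subset b :: A1 <= bs ++ A}.
  by move=> x; rewrite inE => /orP[/eqP->|/s2//]; rewrite mem_cat bb.
split=> // /drop_atP[m r nr]; apply/drop_atP; exists m.
  rewrite -(rk_eqbase _ _ E); apply: rk_mull; first exact: mem_head.
  exact: indg r.
rewrite -(rk_eqbase _ _ E') => h; apply: nr.
have := rk_mulVl (mem_head _ _) h; apply: rk_sub; exact: sub_cons.
Qed.

(** An element and its image determine each other up to finitely many choices, so their ranks drop
    together; apply this to an element of maximal chain length. *)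
Lemma mr_finite_fibre (f : G -> G) : (forall x, K x -> K (f x)) ->
  pred_over A0 (fun v => v 0%N = f (v 1%N)) ->
  (forall y, ~ mr 1 [set x | K x /\ f x = y]) -> mr kap (f @` K).
Proof.
move=> fK df fin.
have [|s ms] := @max_drops_ex K A0; first by exists 1.
have [[d [A [bs [Kd sA dd]]]] maxs] := ms.
have dfA := pred_over_sub sA df.
suff le : drops d A bs <= drops (f d) A bs.
  have r : rk kap (f d) A.
    apply: (max_drops_generic ms (bs := bs)); [exact: fK|exact: sA|].
    apply/eqP; rewrite eqn_leq; apply/andP; split; last by rewrite -dd.
    by apply: maxs => //; apply: fK.
  have /rkP := r; apply; last by exists d.
  have dKA := def_over_sub sA dK; apply/def_overP.
  have := codef_ex (P := fun x v => K x /\ v 0%N = f x)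
    (Q := fun x v => K x /\ v 0%N = f x) (codef_and (proj1 (def_overP _ _) dKA)
      (codef_reindex (fun n => if n is 0%N then 1%N else if n is 1%N then 0%N else n) dfA)).
  by apply: codef_ext => v; split=> [[x [? ->]]|[x ? <-]]; exists x.
apply: (drops_le (S := fun A1 A2 => {subset A0 <= A1} /\ A1 = A2)) => //.
move=> A1 _ b _ [s1 <-]; split; first by split=> // x /s1; exact: sub_cons.
move=> nd /indepP it; apply: nd; apply: indep_sym.
(* Over its image [d] has rank 0, and nothing can drop from there. *)
have /indepP id : indep d (f d :: A1) b.
  move=> [|m] r; first exact: rk0.
  case: (fin (f d)); apply: (@mr_le _ m.+1) => //.
  have /rkP := r; apply; last by [].
  have s2 : {subset A0 <= f d :: A1} by move=> x /s1; exact: sub_cons.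
  have dK' := def_over_sub s2 dK; have df' := pred_over_sub s2 df.
  apply/def_overP; apply: codef_and; first exact/def_overP.
  apply: codef_eq; last by apply: cofun_const; exact: mem_head.
  exact: (cofun_fun df' (cofun_var _ _ _ _ 0%N)).
move=> m r; have := id _ (it _ r); apply: rk_sub => x.
by rewrite !inE => /orP[->//|->]; rewrite !orbT.
Qed.

(** With [a] generic in [P] and [b] generic in [Z] over [a], the quotient [a * b^-1] is independent
    of [a]; hence [a] stays generic over it, inside the intersection. *)
Lemma translate_meet P Z : definable N P -> definable N Z -> P `<=` K -> Z `<=` K ->
  mr kap P -> mr kap Z -> exists2 g, K g & mr kap (P `&` ltrans g Z).
Proof.
move=> /definable_def_over[B1 dP] /definable_def_over[B2 dZ] PK ZK mP mZ.
pose A := A0 ++ B1 ++ B2.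
have sA : {subset A0 <= A} by exact: sub_catl.
have dPA : def_over A P by apply: def_over_sub dP => x xB; rewrite !mem_cat xB orbT.
have dZA : def_over A Z by apply: def_over_sub dZ => x xB; rewrite !mem_cat xB !orbT.
have [a ra Pa] := rk_ext dPA mP.
have [b rb Zb] := rk_ext (def_over_sub (@sub_cons a A) dZA) mZ.
have Ka := PK _ Pa; have Kb := ZK _ Zb.
exists (a * b^-1); first by apply: KM => //; apply: KV.
have rg : rk kap (a * b^-1) (a :: A).
  have h := rk_img (f := fun x => a * x^-1); apply: h rb; last by td.
  by move=> x y /mulgI /invg_inj.
have /indep_sym i : indep (a * b^-1) A a.
  by apply: rkK_indep => //; apply: KM => //; apply: KV.
have E : (a * b^-1)^-1 * a = b by rewrite invgM invgK mulgVK.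
move: (a * b^-1) E i {rg} => g E i.
have /rkP := i _ ra; apply; last by split=> //; rewrite /ltrans /= E.
by rewrite /ltrans; td.
Qed.

(** Induction on the rank of [V]: for generic [g], the part of [V] in the translate of [W] by [g]
    has smaller rank. Otherwise [g] would be generic over a point [x] there, and [u^-1 * x] would
    lie in [W] for a generic set of [u]. *)
Lemma avoid_small W : definable N W -> ~ mr kap W -> forall r V, definable N V ->
  ~ mr r V -> exists gs : seq G, (forall g, g \in gs -> K g) /\
    forall y, V y -> exists2 g, g \in gs & ~ W (g^-1 * y).
Proof.
move=> /definable_def_over[B dW] nW; elim=> [|r IH] V dV nV.
  by exists [::]; split=> // y Vy; case: nV; exists y.
have [B' dV'] := definable_def_over dV.
pose A := A0 ++ B ++ B'.
have sA : {subset A0 <= A} by exact: sub_catl.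
have dWA : def_over A W by apply: def_over_sub dW => x xB; rewrite !mem_cat xB orbT.
have dVA : def_over A V by apply: def_over_sub dV' => x xB; rewrite !mem_cat xB !orbT.
have [g rg Kg] := genericK sA.
have dVW : def_over (g :: A) (V `&` ltrans g W) by rewrite /ltrans; td.
have nVW : ~ mr r (V `&` ltrans g W).
  move=> /(rk_ext dVW)[x rx [Vx Wx]].
  have /indep_sym ig : indep x A g.
    move=> m rm; apply: rk_le rx; rewrite leqNgt; apply/negP => lt; apply: nV.
    by have /rkP := rk_le lt rm; apply.
  have mU : mr kap [set u | W (u^-1 * x)].
    have /rkP := ig _ rg; apply; last exact: Wx.
    td.
  apply: nW; have := @mr_img kap (fun u => u^-1 * x) [:: x] _ _ _ mU.
  move=> h; apply: (mr_sub _ (h _ _)); first by move=> _ [u Wu <-].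
    td.
  by move=> u w _ _ /mulIg /invg_inj.
have [gs [Kgs H]] := IH _ (def_over_definable dVW) nVW.
exists (g :: gs); split=> [h|y Vy]; first by rewrite inE => /orP[/eqP->//|/Kgs].
have [Wy|nWy] := pselect (W (g^-1 * y)); last by exists g; rewrite ?mem_head.
by have [//|h hg ?] := H y; exists h; rewrite // inE hg orbT.
Qed.

(** Gives genericity a first-order form: for fixed [n] it is a condition on the parameters of [W]
    and [Z]. *)
Fixpoint cov n (W Z : set G) : Prop :=
  if n is n'.+1 then exists2 x, K x & cov n' (W `\` ltrans x Z) Z
  else forall y, ~ W y.

Lemma cov_seq (gs : seq G) W Z : (forall g, g \in gs -> K g) ->
  (forall y, W y -> exists2 g, g \in gs & Z (g^-1 * y)) -> cov (size gs) W Z.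
Proof.
elim: gs W => [|g gs IH] W Kgs H /=; first by move=> y /H[].
exists g; first by apply: Kgs; rewrite mem_head.
apply: IH => [h hg|y [Wy nZ]]; first by apply: Kgs; rewrite inE hg orbT.
by have [h] := H _ Wy; rewrite inE => /orP[/eqP->//|]; exists h.
Qed.

Lemma covW n k W Z : n <= k -> cov n W Z -> cov k W Z.
Proof.
elim: k n W => [|k IH] [|n] W //= nk h.
  exists 1; first exact: K1.
  by apply: (IH 0%N) => //= y [/h].
by case: h => x Kx h; exists x => //; apply: IH h.
Qed.

Lemma cov_mr n W Z : definable N W -> definable N Z -> cov n W Z -> mr kap W ->
  mr kap Z.
Proof.
move=> dW dZ; elim: n W dW => [|n IH] W dW /=.
  by move=> h /mr0[y /h].
move=> [x Kx h] mW.
have dx := definable_ltrans x dZ.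
have [|||h1|h1] := @mr_union kap (W `\` ltrans x Z) (ltrans x Z).
- exact: definableD.
- by [].
- by apply: mr_sub mW => y Wy; have [?|?] := pselect (ltrans x Z y); [right|left].
- by apply: IH h h1; apply: definableD.
- by have := mr_ltrans x^-1 h1; rewrite ltransM mulVg ltrans1.
Qed.

Lemma generic_cov Z : definable N Z -> Z `<=` K -> mr kap Z -> exists n, cov n K Z.
Proof.
move=> dZ ZK mZ; have dK' := def_over_definable dK.
have [n0 Hn0] : exists n, ~ splits kap n K.
  by apply/existsNP => h; apply: nK; apply: splits_mrS.
have [k [P [HP HC]]] := decomp dK' Hn0.
have ex l : exists g, l < k -> K g /\ mr kap (P l `&` ltrans g Z).
  have [lk|] := boolP (l < k); last by exists 1.
  have [[dP mP _] sP] := HP _ lk.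
  by have [g Kg mg] := translate_meet dP dZ sP ZK mP mZ; exists g.
have [g Hg] := choice ex.
pose gs := mkseq g k.
have dU : definable N [set y | exists2 h, h \in gs & Z (h^-1 * y)].
  elim: gs => [|h hs IH].
    suff -> : [set y | exists2 h, h \in [::] & Z (h^-1 * y)] = ~` setT.
      by apply: definableC; exact: definableT.
    by apply/seteqP; split=> y => [[]//|]; case.
  have -> : [set y | exists2 h', h' \in h :: hs & Z (h'^-1 * y)] =
      ltrans h Z `|` [set y | exists2 h, h \in hs & Z (h^-1 * y)].
    apply/seteqP; split=> y.
      by move=> [h']; rewrite inE => /orP[/eqP->|h1 h2]; [left|right; exists h'].
    by move=> [h1|[h' h1 h2]]; [exists h; rewrite ?mem_head|
      exists h'; rewrite // inE h1 orbT].
  by apply: definableU => //; apply: definable_ltrans.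
pose W := K `\` [set y | exists2 h, h \in gs & Z (h^-1 * y)].
have dW : definable N W by apply: definableD.
have nW : ~ mr kap W.
  move=> mW; have [|l lk ml] := HC W dW.
    by apply: mr_sub mW => x Wx; split=> //; case: Wx.
  have [_ mg] := Hg _ lk; have [[dP _ H] _] := HP _ lk.
  apply: (H _ (definable_ltrans (g l) dZ)) => //.
  apply: mr_sub ml => x [[Kx nx] Px]; split=> // zx; apply: nx.
  by exists (g l) => //; apply: map_f; rewrite mem_iota.
(* The part [W] missed by the translates in [gs] is not generic, so every point of [K] has a
   translate by some [hs] outside [W], hence covered. *)
have [hs [Khs H]] := avoid_small dW nW dK' nK.
exists (size [seq h * h' | h <- hs, h' <- gs]); apply: cov_seq.
  move=> _ /allpairsP[[h h'] /= [hh /mapP[l + ->] ->]].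
  rewrite mem_iota => /andP[_ lk]; apply: KM; first exact: Khs.
  by case: (Hg l lk).
move=> y Ky; have [h hh nWy] := H _ Ky.
have [h' hh' Zh] : exists2 h', h' \in gs & Z (h'^-1 * (h^-1 * y)).
  apply: contrapT => nz; apply: nWy; split=> //.
  by apply: KM => //; apply: KV; apply: Khs.
by exists (h * h'); [exact: allpairs_f|rewrite invgM -mulgA].
Qed.

Lemma cov_pred_over A n (Wp Zp : (nat -> G) -> set G) : {subset A0 <= A} ->
  pred_over A (fun v => Wp (fun n => v n.+1) (v 0%N)) ->
  pred_over A (fun v => Zp (fun n => v n.+1) (v 0%N)) -> pred_over A (fun v => cov n (Wp v) (Zp v)).
Proof.
move=> sA; elim: n Wp Zp => [|n IH] Wp Zp dW dZ.
  exact: (codef_all (P := fun x v => ~ Wp v x) (Q := fun x v => ~ Wp v x) (codef_not dW)).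
have dK' := proj1 (def_overP _ _) (def_over_sub sA dK).
have dZ' := codef_reindex (fun n => if n is m.+1 then m.+2 else 0%N) dZ.
have dW' := codef_reindex (fun n => if n is m.+1 then m.+2 else 0%N) dW.
have dZ3 := codef_reindex (fun n => if n is m.+1 then m.+3 else 0%N) dZ.
have H := IH (fun w => Wp (fun n => w n.+1) `\` ltrans (w 0%N) (Zp (fun n => w n.+1)))
  (fun w => Zp (fun n => w n.+1)).
have := codef_ex (P := fun x v => K x /\ cov n (Wp v `\` ltrans x (Zp v)) (Zp v))
  (Q := fun x v => K x /\ cov n (Wp v `\` ltrans x (Zp v)) (Zp v)) (codef_and dK' (H _ _)).
move=> h; apply: codef_ext (h _ _) => [v|v||].
- by split=> [[x []]|[x]]; exists x.
- by split=> [[x []]|[x]]; exists x.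
- apply: codef_and => //; apply: codef_not.
  apply: (codef_subst (P := fun z v => Zp (fun n => v n.+2) z)
    (Q := fun z v => Zp (fun n => v n.+2) z)) => //.
  ftt.
- exact: dZ'.
Qed.

Lemma splits_seq m (Q : nat -> set G) n X : definable N X ->
  (forall i, definable N (Q i)) ->
  (forall i j, i <> j -> ~ mr m (Q i `&` Q j)) ->
  (forall i, mr m (X `&` Q i)) -> splits m n X.
Proof.
elim: n X Q => [//|n IH] X Q dX dQ disj mQ.
have d0 := definableI dX (dQ 0%N).
exists (X `&` Q 0%N); split=> //; do ?by move=> x [].
apply: (IH _ (fun i => Q i.+1)) => //; first exact: definableD.
  by move=> i j ij; apply: disj => -[].
move=> i; have [|||h|h] := @mr_union m ((X `\` (X `&` Q 0%N)) `&` Q i.+1)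
    (Q 0%N `&` Q i.+1).
- by apply: definableI => //; apply: definableD.
- exact: definableI.
- apply: mr_sub (mQ i.+1) => x [Xx Qx].
  by have [q0|q0] := pselect (Q 0%N x); [right|left; split=> //; split=> // -[]].
- by [].
- by case: (@disj 0%N i.+1).
Qed.

Lemma infinite_seq (T : Type) (S : set T) : infinite_set S ->
  exists2 f : nat -> T, injective f & forall n, S (f n).
Proof.
move=> /infiniteP /card_leP[f].
pose u (n : nat) : [set: nat] := exist _ n (mem_set I).
exists (fun n => \val (f (u n))); last by move=> n; apply: set_mem; exact: valP.
move=> i j /val_inj E.
by have /(congr1 val) : u i = u j by apply: (@inj _ _ _ f) => //; rewrite inE.
Qed.

Hypothesis Kconn : connected N K.

(** The stabiliser of [P] up to smaller rank is a definable subgroup of finite index, hence all of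
    [K]. *)
Lemma stab_all P : deg1 kap P -> P `<=` K -> forall g, K g ->
  mr kap (P `&` ltrans g P).
Proof.
move=> dgP PK; have [dP mP HP] := dgP.
have [B dB] := definable_def_over dP; pose A := A0 ++ B.
have sA : {subset A0 <= A} by exact: sub_catl.
have dPA : def_over A P by apply: def_over_sub dB; exact: sub_catr.
have dKA : def_over A K by exact: def_over_sub sA dK.
clear dB.
pose F1 n g := cov n K (P `&` ltrans g P).
pose F2 n g := cov n K (P `\` ltrans g P).
have dF1 n : def_over A [set g | F1 n g].
  apply/def_overP; apply: (@cov_pred_over A n (fun=> K) (fun v => P `&` ltrans (v 0%N) P)) => //.
    exact/def_overP.
  by rewrite /ltrans; td.
have dF2 n : def_over A [set g | F2 n g].
  apply/def_overP; apply: (@cov_pred_over A n (fun=> K) (fun v => P `\` ltrans (v 0%N) P)) => //.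
    exact/def_overP.
  by rewrite /ltrans; td.
have dgt g := definable_ltrans g dP.
have F12 g : exists n, F1 n g \/ F2 n g.
  have [|||h|h] := @mr_union kap (P `&` ltrans g P) (P `\` ltrans g P).
  - exact: definableI.
  - exact: definableD.
  - by apply: mr_sub mP => x Px; have [?|?] := pselect (ltrans g P x); [left|right].
  - have [||n Hn] := @generic_cov _ _ _ h; first exact: definableI.
      by move=> x [/PK].
    by exists n; left.
  - have [||n Hn] := @generic_cov _ _ _ h; first exact: definableD.
      by move=> x [/PK].
    by exists n; right.
(* If no [n] served every [g], saturation would yield a [g] escaping all [F1 n] and [F2 n]. The
   uniform bound makes the stabiliser definable. *)
have [n Hn] : exists n, forall g, F1 n g \/ F2 n g.
  apply: contrapT => nn.
  pose D n := [set g | ~ F1 n g] `&` [set g | ~ F2 n g].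
  have [||||g Hg] := @sat_filter A [set Y | Y = setT \/ exists n, Y = D n].
  - by left.
  - move=> Y [->|[n ->]]; first exact: def_overT.
    exact: (def_overI (def_overC (dF1 n)) (def_overC (dF2 n))).
  - move=> Y Z [->|[n ->]] [->|[k ->]]; rewrite ?setIT ?setTI; first by left.
    + by right; exists k.
    + by right; exists n.
    right; exists (maxn n k); apply/seteqP; split=> g.
      by case: (leqP n k) => _ [].
    move=> [h1 h2]; split; split=> h'; [apply: h1|apply: h2|apply: h1|apply: h2];
      by apply: covW h'; rewrite ?leq_maxl ?leq_maxr.
  - move=> Y [->|[n ->]]; first by exists 1.
    apply: contrapT => h; apply: nn; exists n => g; apply: contrapT => h'.
    by apply: h; exists g; split=> ?; apply: h'; [left|right].
  have [n Hn] := F12 g.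
  have [h1 h2] : D n g by apply: Hg; right; exists n.
  by case: Hn.
have F1P g : F1 n g <-> mr kap (P `&` ltrans g P).
  have dK' := def_over_definable dK; split=> [h|h].
    by apply: cov_mr h mK => //; apply: definableI.
  have [//|h2] := Hn g; exfalso; apply: (HP _ (dgt g) h).
  by apply: cov_mr h2 mK => //; apply: definableD.
pose St := [set g | K g /\ F1 n g].
have StV g : St g -> St g^-1.
  move=> [Kg /F1P h]; split; first exact: KV.
  apply/F1P; have := mr_ltrans g^-1 h.
  by rewrite ltransI ltransM mulVg ltrans1 setIC.
have StM g h : St g -> St h -> St (g * h).
  move=> [Kg /F1P mg] [Kh /F1P mh]; split; first exact: KM.
  have := mr_ltrans g mh; rewrite ltransI ltransM => mgh.
  have := deg1_meet (deg1_ltrans g dgP) dP (dgt (g * h)).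
  rewrite setIC => /(_ mg mgh) h'; apply/F1P; apply: mr_sub h' => x [] //.
suff <- : St = K by move=> g0 [_ /F1P].
apply: Kconn.
- apply: (@def_over_definable A); apply: def_overI => //; exact: dF1.
- split=> //; split; first exact: K1.
  by apply/F1P; rewrite ltrans1 setIid.
- by move=> x [].
apply: contrapT => /infinite_seq[f fi fS].
have ex i : exists x, K x /\ right_coset St x = f i.
  by have [x Kx E] := fS i; exists x.
have [x Hx] := choice ex.
(* Translates of [P] belonging to distinct cosets meet in rank below [kap]; infinitely many of them
   would raise the rank of [K]. *)
apply: nK; apply: splits_mrS; first exact: def_over_definable dK.
move=> k; apply: (@splits_seq _ (fun i => ltrans (x i)^-1 P)); first exact: def_over_definable dK.
- by move=> i; exact: dgt.
- move=> i j ij mij; apply: ij; apply: fi.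
  have [Ki <-] := Hx i; have [Kj <-] := Hx j.
  have Sij : St (x i * (x j)^-1).
    split; first by apply: KM => //; apply: KV.
    apply/F1P; have := mr_ltrans (x i) mij.
    by rewrite ltransI !ltransM mulgV ltrans1.
  apply/seteqP; split=> _ [h Sh <-].
    by exists (h * (x i * (x j)^-1)); [exact: StM|rewrite -!mulgA mulVg mulg1].
  exists (h * (x i * (x j)^-1)^-1); first by apply: StM => //; apply: StV.
  by rewrite invgM invgK -!mulgA mulVg mulg1.
- move=> i; have [Ki _] := Hx i.
  apply: mr_sub (mr_ltrans (x i)^-1 mP) => y Py; split=> //.
  rewrite -(mulKg (x i) y); apply: KM; first exact: KV.
  by apply: PK; move: Py; rewrite /ltrans /= invgK.
Qed.

(** Connected groups have Morley degree one: take degree-one pieces of both sets, translate one to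
    meet the other, and use that its translates agree generically. *)
Lemma conn_meet X Y : definable N X -> definable N Y -> X `<=` K -> Y `<=` K ->
  mr kap X -> mr kap Y -> mr kap (X `&` Y).
Proof.
move=> dX dY XK YK mX mY.
have nsub Z : Z `<=` K -> ~ mr kap.+1 Z by move=> s /(mr_sub s).
have [P dgP PX] := deg1_exists dX mX (nsub _ XK).
have [Q dgQ QY] := deg1_exists dY mY (nsub _ YK).
have PK := subset_trans PX XK; have QK := subset_trans QY YK.
have [dP mP _] := dgP; have [dQ mQ _] := dgQ.
have [g Kg m1] := translate_meet dP dQ PK QK mP mQ.
have m2 := stab_all dgQ QK Kg.
rewrite setIC in m1; rewrite setIC in m2.
have := deg1_meet (deg1_ltrans g dgQ) dP dQ m1 m2.
by apply: mr_sub => x [_ [/PX ? /QY ?]].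
Qed.

Lemma conn_sub H : definable N H -> subgroup H -> H `<=` K -> mr kap H -> H = K.
Proof.
move=> dH [H1 HM HV] HK mH; apply/seteqP; split=> // x Kx.
apply: contrapT => nHx.
have [|y [Hy Hxy]] := mr0 (conn_meet dH (definable_ltrans x dH) HK _ mH (mr_ltrans x mH)).
  by move=> y /HK h; rewrite -(mulVKg x y); apply: KM.
apply: nHx; rewrite -(invgK x) -(mulgK y x^-1).
exact: (HV _ (HM _ _ Hxy (HV _ Hy))).
Qed.

End Group.

Lemma drops_le2 (S : seq G -> seq G -> seq G -> Prop) a a1 a2 bs A A1 A2 :
  S A A1 A2 ->
  (forall A A1 A2 b, b \in bs -> S A A1 A2 -> S (b :: A) (b :: A1) (b :: A2) /\
    (drop_at a A b -> drop_at a1 A1 b \/ drop_at a2 A2 b)) ->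
  drops a A bs <= drops a1 A1 bs + drops a2 A2 bs.
Proof.
elim: bs A A1 A2 => [|b bs IH] A A1 A2 SA H //=.
have [SA' h] := H _ _ _ b (mem_head _ _) SA.
rewrite addnACA; apply: leq_add; last first.
  by apply: IH => // B B' B'' c cb; apply: H; rewrite inE cb orbT.
case: (asboolP (drop_at a A b)) => // /h [] /asboolP -> //.
by rewrite addnC.
Qed.

Lemma rk_mulVr m A g a : g \in A -> rk m (a * g) A -> rk m a A.
Proof.
move=> gA h; rewrite -(mulgK g a); move: h.
by apply: (rk_img (f := fun x => x * g^-1)); [exact: mulIg|td].
Qed.

(* The conjugates of [Y0] are parametrised, up to finite index, by the cosets
   of [H]; comparing rank drops along chains replaces additivity of the rank. *)
Lemma conjugates_generic (H Y0 : set G) A0 nu n0 :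
  subgroup H -> def_over A0 H -> mr nu H -> ~ mr nu.+1 H ->
  mr n0 setT -> ~ mr n0.+1 [set: G] -> def_over A0 Y0 ->
  (forall h y, H h -> Y0 y -> Y0 (y ^ h)) ->
  (forall h, H h -> exists2 a, a \in A0 & Y0 (h * a)) ->
  (forall y, ~ mr nu.+1 [set u | Y0 (y ^ u^-1)]) ->
  mr n0 [set y | exists u, Y0 (y ^ u^-1)].
Proof.
move=> Hsub dH mH nH mT nT dY Yinv Ycov Yfib.
have [H1 HM HV] := Hsub.
have [|s maxG] := @max_drops_ex setT A0; first by exists 1.
have [|sH maxH] := @max_drops_ex H A0; first by exists 1.
have [[g [A [bs [_ sA drg]]]] maxs] := maxG.
(* The base of the chain of [h] contains [g] and its whole chain, so that the two chains can be
   concatenated. *)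
have [h [C [cs [Hh s0C sEC drh]]]] := max_drops_base (g :: bs ++ A) dH maxH.
have gC : g \in C by apply: sEC; rewrite mem_head.
have bC : {subset bs <= C} by move=> x xb; apply: sEC; rewrite !(inE, mem_cat) xb orbT.
have AC : {subset A <= C} by move=> x xb; apply: sEC; rewrite !(inE, mem_cat) xb !orbT.
have [a aA0 Yc] := Ycov _ Hh; set c := h * a in Yc.
pose y := c ^ g.
have dry : sH <= drops y C cs.
  rewrite -drh; apply: (drops_le (S := fun A B => A = B /\ {subset C <= A})); first by split.
  move=> A1 _ b _ [<- s1]; split; first by split=> // x /s1; exact: sub_cons.
  have aA1 : a \in A1 by apply/s1/s0C.
  have gA1 : g \in A1 by apply/s1.
  move=> /drop_atP[m r nr]; apply/drop_atP; exists m.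
    by apply: rk_conj => //; apply: rk_mulr.
  move=> r'; apply: nr; apply: (@rk_mulVr _ _ a); first by rewrite inE aA1 orbT.
  by apply: (@rk_conjV _ _ g); first by rewrite inE gA1 orbT.
pose F := y :: c :: g :: cs ++ C.
have s0F : {subset A0 <= F} by move=> x /s0C xC; rewrite !(inE, mem_cat) xC !orbT.
have CF : {subset C <= F} by move=> x xC; rewrite !(inE, mem_cat) xC !orbT.
have [k rk' Hk] := rk_ext (def_over_sub s0F dH) mH.
have rg1 : rk nu (k * g) F by apply: rk_mulr => //; exact: CF.
have Yg1 : Y0 (y ^ (k * g)^-1).
  rewrite invgM /y conjgM conjgK; apply: Yinv => //; exact: HV.
have gE : k^-1 * (k * g) = g by rewrite mulKg.
move: (k * g) rg1 Yg1 gE => g1 rg1 Yg1 gE.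
(* Write [g = k^-1 * g1] with [k] generic in [H]. Given [y], the element [g1] is generic in its
   fibre, hence independent of the members of the chain; so a drop of [g] is a drop of [y] or of
   [k^-1]. *)
have le : drops g A bs <= drops y A bs + drops k^-1 (g1 :: A) bs.
  apply: (drops_le2 (S := fun A1 A2 A3 => [/\ {subset A0 <= A1}, {subset A1 <= C},
      A1 = A2 & g1 :: A1 =i A3])) => //.
  move=> A1 _ A3 b bb [s1 s2 <- E]; split.
    split=> //; first by move=> x /s1; exact: sub_cons.
      by move=> x; rewrite inE => /orP[/eqP->|/s2//]; exact: bC.
    by move=> x; rewrite !inE -E inE orbCA.
  move=> nd; apply: contrapT => nn; apply: nd; apply: indep_sym.
  have iy : indep b A1 y by apply: indep_sym; apply: contrapT => h'; apply: nn; left.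
  have ik : indep b A3 k^-1 by apply: indep_sym; apply: contrapT => h'; apply: nn; right.
  have ig : indep b (y :: A1) g1.
    apply: indep_sym => m r; apply: (@rk_le _ nu).
      rewrite leqNgt; apply/negP => lt; apply: (Yfib y).
      have /rkP := rk_le lt r; apply; last exact: Yg1.
      have dY1 := def_over_sub s1 dY; td.
    apply: rk_sub rg1 => x; rewrite 2!inE => /or3P[/eqP->|/eqP->|/s2/CF//].
      by apply/CF/bC.
    by rewrite /F mem_head.
  move=> m /iy /ig r.
  have r3 : rk m b A3.
    apply: rk_sub r => x; rewrite -E !inE => /orP[->//|->]; by rewrite !orbT.
  have := ik _ r3; apply: rk_dcl.
    rewrite -gE; apply: cofun_mul; apply: cofun_const; first exact: mem_head.
    by rewrite inE -E mem_head orbT.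
  by move=> x xA; rewrite inE -E inE xA !orbT.
have lek : drops k^-1 (g1 :: A) bs <= sH.
  case: maxH => _; apply; first exact: HV.
  by move=> x /sA; exact: sub_cons.
(* At least [s - sH] drops of [y] occur along [bs], and at least [sH] along [cs], where [y] and [h]
   are interdefinable. *)
have dyA : drops y A (bs ++ C ++ cs) = s.
  apply/eqP; rewrite eqn_leq maxs //= -drg; apply: leq_trans le _.
  rewrite !drops_cat leq_add2l; apply: leq_trans lek (leq_trans dry _).
  rewrite (@drops_eqbase y (catrev C (catrev bs A)) C cs) ?leq_addl // => x.
  rewrite !catrevE !(mem_cat, mem_rev).
  by case: (boolP (x \in C)) => //= /negP nC; apply/negP => /orP[/bC|/AC].
have ry : rk n0 y A.
  apply: (@max_drops_generic setT A0 n0 _ _ mT nT s y A (bs ++ C ++ cs)) => //.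
  exact: def_overT.
have /rkP := ry; apply; last by exists g; rewrite /y conjgK.
have dYA := def_over_sub sA dY; td.
Qed.

(** * Inverted groups and square roots *)

Lemma finite_mr1 X : finite_set X -> ~ mr 1 X.
Proof.
move=> fX [F [tF HF]].
have [x Hx] := choice (fun i => let: And3 _ _ h := HF i in h).
have xi : injective x.
  by move=> i j E; apply: tF => //; exists (x i); split; [exact: Hx|rewrite E; exact: Hx].
apply: infinite_nat; rewrite -(eq_finite_set (@inj_card_eq _ _ setT x _)).
  by apply: sub_finite_set fX => _ [i _ <-]; have [_ s _] := HF i; apply/s/Hx.
by move=> i j _ _; exact: xi.
Qed.

(** The fibres of the commutator map with [t] are cosets of the finite group of fixed points, so its
    image, which consists of inverted elements, is generic. *)
Lemma connected_inverted (K : set G) t : subgroup K -> definable N K -> connected N K ->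
  (forall x, K x -> K (x ^ t)) -> t * t = 1 ->
  finite_set [set x | K x /\ x ^ t = x] -> forall x, K x -> x ^ t = x^-1.
Proof.
move=> Ksub dK Kconn Kt tt fin; have [K1 KM KV] := Ksub.
have [A0 dA0] := definable_def_over dK.
have dKt := def_over_sub (@sub_cons t A0) dA0.
have [|kap [mK nK]] := @exact_rank K; first by exists 1.
have ttJ x : (x ^ t) ^ t = x by rewrite -conjgM tt conjg1.
pose T := [set x | K x /\ x ^ t = x^-1].
have dT : def_over (t :: A0) T by rewrite /T; td.
have dT' := def_over_definable dT.
have TK : T `<=` K by move=> x [].
have mT : mr kap T.
  have sub : (fun x => x^-1 * x ^ t) @` K `<=` T.
    move=> _ [x Kx <-]; split; first by apply: KM; [exact: KV|exact: Kt].
    by rewrite conjMg conjVg ttJ [RHS]invgM invgK.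
  apply: mr_sub sub _; apply: (mr_finite_fibre Ksub dKt mK nK).
  - by move=> x Kx; apply: KM; [exact: KV|exact: Kt].
  - td.
  - move=> y; apply: finite_mr1.
    have [[x0 [Kx0 Ex0]]|n] := pselect (exists x0, K x0 /\ x0^-1 * x0 ^ t = y); last first.
      by apply: (@sub_finite_set _ _ set0) => // x h; apply: n; exists x.
    apply: sub_finite_set (finite_image (fun z => z * x0) fin) => x [Kx Ex] /=.
    exists (x * x0^-1); last by rewrite -mulgA mulVg mulg1.
    split; first by apply: KM => //; exact: KV.
    have E : x ^ t = x * y by rewrite -Ex mulVKg.
    have E0 : x0 ^ t = x0 * y by rewrite -Ex0 mulVKg.
    by rewrite conjMg conjVg E E0 invgM -mulgA mulVKg.
(* If [z] and [s * z] are both inverted, then [z] commutes with [s]; by connectedness such [z] are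
   generic. *)
have comm s x : T s -> K x -> x * s = s * x.
  move=> Ts Kx; have [Ks Es] := Ts.
  pose Cs := [set x | K x /\ x * s = s * x].
  suff ECs : Cs = K by move: Kx; rewrite -ECs => -[].
  have dCs : def_over (s :: t :: A0) Cs by rewrite /Cs; td.
  apply: (conn_sub Ksub dKt mK nK Kconn (def_over_definable dCs)).
  - split=> [|x1 x2 [k1 e1] [k2 e2]|x1 [k1 e1]]; split=> //.
    + by rewrite mulg1 mul1g.
    + exact: KM.
    + by rewrite -mulgA e2 mulgA e1 mulgA.
    + exact: KV.
    + by apply: (mulgI x1); rewrite !mulgA mulgV mul1g e1 mulgK.
  - by move=> z [].
  have dsT := definable_ltrans s^-1 dT'.
  have := conn_meet Ksub dKt mK nK Kconn dT' dsT TK _ mT (mr_ltrans s^-1 mT).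
  have sub : ltrans s^-1 T `<=` K.
    move=> z; rewrite /ltrans /= invgK => -[Kz _].
    by rewrite -(mulKg s z); apply: KM => //; exact: KV.
  move=> /(_ sub); apply: mr_sub => z [[Kz Ez]].
  rewrite /ltrans /= invgK => -[_]; rewrite conjMg Es Ez invgM => E.
  by split=> //; apply: invg_inj; rewrite !invgM E.
have ab x y : K x -> K y -> x * y = y * x.
  move=> Kx Ky.
  pose Z := [set x | K x /\ forall y, K y -> y * x = x * y].
  suff EZ : Z = K by move: Ky; rewrite -EZ => -[_ /(_ _ Kx)].
  have dZ : def_over (t :: A0) Z by rewrite /Z; td.
  apply: (conn_sub Ksub dKt mK nK Kconn (def_over_definable dZ)).
  - split=> [|x1 x2 [k1 e1] [k2 e2]|x1 [k1 e1]].
    + by split=> // z _; rewrite mulg1 mul1g.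
    + split=> [|z Kz]; first exact: KM.
      by rewrite mulgA (e1 z Kz) -mulgA (e2 z Kz) mulgA.
    + split=> [|z Kz]; first exact: KV.
      by apply: (mulgI x1); rewrite !mulgA mulgV mul1g -e1 // mulgK.
  - by move=> z [].
  by apply: mr_sub mT => z Tz; split=> [|w Kw]; [exact: TK|exact: comm].
suff ET : T = K by move=> x; rewrite -ET => -[].
apply: (conn_sub Ksub dKt mK nK Kconn dT') => //.
split=> [|x1 x2 [k1 e1] [k2 e2]|x1 [k1 e1]]; split=> //.
- by rewrite conj1g invg1.
- exact: KM.
- by rewrite conjMg e1 e2 -invgM ab.
- exact: KV.
- by rewrite conjVg e1.
Qed.

Lemma connected_divisible (K : set G) : subgroup K -> definable N K -> connected N K ->
  (forall x y, K x -> K y -> x * y = y * x) ->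
  finite_set [set x | K x /\ x ^+ 2 = 1] ->
  forall x, K x -> exists2 y, K y & y ^+ 2 = x.
Proof.
move=> Ksub dK Kconn ab fin; have [K1 KM KV] := Ksub.
have [A0 dA0] := definable_def_over dK.
have [|kap [mK nK]] := @exact_rank K; first by exists 1.
pose Q := [set x | exists y, K y /\ x = y ^+ 2].
suff EQ : Q = K.
  by move=> x Kx; have [y [Ky ->]] : Q x by [rewrite EQ]; exists y.
have dQ : def_over A0 Q by rewrite /Q; td.
have sqM x y : K x -> K y -> (x * y) ^+ 2 = x ^+ 2 * y ^+ 2.
  by move=> Kx Ky; rewrite expgMn //; exact: ab.
apply: (conn_sub Ksub dA0 mK nK Kconn (def_over_definable dQ)).
- split=> [|_ _ [y [Ky ->]] [z [Kz ->]]|_ [y [Ky ->]]].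
  + by exists 1; rewrite expg1n.
  + by exists (y * z); split; [exact: KM|rewrite sqM].
  + by exists y^-1; split; [exact: KV|rewrite expVgn].
- by move=> _ [y [Ky ->]]; exact: KM.
have := mr_finite_fibre Ksub dA0 mK nK (f := fun x => x ^+ 2) _ _ _.
move=> h; apply: (mr_sub _ (h _ _ _)).
- by move=> _ [y Ky <-]; exists y.
- by move=> x Kx; exact: KM.
- td.
- move=> y; apply: finite_mr1.
  have [[x0 [Kx0 Ex0]]|n] := pselect (exists x0, K x0 /\ x0 ^+ 2 = y); last first.
    by apply: (@sub_finite_set _ _ set0) => // x h'; apply: n; exists x.
  apply: sub_finite_set (finite_image (fun z => z * x0) fin) => x [Kx Ex] /=.
  exists (x * x0^-1); last by rewrite -mulgA mulVg mulg1.
  split; first by apply: KM => //; exact: KV.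
  by rewrite sqM ?expVgn ?Ex ?Ex0 ?mulgV //; exact: KV.
Qed.

Lemma splits_img m n (f : G -> G) B X : pred_over B (fun v => v 0%N = f (v 1%N)) ->
  (forall x y, X x -> X y -> f x = f y -> x = y) -> splits m n X -> splits m n (f @` X).
Proof.
move=> df; elim: n X => [//|n IH] X fi [Y [dY sY mY H]].
exists (f @` Y); split.
- have [C dC] := definable_def_over dY.
  have df' := pred_over_sub (@sub_catl B C) df; have dC' := def_over_sub (@sub_catr B C) dC.
  apply: (@def_over_definable (B ++ C)); apply/def_overP.
  have := codef_ex (P := fun x v => Y x /\ v 0%N = f x)
    (Q := fun x v => Y x /\ v 0%N = f x) (codef_and (proj1 (def_overP _ _) dC')
      (codef_reindex (fun n => if n is 0%N then 1%N else if n is 1%N then 0%N else n) df')).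
  by apply: codef_ext => v; split=> [[x [? ->]]|[x ? <-]]; exists x.
- by move=> _ [x /sY ? <-]; exists x.
- by apply: (mr_img df) mY => x y /sY ? /sY ?; exact: fi.
- have := IH (X `\` Y) (fun x y h1 h2 => fi x y h1.1 h2.1) H.
  apply: splits_sub => _ [x [Xx nY] <-]; split; first by exists x.
  by move=> [y Yy E]; apply: nY; rewrite (fi x y) //; exact: sY.
Qed.

(** No connectedness here. Squaring is injective; if it missed a point, its image would miss a coset
    of the same rank, and iterating would give [K] infinite degree. *)
Lemma sqrt_of_no_involution (K : set G) : subgroup K -> definable N K ->
  (forall x y, K x -> K y -> x * y = y * x) ->
  (forall x, K x -> x ^+ 2 = 1 -> x = 1) ->
  forall x, K x -> exists2 y, K y & y ^+ 2 = x.
Proof.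
move=> Ksub dK ab inv; have [K1 KM KV] := Ksub.
have [|kap [mK nK]] := @exact_rank K; first by exists 1.
pose f (x : G) := x ^+ 2.
have df : pred_over [::] (fun v => v 0%N = f (v 1%N)) by rewrite /f; td.
have sqM x y : K x -> K y -> (x * y) ^+ 2 = x ^+ 2 * y ^+ 2.
  by move=> Kx Ky; rewrite expgMn //; exact: ab.
have fi x y : K x -> K y -> f x = f y -> x = y.
  move=> Kx Ky E; apply: (mulIg y^-1); rewrite mulgV; apply: inv.
    by apply: KM => //; exact: KV.
  by rewrite sqM ?expVgn -/(f x) ?E ?mulgV //; exact: KV.
move=> a Ka; apply: contrapT => na.
have mQ := mr_img df fi mK.
have sQ : f @` K `<=` K by move=> _ [x Kx <-]; exact: KM.
have mD : mr kap (K `\` f @` K).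
  apply: mr_sub (mr_ltrans a mQ) => x [y Ky Ey]; split.
    by rewrite -(mulVKg a x) -Ey; apply: (KM) => //; exact: KM.
  move=> [z Kz Ez]; apply: na; exists (z * y^-1); first by apply: KM => //; exact: KV.
  rewrite sqM ?expVgn -/(f z) -/(f y) ?Ez ?Ey ?invgM ?invgK; last exact: KV; last by [].
  by rewrite mulVKg.
have dQ : definable N (f @` K).
  have [A dA] := definable_def_over dK; apply: (@def_over_definable A).
  suff -> : f @` K = [set x | exists y, K y /\ x = y ^+ 2] by td.
  by apply/seteqP; split=> x [y]; [move=> ? <-; exists y|move=> [? ->]; exists y].
apply: nK; apply: splits_mrS => // n; elim: n => [//|n IH].
exists (K `\` f @` K); split=> //; first exact: definableD.
apply: splits_sub (splits_img df fi IH) => x Qx; split; first exact: sQ.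
by case.
Qed.

(** * The geometry of involutions *)

Section Main.
Implicit Types (D : set G) (x y g h t i j k l p q : G).
Hypothesis Gconn : connected N [set: G].
Hypothesis hinv : exists i : G, involution i.
Variable C : set G.
Hypotheses (Cdef : definable N C) (Csub : subgroup C) (Cconn : connected N C)
  (Cproper : C <> [set: G]) (CTI : TI C) (Casn : almost_self_normalising C).
(** What is kept of [U2perp], which quantifies over arbitrary subgroups. In an abelian [C] the
    elements of order at most two form a subgroup; commutativity is obtained in
    [conjugate_abelian]. *)
Hypothesis Cfin2 : (forall x y, C x -> C y -> x * y = y * x) ->
  finite_set [set x | C x /\ x ^+ 2 = 1].
Hypothesis Creal : [set x : G | strongly_real x] `<=` \bigcup_(g in [set: G]) conj_set C g.

Lemma conj_setP D h x : conj_set D h x <-> D (x ^ h^-1).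
Proof.
split=> [[y Dy <-]|Dx]; first by rewrite conjgK.
by exists (x ^ h^-1); rewrite ?conjgKV.
Qed.

Lemma conj_set_ext D D' : (forall x, D x <-> D' x) -> D = D'.
Proof. by move=> E; apply/seteqP; split=> x /E. Qed.

Lemma conj_setM D g h : conj_set (conj_set D g) h = conj_set D (g * h).
Proof.
by apply: conj_set_ext => x; rewrite !conj_setP invgM -conjgM.
Qed.

Lemma conj_set1 D : conj_set D 1 = D.
Proof. by apply: conj_set_ext => x; rewrite conj_setP invg1 conjg1. Qed.

Lemma mem_conj_set D g x : D x -> conj_set D g (x ^ g).
Proof. by exists x. Qed.

Definition conjugate D : Prop := exists g, D = conj_set C g.

Lemma conjugate_conj D h : conjugate D -> conjugate (conj_set D h).
Proof. by move=> [g ->]; exists (g * h); rewrite conj_setM. Qed.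

Lemma subgroup_conj D h : subgroup D -> subgroup (conj_set D h).
Proof.
move=> [D1 DM DV]; split=> [|x y|x]; rewrite !conj_setP.
- by rewrite conj1g.
- by rewrite conjMg; exact: DM.
- by rewrite conjVg; exact: DV.
Qed.

Lemma conjugate_sub D : conjugate D -> subgroup D.
Proof. by move=> [g ->]; exact: subgroup_conj. Qed.

Lemma definable_conj D h : definable N D -> definable N (conj_set D h).
Proof.
move=> /definable_def_over[A dA]; apply: (@def_over_definable (h :: A)).
have -> : conj_set D h = [set x | D (x ^ h^-1)].
  by apply: conj_set_ext => x; rewrite conj_setP.
td.
Qed.

Lemma conjugate_def D : conjugate D -> definable N D.
Proof. by move=> [g ->]; exact: definable_conj. Qed.

Lemma conjugate_conn D : conjugate D -> connected N D.
Proof.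
move=> [g ->] H dH sH HD fin.
suff <- : conj_set H g^-1 = C by rewrite conj_setM mulVg conj_set1.
apply: Cconn.
- exact: definable_conj.
- exact: subgroup_conj.
- by move=> x /conj_setP /HD /conj_setP; rewrite invgK conjgK.
apply: sub_finite_set (finite_image (fun S => conj_set S g^-1) fin).
move=> _ [x Cx <-]; exists (right_coset H (x ^ g)).
  by exists (x ^ g) => //; exact: mem_conj_set.
apply: conj_set_ext => y; rewrite conj_setP invgK; split.
  move=> [h Hh E]; exists (h ^ g^-1); first exact: mem_conj_set.
  by rewrite -(conjgK g y) -E conjMg conjgK.
by move=> [_ [h Hh <-] <-]; exists h => //; rewrite conjMg conjgKV.
Qed.

Lemma conjugate_TI D D' x : conjugate D -> conjugate D' -> x <> 1 -> D x -> D' x -> D = D'.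
Proof.
move=> [g ->] [h ->] x1 /conj_setP gx /conj_setP hx; apply: contrapT => ne.
have [E|E] := pselect (conj_set C (h * g^-1) = C).
  by apply: ne; rewrite -{1}E conj_setM mulgVK.
have : (C `&` conj_set C (h * g^-1)) (x ^ g^-1).
  by split=> //; apply/conj_setP; rewrite invgM invgK -conjgM mulKg.
rewrite CTI // => /(congr1 (fun z => z ^ g)); rewrite conjgKV conj1g.
by move=> /x1.
Qed.

Lemma conjugate_norm D x t : conjugate D -> x <> 1 -> D x -> D (x ^ t) -> conj_set D t = D.
Proof.
move=> dD x1 Dx Dxt; apply: (conjugate_TI (x := x ^ t)) => //; first exact: conjugate_conj.
  by move=> /(congr1 (fun z => z ^ t^-1)); rewrite conjgK conj1g.
exact: mem_conj_set.
Qed.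

Lemma norm_mem D t x : conj_set D t = D -> D x -> D (x ^ t).
Proof. by move=> E Dx; have := mem_conj_set t Dx; rewrite E. Qed.

Lemma finite_index_reps (H K : set G) : subgroup H -> finite_index H K ->
  exists ns : seq G, forall t, K t -> exists2 n, n \in ns & H (t * n^-1).
Proof.
move=> [H1 _ _] fin.
have ex (S : set G) : exists x, (exists t, right_coset H t = S) -> right_coset H x = S.
  have [[t <-]|n] := pselect (exists t, right_coset H t = S); first by exists t.
  by exists 1.
have [r Hr] := choice ex.
have /finite_seqP[ns Ens] := finite_image r fin.
exists ns => t Kt; exists (r (right_coset H t)).
  suff : [set` ns] (r (right_coset H t)) by [].
  by rewrite -Ens; exists (right_coset H t) => //; exists t.
have E : right_coset H (r (right_coset H t)) = right_coset H t by apply: Hr; exists t.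
have [h Hh Eh] : right_coset H (r (right_coset H t)) t.
  by rewrite E; exists 1; rewrite ?mul1g.
by move: (r _) Eh {E} => n <-; rewrite mulgK.
Qed.

Lemma conjugate_reps D : conjugate D -> exists ns : seq G, forall t, conj_set D t = D ->
  exists2 n, n \in ns & D (t * n^-1).
Proof.
move=> [g ->]; have [ns Hns] := finite_index_reps Csub Casn.
exists [seq n ^ g | n <- ns] => t Et.
have [|n nn Cn] := Hns (t ^ g^-1).
  rewrite /normaliser /= conjgE invgK -!conj_setM Et conj_setM mulgV conj_set1 //.
exists (n ^ g); first exact: map_f.
by apply/conj_setP; rewrite conjMg conjVg conjgK.
Qed.

Lemma finite_cover (T : Type) (S : set T) (R : T -> G -> Prop) (ns : seq G) :
  (forall s, S s -> exists2 n, n \in ns & R s n) ->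
  (forall s s' n, S s -> S s' -> R s n -> R s' n -> s = s') -> finite_set S.
Proof.
move=> H U; elim: ns S H U => [|n ns IH] S H U.
  by apply: (@sub_finite_set _ _ set0) => // s /H[].
have f1 : finite_set [set s | S s /\ R s n].
  have [[s [Ss Rs]]|nn] := pselect (exists s, S s /\ R s n).
    apply: (@sub_finite_set _ _ [set s]) => [s' [Ss' Rs']|]; last exact: finite_set1.
    exact: (U s' s n).
  by apply: (@sub_finite_set _ _ set0) => // s h; apply: nn; exists s.
have f2 : finite_set [set s | S s /\ ~ R s n].
  apply: IH => [s [Ss nR]|s s' m [? _] [? _]]; last exact: U.
  by have [m] := H s Ss; rewrite inE => /orP[/eqP->//|]; exists m.
apply: (@sub_finite_set _ _ ([set s | S s /\ R s n] `|` [set s | S s /\ ~ R s n])).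
  by move=> s Ss; have [?|?] := pselect (R s n); [left|right].
by rewrite finite_setU.
Qed.

(** Elements of [E] in the same coset of [D] coincide, and [D] has finitely many cosets in its
    normaliser. *)
Lemma finite_in_norm D (E : set G) : conjugate D -> subgroup E ->
  (forall x, E x -> conj_set D x = D) -> (forall x, E x -> D x -> x = 1) ->
  finite_set E.
Proof.
move=> dD [E1 EM EV] EN ED; have [D1 DM DV] := conjugate_sub dD.
have [ns Hns] := conjugate_reps dD.
apply: (@finite_cover _ _ (fun x n => D (x * n^-1)) ns); first by move=> x /EN /Hns.
move=> x y n Ex Ey Dx Dy; apply: (mulIg y^-1); rewrite mulgV; apply: ED.
  by apply: EM => //; exact: EV.
have := DM _ _ Dx (DV _ Dy); by rewrite invgM invgK mulgA mulgVK.
Qed.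

Lemma conn_in_norm D D' : conjugate D -> conjugate D' -> (forall x, D x -> conj_set D' x = D') ->
  D `<=` D'.
Proof.
move=> dD dD' HN; have [D1 DM DV] := conjugate_sub dD; have [D1' DM' DV'] := conjugate_sub dD'.
have [ns Hns] := conjugate_reps dD'.
suff E : D `&` D' = D by rewrite -{1}E => x [].
apply: (conjugate_conn dD).
- by apply: definableI; exact: conjugate_def.
- split=> [|x y [? ?] [? ?]|x [? ?]]; split=> //.
  + exact: DM.
  + exact: DM'.
  + exact: DV.
  + exact: DV'.
- by move=> x [].
apply: (@finite_cover _ _ (fun S n => exists x, [/\ D x, S = right_coset (D `&` D') x
    & D' (x * n^-1)]) ns).
  by move=> _ [x Dx <-]; have [n nn Dn] := Hns _ (HN _ Dx); exists n => //; exists x.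
move=> _ _ n _ _ [x [Dx -> Dxn]] [y [Dy -> Dyn]].
have Dxy : (D `&` D') (x * y^-1).
  split; first by apply: DM => //; exact: DV.
  have := DM' _ _ Dxn (DV' _ Dyn); by rewrite invgM invgK mulgA mulgVK.
apply/seteqP; split=> _ [h [Dh Dh'] <-].
  exists (h * (x * y^-1)); first by case: Dxy => ? ?; split; [exact: DM|exact: DM'].
  by rewrite -!mulgA mulVg mulg1.
exists (h * (x * y^-1)^-1).
  by case: Dxy => ? ?; split; [apply: DM => //; exact: DV|apply: DM' => //; exact: DV'].
by rewrite invgM invgK -!mulgA mulVg mulg1.
Qed.

Lemma not_normal : exists g, conj_set C g <> C.
Proof.
apply: contrapT => h; apply: Cproper; apply: Gconn => //.
have -> : [set: G] = normaliser C.
  apply/seteqP; split=> // g _; apply: contrapT => ne; apply: h; by exists g.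
exact: Casn.
Qed.

Lemma conjugate_not_normal D : conjugate D -> exists g, conj_set D g <> D.
Proof.
move=> [h ->]; have [g Hg] := not_normal; exists (h^-1 * g * h).
move=> /(congr1 (fun S => conj_set S h^-1)).
by rewrite !conj_setM -!mulgA mulgV mulg1 conj_set1 mulVKg.
Qed.

Lemma C_nontrivial : exists2 c, C c & c <> 1.
Proof.
have [C1 CM CV] := Csub.
apply: contrapT => h; have [g] := not_normal; apply.
have E x : C x <-> x = 1.
  split=> [Cx|->//]; apply: contrapT => x1; apply: h; by exists x.
apply: conj_set_ext => x; rewrite conj_setP !E; split=> [|->]; last exact: conj1g.
by move=> /(congr1 (fun z => z ^ g)); rewrite conjgKV conj1g.
Qed.

Definition X : set G := [set x | exists g, C (x ^ g^-1)].

Lemma XP x : X x <-> exists2 D, conjugate D & D x.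
Proof.
split=> [[g Cx]|[_ [g ->] /conj_setP]]; last by exists g.
by exists (conj_set C g); [exists g|apply/conj_setP].
Qed.

Lemma X_conj x t : X (x ^ t) <-> X x.
Proof.
split=> -[g Cx]; [exists (g * t^-1)|exists (g * t)].
  by rewrite invgM invgK conjgM.
by rewrite invgM -conjgM mulVKg.
Qed.

Lemma X_real x y : involution x -> involution y -> X (x * y).
Proof.
move=> ix iy; have : [set x : G | strongly_real x] (x * y) by exists x, y.
by move=> /Creal[g _ /conj_setP Cx]; exists g.
Qed.

Lemma sqE x : x ^+ 2 = x * x. Proof. by []. Qed.

Lemma involM (i : G) : involution i -> i * i = 1.
Proof. by case. Qed.

Lemma involV (i : G) : involution i -> i^-1 = i.
Proof. by move/involM => h; apply: (mulgI i); rewrite mulgV h. Qed.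

Lemma involJ (i g : G) : involution i -> involution (i ^ g).
Proof.
move=> [i1 i2]; split; last by rewrite -conjXg i2 conj1g.
by move=> /(congr1 (fun z => z ^ g^-1)); rewrite conjgK conj1g.
Qed.

Lemma invol_comm (x y : G) : involution x -> involution y -> x <> y ->
  x * y = y * x -> involution (x * y).
Proof.
move=> ix iy ne c; split.
  by move=> h; apply: ne; apply: (mulIg y); rewrite h involM.
rewrite sqE {2}c mulgA -(mulgA x y y) involM // mulg1 involM //.
Qed.

(** * Generic unions of conjugates *)

Section TopRank.
Variable n0 : nat.
Hypotheses (mT : mr n0 setT) (nT : ~ mr n0.+1 [set: G]).

Lemma mr_cosets (k : nat) (ns : seq G) : mr k [set u | exists2 n, n \in ns & C (u * n^-1)] -> mr k C.
Proof.
have [A dA] := definable_def_over Cdef.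
have dn n : def_over (n :: A) [set u | C (u * n^-1)] by td.
elim: ns => [|n ns IH]; first by move=> /mr0[u []].
have E : [set u | exists2 m, m \in n :: ns & C (u * m^-1)] =
    [set u | C (u * n^-1)] `|` [set u | exists2 n, n \in ns & C (u * n^-1)].
  apply/seteqP; split=> u.
    by move=> [m]; rewrite inE => /orP[/eqP->|h1 h2]; [left|right; exists m].
  by move=> [h|[m h1 h2]]; [exists n; rewrite ?mem_head|exists m; rewrite // inE h1 orbT].
have ds (ms : seq G) : definable N [set u | exists2 n, n \in ms & C (u * n^-1)].
  elim: ms => [|m ms IHm].
    suff -> : [set u | exists2 n, n \in [::] & C (u * n^-1)] = ~` setT.
      by apply: definableC; exact: definableT.
    by apply/seteqP; split=> y => [[]//|]; case.
  have -> : [set u | exists2 n, n \in m :: ms & C (u * n^-1)] =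
      [set u | C (u * m^-1)] `|` [set u | exists2 n, n \in ms & C (u * n^-1)].
    apply/seteqP; split=> u.
      by move=> [p]; rewrite inE => /orP[/eqP->|h1 h2]; [left|right; exists p].
    by move=> [h|[p h1 h2]]; [exists m; rewrite ?mem_head|exists p; rewrite // inE h1 orbT].
  by apply: definableU => //; exact: def_over_definable (dn m).
rewrite E => /mr_union[||h|/IH//]; [exact: def_over_definable (dn n)|exact: ds|].
have := @mr_img k (fun u => u * n^-1) [:: n] _ _ _ h.
move=> h'; apply: (mr_sub _ (h' _ _)); first by move=> _ [u Cu <-].
  td.
by move=> x y _ _ /mulIg.
Qed.

Lemma mr_X : mr n0 [set y | exists u, C (y ^ u^-1) /\ y ^ u^-1 <> 1].
Proof.
have [c0 Cc0 c01] := C_nontrivial.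
have [C1 CM CV] := Csub.
have [A dA] := definable_def_over Cdef.
have [|nu [mC nC]] := @exact_rank C; first by exists 1.
have dC : def_over (c0 :: 1 :: A) C by apply: def_over_sub dA => x xA; rewrite !inE xA !orbT.
(* Removing [1] avoids the fibre over [1], which would be all of [G]. The base holds the translating
   elements: [1] serves every [h <> 1], and [c0] serves [h = 1]. *)
apply: (@conjugates_generic C [set y | C y /\ y <> 1] (c0 :: 1 :: A) nu) => //.
- td.
- move=> h y Ch [Cy y1]; split.
    by rewrite conjgE; apply: (CM); [exact: CV|exact: CM].
  by move=> /(congr1 (fun z => z ^ h^-1)); rewrite conjgK conj1g.
- move=> h Ch; have [->|h1] := pselect (h = 1).
    by exists c0; rewrite ?mem_head // mul1g.
  by exists 1; rewrite ?inE ?eqxx ?orbT // mulg1.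
- move=> y my; have [u0 [Cu0 u01]] := mr0 my.
  have [ns Hns] := finite_index_reps Csub Casn.
  have y1 : y <> 1 by move=> y1; apply: u01; rewrite y1 conj1g.
  apply: nC; apply: (@mr_cosets _ [seq n * u0 | n <- ns]).
  apply: mr_sub my => u [Cu u1].
  have E : conj_set C u = conj_set C u0.
    by apply: (conjugate_TI _ _ y1); [exists u|exists u0|exact/conj_setP|exact/conj_setP].
  have [|n nn Cn] := Hns (u * u0^-1).
    by rewrite /normaliser /= -conj_setM E conj_setM mulgV conj_set1.
  by exists (n * u0); [exact: map_f|rewrite invgM mulgA].
Qed.

Lemma X_generic : mr n0 X.
Proof. by apply: mr_sub mr_X => y [u []]; exists u. Qed.

Lemma def_over_X A : def_over A C -> def_over A X.
Proof. by move=> dC; rewrite /X; td. Qed.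

(* If [i] lies in no conjugate of [C], the elements whose centralisers lie in
   that of [i] form a generic family disjoint from the generic set [X]. *)
Lemma involution_in_X i : involution i -> X i.
Proof.
move=> invi; apply: contrapT => nXi.
have ii := involM invi.
(* Otherwise [k * i] is an involution and [i = k * (k * i)] is strongly real. *)
have only k : involution k -> k * i = i * k -> k = i.
  move=> ik c; apply: contrapT => ne; apply: nXi.
  have -> : i = k * (k * i) by rewrite mulgA involM // mul1g.
  by apply: X_real => //; apply: invol_comm.
have [A dA] := definable_def_over Cdef.
pose cen y := [set t | t * y = y * t].
(* The centre of the centraliser of [y]: a definable abelian group, to which [sqrt_of_no_involution]
   applies whenever it does not contain [i]. *)
pose Zc y := [set z | z * y = y * z /\ forall t, t * y = y * t -> t * z = z * t].
have dZ y : definable N (Zc y).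
  by apply: (@def_over_definable [:: y]); rewrite /Zc; td.
have cV x y : x * y = y * x -> x^-1 * y = y * x^-1.
  by move=> c; apply: (mulgI x); rewrite mulVKg mulgA c mulgK.
have cM x y z : x * z = z * x -> y * z = z * y -> x * y * z = z * (x * y).
  by move=> c1 c2; rewrite -mulgA c2 mulgA c1 mulgA.
have sZ y : subgroup (Zc y).
  split=> [|a b [a1 a2] [b1 b2]|a [a1 a2]]; split.
  - by rewrite mulg1 mul1g.
  - by move=> t _; rewrite mulg1 mul1g.
  - exact: cM.
  - by move=> t ty; apply/esym; apply: cM; apply/esym; [exact: a2|exact: b2].
  - exact: cV.
  - by move=> t ty; apply/esym; apply: cV; apply/esym; exact: a2.
have abZ y a b : Zc y a -> Zc y b -> a * b = b * a by move=> [a1 _] [_ b2]; exact: b2.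
have Zyy y : Zc y y by split.
have Zi y z : y * i = i * y -> Zc y z -> z * i = i * z.
  by move=> c [_ h]; apply/esym; apply: h.
have sq0 (E : set G) : (forall z, E z -> z * i = i * z) -> ~ E i ->
    forall x, E x -> x ^+ 2 = 1 -> x = 1.
  move=> Ei nE x Ex x2; apply: contrapT => x1; apply: nE.
  by rewrite -(only x) //; exact: Ei.
pose good y := [/\ y * i = i * y & forall t, t * y = y * t -> t * i = i * t].
have goodZ y : y * i = i * y -> Zc y i -> good y.
  by move=> c [_ h].
(* If [i] is in neither centre, [y ^- 2], which equals [(i * y) ^- 2], has a square root [b] in
   both. Uniqueness of roots gives [y = b^-1], and then [i = i * y * b] lies in the second
   centre. *)
have good_or y : y * i = i * y -> good y \/ good (i * y).
  move=> c; have c' : i * y * i = i * (i * y) by rewrite -mulgA c.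
  apply: contrapT => /not_orP[n1 n2].
  have nA : ~ Zc y i by move=> h; apply: n1; exact: goodZ.
  have nB : ~ Zc (i * y) i by move=> h; apply: n2; exact: goodZ.
  have sqA := sq0 _ (fun z => @Zi y z c) nA.
  have [B1 BM BV] := sZ (i * y); have [A1 AM AV] := sZ y.
  have cAB a b : Zc y a -> Zc (i * y) b -> b * a = a * b.
    move=> [_ ha] hb; apply: ha; have bi := Zi _ _ c' hb; case: hb => b1 _.
    by apply: (mulgI i); rewrite mulgA -bi -mulgA b1 -mulgA.
  have sI : subgroup (Zc y `&` Zc (i * y)).
    by split=> [|a b [? ?] [? ?]|a [? ?]]; split=> //; [exact: AM|exact: BM|exact: AV|exact: BV].
  have [||||b [bA bB] Eb] := sqrt_of_no_involution sI _ _ _ (x := y ^- 2).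
  - exact: definableI.
  - by move=> a b [a1 _] [b1 _]; exact: abZ a1 b1.
  - by move=> a [a1 _]; exact: sqA.
  - have y2 : y ^- 2 = (i * y) ^- 2.
      congr (_^-1); rewrite !sqE -mulgA (mulgA y) c !mulgA ii mul1g //.
    split; first by apply: (AV); exact: AM.
    by rewrite y2; apply: (BV); exact: BM.
  have yb : y = b^-1.
    have : y * b = 1.
      apply: sqA; first exact: AM.
      by rewrite expgMn ?Eb ?mulgV //; exact: abZ (Zyy y) bA.
    by move=> h; apply: (mulIg b); rewrite h mulVg.
  have E : i * y * b = i by rewrite yb mulgVK.
  by apply: nB; have := BM _ _ (Zyy (i * y)) bB; rewrite E.
(* Extracting a root of [y ^+ 2] shows that its centraliser lies in that of [y]; since
   [(i * y) ^+ 2 = y ^+ 2], goodness passes to [i * y]. A conjugate of [C] containing [i * y] would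
   contain [y ^+ 2], hence be [D] and contain [i]. *)
have good_X y : y <> 1 -> good y -> X y -> good (i * y) /\ ~ X (i * y).
  move=> y1 [c gy] /XP[D dD Dy].
  have [D1 DM DV] := conjugate_sub dD.
  have nDi : ~ D i by move=> Di; apply: nXi; apply/XP; exists D.
  have iy2 : (i * y) ^+ 2 = y ^+ 2.
    by rewrite !sqE -mulgA (mulgA y) c !mulgA ii mul1g.
  have Dy2 : D (y ^+ 2) by exact: DM.
  have sqD x : D x -> x * i = i * x -> x ^+ 2 = 1 -> x = 1.
    move=> Dx cx; apply: (sq0 [set z | D z /\ z * i = i * z]) => //; first by move=> z [].
    by case.
  have ci2 : y ^+ 2 * i = i * y ^+ 2 by exact: cM.
  have y21 : y ^+ 2 <> 1 by move=> /(sqD _ Dy c).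
  have [A1 AM AV] := sZ (y ^+ 2).
  have sI : subgroup (Zc (y ^+ 2) `&` D).
    by split=> [|a b [? ?] [? ?]|a [? ?]]; split=> //; [exact: AM|exact: DM|exact: AV|exact: DV].
  have [||||v [vA vD] Ev] := sqrt_of_no_involution sI _ _ _ (x := y ^+ 2).
  - by apply: definableI => //; exact: conjugate_def.
  - by move=> a b [a1 _] [b1 _]; exact: abZ a1 b1.
  - by move=> a [a1 a2]; apply: sqD => //; exact: Zi a1.
  - by split.
  have cy2 : y * y ^+ 2 = y ^+ 2 * y by rewrite !sqE !mulgA.
  have yv : y = v.
    have cyv : y * v = v * y by case: vA => _; exact.
    have : y * v^-1 = 1.
      apply: sqD; first by apply: (DM) => //; exact: DV.
        by apply: cM => //; apply: cV; exact: Zi vA.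
      rewrite expgMn; last by apply/esym; apply: cV.
      by rewrite expVgn Ev mulgV.
    by move=> h; apply: (mulIg v^-1); rewrite h mulgV.
  split; last first.
    move=> /XP[D' dD' Dy'].
    have E : D = D'.
      apply: (conjugate_TI dD dD' y21) => //; rewrite -iy2.
      by have [_ DM' _] := conjugate_sub dD'; exact: DM'.
    by apply: nDi; rewrite -(mulgK y i); apply: (DM); [rewrite E|exact: DV].
  split; first by rewrite -mulgA c.
  move=> t ct; apply: gy.
  have ct2 : t * y ^+ 2 = y ^+ 2 * t.
    rewrite -iy2; rewrite !sqE; apply/esym; apply: cM; by apply/esym.
  by rewrite yv; case: vA => _; exact.
pose good' y := good y /\ ~ X y.
have good'_or y : y * i = i * y -> good' y \/ good' (i * y).
  have aux z : good z -> good' z \/ good' (i * z).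
    move=> gz; have [Xz|nXz] := pselect (X z); last by left.
    have [z1|z1] := pselect (z = 1); last by right; exact: good_X.
    by right; rewrite z1 mulg1.
  move=> c; have [/aux//|/aux] := good_or y c.
  by rewrite mulgA ii mul1g => -[]; [right|left].
have sub_iA : {subset A <= i :: 1 :: A} by move=> x xA; rewrite !inE xA !orbT.
have dC1 := def_over_sub sub_iA dA.
have dX := def_over_X dC1.
pose H := [set y | y * i = i * y].
have dH : def_over (i :: 1 :: A) H by rewrite /H; td.
have sH : subgroup H.
  by split=> [|a b|a]; rewrite /H /= ?mulg1 ?mul1g //; [exact: cM|exact: cV].
have [|nu [mH nH]] := @exact_rank H; first by exists 1; rewrite /H /= mulg1 mul1g.
have dg : def_over (i :: 1 :: A) good'.
  have -> : good' = [set y | (y * i = i * y /\ forall t, t * y = y * t -> t * i = i * t)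
      /\ ~ X y].
    by apply/seteqP; split=> y [[? ?] ?].
  td.
have mY : mr n0 [set y | exists u, good' (y ^ u^-1)].
  apply: (conjugates_generic sH dH mH nH mT nT dg).
  - move=> h y Hh [[c g] nX]; split; last by rewrite X_conj.
    have ih : i ^ h = i by rewrite conjgE -Hh mulKg.
    split; first by rewrite -{1}ih -{2}ih -!conjMg c.
    move=> t ct; have /(congr1 (fun z => z ^ h)) : t ^ h^-1 * i = i * t ^ h^-1.
      by apply: g; rewrite -(conjgK h y) -!conjMg ct.
    by rewrite /= (conjMg (t ^ h^-1) i) (conjMg i (t ^ h^-1)) conjgKV ih.
  - move=> h Hh; have [g|g] := good'_or h Hh.
      by exists 1; rewrite ?inE ?eqxx ?orbT // mulg1.
    by exists i; rewrite ?mem_head // Hh.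
  - move=> y my; have [u0 g0] := mr0 my; apply: nH.
    (* Both [i ^ u] and [i ^ u0] commute with [y], and [i] commutes with no other involution; so the
       fibre lies in one coset of [H]. *)
    have sub : [set u | good' (y ^ u^-1)] `<=` [set u | H (u * u0^-1)].
      move=> u g.
      have comm w : good' (y ^ w^-1) -> (i ^ w) * y = y * (i ^ w).
        move=> [[c _] _]; have /(congr1 (fun z => z ^ w)) := c.
        by rewrite /= (conjMg (y ^ w^-1) i) (conjMg i (y ^ w^-1)) conjgKV.
      have /(congr1 (fun z => z ^ u0^-1)) := comm _ g.
      rewrite /= (conjMg (i ^ u) y) (conjMg y (i ^ u)) => c.
      have [[_ h] _] := g0.
      have := only ((i ^ u) ^ u0^-1) _ (h _ c).
      move=> /(_ (involJ _ (involJ _ invi))); rewrite -conjgM => E.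
      by rewrite /H /= -{1}E conjgE mulgA mulgV mul1g.
    have := @mr_img nu.+1 (fun u => u * u0^-1) [:: u0] _ _ _ (mr_sub sub my).
    move=> h; apply: (mr_sub _ (h _ _)); first by move=> _ [u Hu <-].
      td.
    by move=> a b _ _ /mulIg.
have dY : definable N [set y | exists u, good' (y ^ u^-1)].
  by apply: (@def_over_definable (i :: 1 :: A)); td.
have sT : subgroup [set: G] by [].
have [||y [Xy [u [_ nX]]]] := mr0 (conn_meet sT (def_overT [::]) mT nT Gconn
  (def_over_definable dX) dY _ _ X_generic mY) => //.
by apply: nX; rewrite X_conj.
Qed.

End TopRank.

(** * The conjugate of [C] through a non-trivial element, and its structure *)

Definition conj_at x : set G := [set z | exists g, C (x ^ g^-1) /\ C (z ^ g^-1)].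

Lemma conj_atE D x : conjugate D -> x <> 1 -> D x -> conj_at x = D.
Proof.
move=> dD x1 Dx; apply: conj_set_ext => z; split.
  move=> [g [/conj_setP gx /conj_setP gz]].
  by rewrite (conjugate_TI dD (ex_intro _ g erefl) x1 Dx gx).
by case: dD Dx => g -> /conj_setP Dx /conj_setP Dz; exists g.
Qed.

Lemma all_X x : involution x -> X x.
Proof.
have [|n0 [mT nT]] := @exact_rank setT; first by exists 1.
exact: (involution_in_X mT nT).
Qed.

Lemma conj_at_ex x : X x -> x <> 1 -> conjugate (conj_at x) /\ conj_at x x.
Proof. by move=> /XP[D dD Dx] x1; rewrite (conj_atE dD x1 Dx). Qed.

Lemma conj_at_inv i : involution i -> conjugate (conj_at i) /\ conj_at i i.
Proof. by move=> ii; apply: conj_at_ex; [exact: all_X|case: ii]. Qed.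

Lemma conj_comm x t : x * t = t * x -> x ^ t = x.
Proof. by move=> c; rewrite conjgE c mulKg. Qed.

Lemma comm_conj x t : x ^ t = x -> x * t = t * x.
Proof. by move=> {2}<-; rewrite conjgE mulVKg. Qed.

(* An involution acting on [D] from outside [D] has finitely many fixed points
   there, since its centraliser normalises its own conjugate of [C]. *)
Lemma inverts D a : involution a -> conjugate D -> conj_set D a = D -> ~ D a ->
  forall x, D x -> x ^ a = x^-1.
Proof.
move=> ia dD nD nDa; have [da aa] := conj_at_inv ia.
have a1 : a <> 1 by case: ia.
have [D1 DM DV] := conjugate_sub dD.
apply: (connected_inverted (conjugate_sub dD) (conjugate_def dD) (conjugate_conn dD)).
- by move=> x; exact: norm_mem.
- exact: involM.
apply: (finite_in_norm da).
- split=> [|x y [Dx cx] [Dy cy]|x [Dx cx]]; split=> //.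
  + exact: conj1g.
  + exact: DM.
  + by rewrite (conjMg x y) cx cy.
  + exact: DV.
  + by rewrite (conjVg x) cx.
- move=> x [Dx /comm_conj cx]; apply: (conjugate_norm da a1 aa).
  by rewrite conj_comm.
- move=> x [Dx _] ax; apply: contrapT => x1; apply: nDa.
  by rewrite (conjugate_TI dD da x1 Dx ax).
Qed.

Lemma inverted_abelian D a : subgroup D -> (forall x, D x -> x ^ a = x^-1) ->
  forall x y, D x -> D y -> x * y = y * x.
Proof.
move=> [D1 DM DV] inv x y Dx Dy; apply: invg_inj.
rewrite -(inv (x * y)); last exact: DM.
by rewrite (conjMg x y) !inv // -invgM.
Qed.

Lemma prod_neq1 i j : involution i -> involution j -> i <> j -> i * j <> 1.
Proof. by move=> ii ij ne h; apply: ne; apply: (mulIg j); rewrite h involM. Qed.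

Lemma prod_conjl i j : involution i -> involution j -> (i * j) ^ i = (i * j)^-1.
Proof.
by move=> ii ij; rewrite conjgE invgM !involV // !mulgA involM // mul1g.
Qed.

Lemma prod_conjr i j : involution i -> involution j -> (i * j) ^ j = (i * j)^-1.
Proof.
move=> ii ij; rewrite conjgE invgM !involV // -(mulgA i j j) involM //.
by rewrite mulg1.
Qed.

Lemma prod_cd i j : involution i -> involution j -> i <> j ->
  [/\ conjugate (conj_at (i * j)), conj_at (i * j) (i * j), conj_set (conj_at (i * j)) i = conj_at (i * j) &
      conj_set (conj_at (i * j)) j = conj_at (i * j)].
Proof.
move=> ii ij ne; have p1 := prod_neq1 ii ij ne.
have [dD Dp] := conj_at_ex (X_real ii ij) p1; have [_ _ DV] := conjugate_sub dD.
split=> //; apply: (conjugate_norm dD p1 Dp).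
  by rewrite prod_conjl //; exact: DV.
by rewrite prod_conjr //; exact: DV.
Qed.

(** Two conjugate involutions in distinct conjugates of [C] normalise the conjugate through their
    product. If it contained one of them it would contain both, which is excluded. *)
Lemma special : exists D a, [/\ conjugate D, involution a, conj_set D a = D & ~ D a].
Proof.
have [i ii] := hinv; have [di Di] := conj_at_inv ii.
have [t nt] := conjugate_not_normal di.
have ij := involJ t ii; have i1 : i <> 1 by case: ii.
have j1 : i ^ t <> 1 by case: ij.
have ne : i <> i ^ t.
  by move=> E; apply: nt; apply: (conjugate_norm di i1 Di); rewrite -E.
have [dD Dp ni nj] := prod_cd ii ij ne.
exists (conj_at (i * i ^ t)), i; split=> // Dii.
have [D1 DM DV] := conjugate_sub dD.
have Dj : conj_at (i * i ^ t) (i ^ t).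
  by have := DM _ _ (DV _ Dii) Dp; rewrite mulKg.
apply: nt; apply: (conjugate_norm di i1 Di).
by rewrite (conjugate_TI di dD i1 Di Dii).
Qed.

Lemma conj_of D D' : conjugate D -> conjugate D' -> exists g, D' = conj_set D g.
Proof.
move=> [g ->] [h ->]; exists (g^-1 * h).
by rewrite conj_setM mulVKg.
Qed.

Lemma inverter D : conjugate D -> exists a, [/\ involution a, conj_set D a = D & ~ D a].
Proof.
move=> dD; have [D0 [a [dD0 ia na nDa]]] := special.
have [g ->] := conj_of dD0 dD; exists (a ^ g); split.
- exact: involJ.
- by rewrite conj_setM conjgE mulVKg -conj_setM na.
- by move=> /conj_setP; rewrite conjgK.
Qed.

Lemma conjugate_abelian D : conjugate D -> forall x y, D x -> D y -> x * y = y * x.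
Proof.
move=> dD; have [a [ia na nDa]] := inverter dD.
apply: (@inverted_abelian D a); first exact: conjugate_sub.
exact: inverts.
Qed.

Lemma conjugate_divisible D : conjugate D -> forall x, D x -> exists2 y, D y & y ^+ 2 = x.
Proof.
move=> dD; apply: (connected_divisible (conjugate_sub dD) (conjugate_def dD) (conjugate_conn dD) (conjugate_abelian dD)).
case: dD => g ->.
have dC : conjugate C by exists 1; rewrite conj_set1.
apply: sub_finite_set (finite_image (fun x => x ^ g) (Cfin2 (conjugate_abelian dC))).
move=> x [/conj_setP Cx x2]; exists (x ^ g^-1); last exact: conjgKV.
by split=> //; rewrite -conjXg x2 conj1g.
Qed.

(** Let [a] invert [D]. Then [k], [k'] and [k * k'] all invert the conjugate through [a]; but the
    product of two inversions is the identity, so a square root of [a] there has order at most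
    two. *)
Lemma inv_unique D k k' : conjugate D -> involution k -> involution k' -> D k -> D k' ->
  k = k'.
Proof.
move=> dD ik ik' Dk Dk'; apply: contrapT => ne.
have [a [ia na nDa]] := inverter dD; have [da aa] := conj_at_inv ia.
have [D1 DM DV] := conjugate_sub dD.
have a1 : a <> 1 by case: ia.
have aux m : involution m -> D m -> forall x, conj_at a x -> x ^ m = x^-1.
  move=> im Dm; apply: inverts => //.
    apply: (conjugate_norm da a1 aa); rewrite conj_comm //; apply/esym; apply: comm_conj.
    by rewrite (inverts ia dD) // involV.
  have m1 : m <> 1 by case: im.
  by move=> am; apply: nDa; rewrite (conjugate_TI dD da m1 Dm am).
have ikk : involution (k * k') by apply: invol_comm => //; exact: conjugate_abelian Dk Dk'.
have Dkk : D (k * k') by exact: DM.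
have [e ae Ee] := conjugate_divisible da aa.
have e2 : e = e^-1.
  have [_ _ aV] := conjugate_sub da.
  rewrite -(aux _ ikk Dkk _ ae) conjgM (aux _ ik Dk) // (aux _ ik' Dk') ?invgK //.
  exact: aV.
by apply: a1; rewrite -Ee sqE {2}e2 mulgV.
Qed.

Lemma inv_ex D : conjugate D -> exists2 k, involution k & D k.
Proof.
move=> dD; have [i ii] := hinv; have [di Di] := conj_at_inv ii.
have [g ->] := conj_of di dD.
by exists (i ^ g); [exact: involJ|exact: mem_conj_set].
Qed.

(** * The projective plane: involutions are both points and lines, and [perp] is incidence *)

Definition perp i k : Prop :=
  [/\ involution i, involution k, i <> k & i * k = k * i].

Lemma perp_sym i k : perp i k -> perp k i.
Proof. by move=> [? ? ne c]; split=> // h; apply: ne. Qed.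

Lemma perpJ i k g : perp i k -> perp (i ^ g) (k ^ g).
Proof.
move=> [ii ik ne c]; split; [exact: involJ|exact: involJ| |].
  by move=> /conjg_inj.
by rewrite -(conjMg i k) c (conjMg k i).
Qed.

Lemma perp_inv i k x : perp i k -> conj_at k x -> x ^ i = x^-1.
Proof.
move=> [ii ik ne c] kx; have [dk kk] := conj_at_inv ik.
apply: inverts kx => //; last by move=> ki; apply: ne; exact: inv_unique kk.
have k1 : k <> 1 by case: ik.
by apply: (conjugate_norm dk k1 kk); rewrite conj_comm.
Qed.

(** Both involutions invert [conj_at k], so their product centralises it; then [conj_at k]
    normalises [conj_at (i * j)] and, being connected, lies in it. *)
Lemma perp_prod i j k : perp i k -> perp j k -> conj_at k (i * j).
Proof.
move=> pi pj; have [ii ik _ _] := pi; have [ij _ _ _] := pj.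
have [dk kk] := conj_at_inv ik; have [K1 KM KV] := conjugate_sub dk.
have [<-|ne] := pselect (i = j); first by rewrite involM.
have [dD Dp _ _] := prod_cd ii ij ne; have p1 := prod_neq1 ii ij ne.
have sub : conj_at k `<=` conj_at (i * j).
  apply: conn_in_norm => // x kx; apply: (conjugate_norm dD p1 Dp).
  rewrite conj_comm //; apply/esym; apply: comm_conj.
  by rewrite conjgM (perp_inv pi kx) (perp_inv pj) ?invgK //; exact: KV.
have k1 : k <> 1 by case: ik.
by rewrite (conjugate_TI dk dD k1 kk (sub _ kk)).
Qed.

Lemma perp_shift i k d : perp i k -> conj_at k d -> perp (i * d) k.
Proof.
move=> pi kd; have [ii ik ne c] := pi; have [dk kk] := conj_at_inv ik.
have [K1 KM KV] := conjugate_sub dk.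
have nki : ~ conj_at k i by move=> ki; apply: ne; exact: inv_unique kk.
have nd x : conj_at k x -> i * d <> x.
  move=> kx E; apply: nki; rewrite -(mulgK d i) E; apply: (KM) => //; exact: KV.
split=> //; last 2 first.
- exact: nd.
- by rewrite -mulgA (conjugate_abelian dk kd kk) mulgA c mulgA.
split; first exact: nd.
rewrite sqE -mulgA (mulgA d i d).
have -> : d * i = i * d^-1.
  by rewrite -(perp_inv pi kd) conjgE mulVKg.
by rewrite mulgVK involM.
Qed.

Lemma perp_ex k : involution k -> exists i, perp i k.
Proof.
move=> ik; have [dk kk] := conj_at_inv ik.
have [a [ia na nDa]] := inverter dk; exists a; split=> //.
  by move=> E; apply: nDa; rewrite E.
apply/esym; apply: comm_conj; rewrite (inverts ia dk) // involV //.
Qed.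

Lemma fix_inv D i k : conjugate D -> involution i -> conj_set D i = D -> involution k ->
  D k -> i * k = k * i.
Proof.
move=> dD ii ni ik Dk; apply/esym; apply: comm_conj.
by apply: (inv_unique dD) => //; [exact: involJ|apply: norm_mem].
Qed.

(** The line through two points is the involution of the conjugate containing their product: both
    normalise this conjugate, hence fix its only involution. *)
Lemma perp_join i j : involution i -> involution j -> i <> j ->
  exists k, perp i k /\ perp j k.
Proof.
move=> ii ij ne; have [dD Dp ni nj] := prod_cd ii ij ne.
have [D1 DM DV] := conjugate_sub dD.
have [k ik Dk] := inv_ex dD; exists k.
have Dij : conj_at (i * j) i -> conj_at (i * j) j.
  by move=> h; have := DM _ _ (DV _ h) Dp; rewrite mulKg.
have Dji : conj_at (i * j) j -> conj_at (i * j) i.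
  by move=> h; have := DM _ _ Dp (DV _ h); rewrite mulgK.
split; split=> //.
- by move=> E; apply: ne; rewrite -E in Dk; apply: (inv_unique dD) => //; exact: Dij.
- exact: fix_inv Dk.
- by move=> E; apply: ne; rewrite -E in Dk; apply: (inv_unique dD) => //; exact: Dji.
- exact: fix_inv Dk.
Qed.

Lemma perp_unique i j k k' : i <> j -> perp i k -> perp j k -> perp i k' -> perp j k' ->
  k = k'.
Proof.
move=> ne p1 p2 p3 p4; have [ii ik _ _] := p1; have [ij _ _ _] := p2.
have [_ ik' _ _] := p3.
have [dk kk] := conj_at_inv ik; have [dk' kk'] := conj_at_inv ik'.
have E := conjugate_TI dk dk' (prod_neq1 ii ij ne) (perp_prod p1 p2) (perp_prod p3 p4).
by apply: (inv_unique dk) => //; rewrite E.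
Qed.

(** A square root [e] of [i * j] in [conj_at k] is inverted by [i], whence
    [i ^ e = i * e ^+ 2 = j]. *)
Lemma perp_trans i j k : perp i k -> perp j k -> exists2 e, conj_at k e & i ^ e = j.
Proof.
move=> p1 p2; have [ii ik _ _] := p1; have [dk kk] := conj_at_inv ik.
have [e ke Ee] := conjugate_divisible dk (perp_prod p1 p2); exists e => //.
have : e ^ i = e^-1 by exact: perp_inv p1 ke.
rewrite !conjgE (involV ii) => <-.
rewrite !mulgA -(mulgA (i * e) i i) involM // mulg1 -mulgA -sqE Ee.
by rewrite mulgA involM // mul1g.
Qed.

Lemma inv_conj i j : involution i -> involution j -> exists g, i ^ g = j.
Proof.
move=> ii ij; have [->|ne] := pselect (i = j); first by exists 1; exact: conjg1.
have [k [p1 p2]] := perp_join ii ij ne.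
by have [e _ E] := perp_trans p1 p2; exists e.
Qed.

Lemma perp_prod_inv i j : perp i j -> involution (i * j).
Proof. by move=> [? ? ? ?]; exact: invol_comm. Qed.

Lemma X_two x : X x -> exists i j, [/\ involution i, involution j & x = i * j].
Proof.
move=> Xx; have [->|x1] := pselect (x = 1).
  by have [i ii] := hinv; exists i, i; rewrite involM.
have [dx xx] := conj_at_ex Xx x1; have [k ik xk] := inv_ex dx.
have [i pi] := perp_ex ik; have [ii _ _ _] := pi.
have k1 : k <> 1 by case: ik.
have kx : conj_at k x by rewrite (conj_atE dx k1 xk).
have [ix _ _ _] := perp_shift pi kx.
by exists i, (i * x); rewrite mulgA involM // mul1g.
Qed.

Lemma X_three i j l : involution i -> involution j -> involution l -> X (i * j * l).
Proof.
move=> ii ij il; have [<-|ne] := pselect (i = j).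
  by rewrite involM // mul1g; exact: all_X.
have [k [p1 p2]] := perp_join ii ij ne; have [_ ik _ _] := p1.
have [dk kk] := conj_at_inv ik; have [K1 KM KV] := conjugate_sub dk.
have kij := perp_prod p1 p2.
have [->|nl] := pselect (l = k); first by apply/XP; exists (conj_at k) => //; exact: KM.
(* As [m] inverts [i * j] and commutes with [l], both [i * j * m] and [m * l] are involutions. *)
have [m [q1 q2]] := perp_join il ik nl.
have q2' := perp_sym q2; have [im _ _ _] := q2'.
have pm : involution (i * j * m).
  have <- : m * (i * j)^-1 = i * j * m.
    by rewrite -(perp_inv q2' kij) conjgE mulVKg.
  by have [] := perp_shift q2' (KV _ kij).
have -> : i * j * l = i * j * m * (m * l).
  by rewrite !mulgA -(mulgA (i * j) m m) involM // mulg1.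
by apply: X_real => //; apply: perp_prod_inv; exact: perp_sym.
Qed.

Lemma X_all x : X x.
Proof.
suff -> : X = setT by [].
have [|n0 [mT nT]] := @exact_rank setT; first by exists 1.
have [A dA] := definable_def_over Cdef.
have sT : subgroup [set: G] by [].
apply: (conn_sub sT (def_overT [::]) mT nT Gconn) => //.
- exact: def_over_definable (def_over_X dA).
- split=> [|a b|a].
  + by exists 1; rewrite conj1g; case: Csub.
  + move=> /X_two[i [j [ii ij ->]]] /X_two[l [m [il im ->]]].
    have /X_two[p [q [ip iq E]]] := X_three ii ij il.
    by rewrite mulgA E; exact: X_three.
  + by move=> [g Cg]; exists g; rewrite (conjVg a); case: Csub => _ _; exact.
- exact: X_generic.
Qed.

Lemma conj_atP x : x <> 1 -> conjugate (conj_at x) /\ conj_at x x.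
Proof. exact: conj_at_ex (X_all x). Qed.

Lemma comm_inv z p : involution p -> z * p = p * z -> conj_at p z \/ perp z p.
Proof.
move=> ip c; have [dp pp] := conj_at_inv ip; have [P1 _ _] := conjugate_sub dp.
have [->|z1] := pselect (z = 1); first by left.
have [dz zz] := conj_atP z1.
have np : conj_set (conj_at z) p = conj_at z by apply: (conjugate_norm dz z1 zz); rewrite conj_comm.
have p1 : p <> 1 by case: ip.
have [zp|nzp] := pselect (conj_at z p); first by left; rewrite (conj_atE dz p1 zp).
right; have E : z = z^-1 by rewrite -(inverts ip dz np nzp zz) conj_comm.
split=> //; last by move=> E'; apply: nzp; rewrite -E'.
by split=> //; rewrite sqE {2}E mulgV.
Qed.

Lemma conj_at_conj x g : x <> 1 -> conj_set (conj_at x) g = conj_at (x ^ g).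
Proof.
move=> x1; have [dx xx] := conj_atP x1; apply/esym; apply: conj_atE.
- exact: conjugate_conj.
- by move=> /(congr1 (fun z => z ^ g^-1)); rewrite conjgK conj1g.
- exact: mem_conj_set.
Qed.

Lemma conj_at_conj_mem k z g : involution k -> conj_at k z -> conj_at (k ^ g) (z ^ g).
Proof. by move=> [k1 _] kz; rewrite -conj_at_conj //; exact: mem_conj_set. Qed.

Lemma conj_at_disj k l x : involution k -> involution l -> k <> l -> conj_at k x -> conj_at l x ->
  x = 1.
Proof.
move=> ik il ne kx lx; apply: contrapT => x1; apply: ne.
have [dk kk] := conj_at_inv ik; have [dl ll] := conj_at_inv il.
by apply: (inv_unique dk) => //; rewrite (conjugate_TI dk dl x1 kx lx).
Qed.

(** * Pythagorean composition of lengths *)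

(* The conjugacy classes of [G] behave like the squared cosines of lengths:
   the class of a product [a * b] with [a], [b] in orthogonal tori depends only
   on the classes of [a] and [b], and this composition is an associative,
   cancellative operation without inverses, contradicting stability. *)
Section Frame.
Variables (i j k : G).
Hypotheses (pij : perp i j) (kE : k = i * j).

Let ii : involution i. Proof. by case: pij. Qed.
Let ij : involution j. Proof. by case: pij. Qed.
Let ik : involution k. Proof. by rewrite kE; exact: perp_prod_inv. Qed.
Let cij : i * j = j * i. Proof. by case: pij. Qed.
Let i1 : i <> 1. Proof. by case: ii. Qed.
Let j1 : j <> 1. Proof. by case: ij. Qed.

Lemma frame_ki : perp k i.
Proof.
split=> //; last by rewrite kE -mulgA -cij.
by rewrite kE => E; apply: j1; apply: (mulgI i); rewrite mulg1.
Qed.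

Lemma frame_kj : perp k j.
Proof.
split=> //; last by rewrite kE {1}cij mulgA.
by rewrite kE => E; apply: i1; apply: (mulIg j); rewrite mul1g.
Qed.

Let dDi : conjugate (conj_at i). Proof. by case: (conj_at_inv ii). Qed.
Let dDj : conjugate (conj_at j). Proof. by case: (conj_at_inv ij). Qed.

Lemma kV_i a : conj_at i a -> k * a = a^-1 * k.
Proof.
move=> ha; rewrite -(perp_inv frame_ki ha) conjgE (involV ik).
by rewrite -(mulgA k (a * k) k) -(mulgA a k k) involM // mulg1.
Qed.

Lemma kV_j b : conj_at j b -> k * b = b^-1 * k.
Proof.
move=> hb; rewrite -(perp_inv frame_kj hb) conjgE (involV ik).
by rewrite -(mulgA k (b * k) k) -(mulgA b k k) involM // mulg1.
Qed.

Lemma perp_ak a : conj_at i a -> perp (a * k) i.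
Proof.
move=> ha; have [_ _ V] := conjugate_sub dDi.
have -> : a * k = k * a^-1 by rewrite kV_i ?invgK //; exact: V.
by apply: perp_shift; [exact: frame_ki|exact: V].
Qed.

Lemma perp_kb b : conj_at j b -> perp (k * b) j.
Proof. by move=> hb; apply: perp_shift => //; exact: frame_kj. Qed.

(** The points [a * k], [k] and [k * b] form a triangle with a right angle at [k], since its legs
    lie on the perpendicular lines [i] and [j]. The product [a * b] measures the hypotenuse. *)
Lemma split_ab a b : a * b = (a * k) * (k * b).
Proof. by rewrite !mulgA -(mulgA a k k) involM // mulg1. Qed.

Lemma ak_j a : a * k = j -> a = i.
Proof.
move=> E; apply: (mulIg k); rewrite E kE mulgA involM // mul1g //.
Qed.

Lemma kb_i b : k * b = i -> b = j.
Proof.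
by move=> E; apply: (mulgI k); rewrite E kE -mulgA involM // mulg1.
Qed.

(** A hypotenuse has maximal length only if a leg has. If [a * k] and [k * b] are perpendicular and
    [a * k <> j], then [k * b] and [i] are both the line through [a * k] and [j]. *)
Lemma comp_inv a b : conj_at i a -> conj_at j b -> involution (a * b) -> a = i \/ b = j.
Proof.
move=> ha hb; rewrite split_ab => ipq.
have pi := perp_ak ha; have qj := perp_kb hb.
have [ip _ _ _] := pi; have [iq _ _ _] := qj.
have pq : perp (a * k) (k * b).
  split=> //; first by move=> E; case: ipq => h _; apply: h; rewrite E involM.
  by apply: invg_inj; rewrite involV // invgM !involV.
have [E|ne] := pselect (a * k = j); first by left; exact: ak_j.
right; apply: kb_i.
by apply: (perp_unique ne) => //; apply: perp_sym.
Qed.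

(** In cosines: a product equal to its first factor, which is not zero, has second factor one. *)
Lemma comp_cancel a b g : conj_at i a -> a <> i -> conj_at j b -> (a * b) ^ g = a -> b = 1.
Proof.
move=> ha ai hb Eg; have [a1|a1] := pselect (a = 1).
  have : (a * b) ^ g = 1 ^ g by rewrite Eg a1 conj1g.
  by move=> /conjg_inj; rewrite a1 mul1g.
apply: contrapT => b1.
set p := a * k; set q := k * b.
have Epq : a * b = p * q by exact: split_ab.
have Epk : a = p * k by rewrite /p -mulgA involM // mulg1.
have pi : perp p i := perp_ak ha; have qj : perp q j := perp_kb hb.
have [ip _ _ _] := pi; have [iq _ _ _] := qj.
have qk : q <> k by move=> E; apply: b1; apply: (mulgI k); rewrite mulg1.
have pj : p <> j by move=> /ak_j.
have pq : p <> q.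
  by move=> E; apply: a1; rewrite -Eg Epq E involM // conj1g.
have [r [pr qr]] := perp_join ip iq pq; have [_ ir _ _] := pr.
have rpq := perp_prod pr qr.
have rgi : r ^ g = i.
  have h := conj_at_conj_mem g ir rpq; rewrite -Epq Eg in h.
  have [dr' rr'] := conj_at_inv (involJ g ir).
  apply: (inv_unique dr') => //; first exact: involJ.
  by rewrite (conjugate_TI dr' dDi a1 h ha); case: (conj_at_inv ii).
have pgi : perp (p ^ g) i by rewrite -rgi; exact: perpJ.
have [e ie Ee] := perp_trans pgi pi.
have ae : a ^ e = a by apply: conj_comm; exact: conjugate_abelian dDi _ _ ha ie.
set z := g * e.
have pz : p ^ z = p by rewrite /z conjgM.
have qz : q ^ z = k.
  have : (p * q) ^ z = a by rewrite -Epq /z conjgM Eg.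
  by rewrite (conjMg p q) pz Epk => /mulgI.
(* [z] fixes [p] and moves [q] to [k]. If [z] is not yet an involution perpendicular to [p],
   composing it with one that fixes [p] and [q] makes it so; the result exchanges [q] and [k]. *)
have [s [sp qs]] : exists s, perp s p /\ q ^ s = k.
  have [pz'|] := comm_inv ip (esym (comm_conj pz)); last by exists z.
  have [s' [ps' qs']] := perp_join ip iq pq.
  exists (s' * z); split; first by apply: perp_shift => //; exact: perp_sym.
  by rewrite conjgM (conj_comm (x := q) (t := s')) //; case: qs'.
have [is' _ _ _] := sp.
have ks : k ^ s = q by rewrite -qs -conjgM involM // conjg1.
have jqk : conj_at j (q * k) by apply: perp_prod => //; exact: frame_kj.
have qk1 : q * k <> 1 by exact: prod_neq1.
have [_ _ jV] := conjugate_sub dDj.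
have ns : conj_set (conj_at j) s = conj_at j.
  apply: (conjugate_norm dDj qk1 jqk); rewrite (conjMg q k) qs ks.
  by have := jV _ jqk; rewrite invgM !involV.
have csj : s * j = j * s by apply: (fix_inv dDj) => //; case: (conj_at_inv ij).
have [Esj|sj] := pselect (s = j).
  by apply: qk; rewrite -qs Esj conj_comm //; case: qj.
have Esi : s = i.
  have psj : perp s j by split.
  (* [s] and [i] are both perpendicular to the distinct points [p] and [j]. *)
  exact: (perp_unique pj (perp_sym sp) (perp_sym psj) pi (perp_sym pij)).
apply: qk; rewrite -qs Esi conj_comm //.
have Ek : k ^ i = q by rewrite -Esi.
by rewrite -Ek; rewrite conj_comm //; case: frame_ki.
Qed.

Lemma pair_conj l m : perp l m -> exists x, l ^ x = i /\ m ^ x = j.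
Proof.
move=> plm; have [il im _ _] := plm; have [x Ex] := inv_conj il ii.
have p1 : perp (m ^ x) i by rewrite -Ex; apply: perpJ; exact: perp_sym.
have [e ie Ee] := perp_trans p1 (perp_sym pij).
exists (x * e); rewrite !conjgM Ex Ee; split=> //.
by rewrite conj_comm //; apply: conjugate_abelian dDi _ _ _ ie; case: (conj_at_inv ii).
Qed.

Lemma class_rep y : exists x, conj_at i (y ^ x).
Proof.
have [I1 _ _] := conjugate_sub dDi.
have [->|y1] := pselect (y = 1); first by exists 1; rewrite conj1g.
have [dy yy] := conj_atP y1; have [l il yl] := inv_ex dy.
have [x Ex] := inv_conj il ii; exists x; rewrite -Ex.
have l1 : l <> 1 by case: il.
by apply: conj_at_conj_mem => //; rewrite (conj_atE dy l1 yl).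
Qed.

(* Associativity, read off the orthoscheme with vertices [a^-1], [1], [b] and
   [b * c] in the projective space of the group. *)
Lemma comp_trans a b g1 g h b' g2 : conj_at i a -> conj_at j b -> conj_at i g1 -> conj_at j b' ->
  (a * b) ^ g = g1 -> (g1 * b') ^ h = g2 ->
  exists b'', [/\ conj_at j b'', exists f, (a * b'') ^ f = g2 & b'' = 1 -> b = 1].
Proof.
move=> ha hb hg1 hb' Eg Eh.
have [I1 IM IV] := conjugate_sub dDi; have [J1 JM JV] := conjugate_sub dDj.
have nij : i <> j by case: pij.
have [ab1|ab1] := pselect (a * b = 1).
  have Eab : a = b^-1 by apply: (mulIg b); rewrite ab1 mulVg.
  have a1 : a = 1 by apply: (conj_at_disj ii ij nij) => //; rewrite Eab; exact: JV.
  have b1 : b = 1 by move: ab1; rewrite a1 mul1g.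
  exists b'; split=> //; exists h.
  by rewrite a1 mul1g -Eh -Eg ab1 conj1g mul1g.
set m := k * b.
have mE : m = b^-1 * k by exact: kV_j.
have mj : perp m j := perp_kb hb; have [im _ nmj _] := mj.
have minv : (a * b) ^ m = (a * b)^-1.
  rewrite conjgE (involV im) {1}mE mE invgM -!mulgA; congr (_ * _).
  by rewrite !mulgA -(mulgA (k * a) b) mulgV mulg1 kV_i // -mulgA involM // mulg1.
have [dD Dab] := conj_atP ab1; have [D1 DM DV] := conjugate_sub dD.
have nm : conj_set (conj_at (a * b)) m = conj_at (a * b).
  by apply: (conjugate_norm dD ab1 Dab); rewrite minv; exact: DV.
have [l il Dl] := inv_ex dD; have l1 : l <> 1 by case: il.
have El := conj_atE dD l1 Dl.
have plm : perp l m.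
  split=> //; last by apply/esym; apply: (fix_inv dD).
  move=> Elm; have c : (a * b) ^ m = a * b.
    by apply: conj_comm; apply: conjugate_abelian dD _ _ Dab _; rewrite -Elm.
  have E : a * b = (a * b)^-1 by rewrite -minv c.
  have iab : involution (a * b) by split=> //; rewrite sqE {2}E mulgV.
  have Eabm : a * b = m by rewrite -Elm; exact: (inv_unique dD).
  have Eak : a = k by apply: (mulIg b).
  have [_ _ nki _] := frame_ki; apply: nki.
  by apply: (inv_unique dDi) => //; [rewrite -Eak|case: (conj_at_inv ii)].
(* After moving [l], [m] to [i], [j], the element [(a * b) ^ x] is [g1] or its inverse; in the
   second case a further conjugation by [j] corrects it. *)
have [x [[Ex1 Ex2] Exg]] : exists x, (l ^ x = i /\ m ^ x = j) /\ (a * b) ^ x = g1.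
  have [x [Ex1 Ex2]] := pair_conj plm.
  have hx : conj_at i ((a * b) ^ x) by rewrite -Ex1; apply: conj_at_conj_mem => //; rewrite El.
  have abx1 : (a * b) ^ x <> 1.
    by move=> /(congr1 (fun z => z ^ x^-1)); rewrite conjgK conj1g.
  have Ey : ((a * b) ^ x) ^ (x^-1 * g) = g1 by rewrite conjgM conjgK.
  have ni : conj_set (conj_at i) (x^-1 * g) = conj_at i.
    by apply: (conjugate_norm dDi abx1 hx); rewrite Ey.
  have iy : i ^ (x^-1 * g) = i.
    apply: (inv_unique dDi) => //; first exact: involJ.
      by apply: norm_mem => //; case: (conj_at_inv ii).
    by case: (conj_at_inv ii).
  have [hy|py] := comm_inv ii (esym (comm_conj iy)).
    exists x; split=> //; rewrite -Ey; apply/esym; apply: conj_comm.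
    exact: conjugate_abelian dDi _ _ hx hy.
  exists (x * j); rewrite !conjgM Ex1 Ex2; split.
    by rewrite !conj_comm.
  by rewrite -Ey (perp_inv py hx); exact: perp_inv (perp_sym pij) hx.
set c := b' ^ x^-1.
have hc : conj_at m c.
  by rewrite /c -(conjgK x m) Ex2; exact: conj_at_conj_mem.
set d := b * c.
have Ed : (a * d) ^ x = g1 * b'.
  by rewrite /d mulgA (conjMg (a * b) c) Exg /c conjgKV.
(* [m'] is perpendicular to [m], with product [j]; hence it inverts [c], which means that [i]
   inverts [d]. *)
set m' := i * b.
have m'j : perp m' j by exact: perp_shift.
have [im' _ _ _] := m'j.
have bi : b ^ i = b^-1 by exact: perp_inv pij hb.
have m'm : m' * m = j.
  by rewrite /m' mE mulgA mulgK kE mulgA involM // mul1g.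
have pm' : perp m' m.
  split=> //; first by move=> E; apply: j1; rewrite -m'm E involM.
  by rewrite m'm; apply: invg_inj; rewrite invgM !involV // m'm.
have di : d ^ i = d^-1.
  rewrite /d (conjMg b c) bi invgM.
  have := perp_inv pm' hc; rewrite /m' conjgM.
  move=> /(congr1 (fun z => z ^ b^-1)); rewrite conjgK => ->.
  by rewrite conjgE invgK !mulgA mulVg mul1g.
have [d1|d1] := pselect (d = 1).
  have b1 : b = 1.
    apply: (conj_at_disj ij im _ hb) => [E|]; first by apply: nmj.
    have -> : b = c^-1 by apply: (mulIg c); rewrite mulVg.
    by have [dm _] := conj_at_inv im; have [_ _ mV] := conjugate_sub dm; exact: mV.
  exists 1; split=> //; exists (x * h).
  by rewrite mulg1 conjgM -Eh -Ed d1 mulg1.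
have [dd Dd] := conj_atP d1; have [E1 EM EV] := conjugate_sub dd.
have nid : conj_set (conj_at d) i = conj_at d.
  by apply: (conjugate_norm dd d1 Dd); rewrite di; exact: EV.
have [n iN Dn] := inv_ex dd; have n1 : n <> 1 by case: iN.
have pni : perp n i.
  split=> //; last by apply/esym; apply: (fix_inv dd).
  move=> Eni; rewrite Eni in Dn.
  have c2 : d ^ i = d by apply: conj_comm; exact: conjugate_abelian dd _ _ Dd Dn.
  have E : d = d^-1 by rewrite -di c2.
  have id' : involution d by split=> //; rewrite sqE {2}E mulgV.
  have Edi : d = i by exact: (inv_unique dd).
  have cm' : c = m'.
    rewrite /m' -(mulKg b c) -/d Edi -bi conjgE (involV ii).
    by rewrite -!mulgA involM // mulg1.
  have [dm mm] := conj_at_inv im.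
  have [_ _ nm' _] := pm'; apply: nm'; apply: (inv_unique dm) => //.
  by rewrite -cm'.
(* [e] commutes with [a], so conjugation by it brings [d] into [conj_at j] without changing [a]. *)
have [e ie Ee] := perp_trans pni (perp_sym pij).
exists (d ^ e); split.
- by rewrite -Ee; apply: conj_at_conj_mem => //; rewrite (conj_atE dd n1 Dn).
- exists (e^-1 * (x * h)).
  have -> : a * d ^ e = (a * d) ^ e.
    by rewrite (conjMg a d) (conj_comm (x := a)) //; exact: conjugate_abelian dDi _ _ ha ie.
  by rewrite conjgM conjgK conjgM Ed.
- by move=> /(congr1 (fun z => z ^ e^-1)); rewrite conjgK conj1g.
Qed.

(** Divisibility for the composition of lengths. *)
Definition below a c : Prop := exists b, conj_at j b /\ exists f, (a * b) ^ f = c.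

Lemma below_refl a : below a a.
Proof. by have [J1 _ _] := conjugate_sub dDj; exists 1; split=> //; exists 1; rewrite mulg1 conjg1. Qed.

Lemma below_trans a c d : conj_at i a -> conj_at i c -> below a c -> below c d -> below a d.
Proof.
move=> ha hc [b [hb [f Ef]]] [b' [hb' [f' Ef']]].
have [b'' [hb'' h _]] := comp_trans ha hb hc hb' Ef Ef'.
by exists b''.
Qed.

Lemma frame_false : False.
Proof.
have [I1 IM IV] := conjugate_sub dDi.
(* [b0] must differ from [1], so that composing with it changes the length, and from [j], so that
   the maximal length [i] is never reached and cancellation remains available. *)
have [b0 hb0 Eb0] : exists2 b, conj_at j b & b ^+ 2 = j by apply: conjugate_divisible => //; case: (conj_at_inv ij).
have b01 : b0 <> 1 by move=> E; apply: j1; rewrite -Eb0 E expg1n.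
have b0j : b0 <> j by move=> E; apply: j1; rewrite -Eb0 E; case: ij.
have step a : exists a', conj_at i a' /\ exists f, (a * b0) ^ f = a'.
  by have [x hx] := class_rep (a * b0); exists ((a * b0) ^ x); split=> //; exists x.
have [nx Hnx] := choice step.
pose t n := iter n nx 1.
have ht n : conj_at i (t n) by case: n => [//|n]; case: (Hnx (t n)).
have ti n : t n <> i.
  elim: n => [|n IH]; first by move=> E; apply: i1.
  move=> E; have [_ [f Ef]] := Hnx (t n).
  have : involution (t n * b0).
    have -> : t n * b0 = i ^ f^-1 by rewrite -E /= -Ef conjgK.
    exact: involJ.
  by move=> /(comp_inv (ht n) hb0)[].
have bS n : below (t n) (t n.+1).
  by exists b0; split=> //; case: (Hnx (t n)).
have le m n : m <= n -> below (t m) (t n).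
  elim: n => [|n IH]; first by rewrite leqn0 => /eqP->; exact: below_refl.
  rewrite leq_eqVlt => /orP[/eqP->|]; first exact: below_refl.
  by rewrite ltnS => /IH h; exact: below_trans (ht m) (ht n) h (bS n).
have nlt m n : n < m -> ~ below (t m) (t n).
  move=> /le h1 h2.
  (* Going from [t n] to [t n.+1] and back composes [t n] with some [b'' <> 1] and returns its
     class, against [comp_cancel]. *)
  have [b' [hb' [f' Ef']]] := below_trans (ht n.+1) (ht m) h1 h2.
  have [_ [f Ef]] := Hnx (t n).
  have [b'' [hb'' [f'' Ef''] /(_ _)/b01]] := comp_trans (ht n) hb0 (ht n.+1) hb' Ef Ef'.
  by apply; exact: comp_cancel (ht n) (ti n) hb'' Ef''.
have [A dA] := definable_def_over (conjugate_def dDj).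
apply: (@no_ladder below A).
  by rewrite /below; td.
move=> n; exists t, t => m p _ _; split; last exact: le.
by move=> h; rewrite leqNgt; apply/negP => /nlt.
Qed.

End Frame.

Lemma main_false : False.
Proof.
have [k ik] := hinv; have [i pi] := perp_ex ik.
exact: (frame_false pi erefl).
Qed.

End Main.

End Saturated.

(** * Transfer to the saturated extension *)

Section Covers.
Context (G : groupType).
Implicit Types (H K W : set G).

(** First-order for fixed [n]. Finite index and finiteness (cosets of the trivial group) are
    transferred in this form. *)
Fixpoint covered H n W : Prop :=
  if n is n'.+1 then exists a, covered H n' [set t | W t /\ ~ H (t * a^-1)]
  else forall t, ~ W t.

Lemma covered_seq H W (ns : seq G) :
  (forall t, W t -> exists2 n, n \in ns & H (t * n^-1)) -> covered H (size ns) W.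
Proof.
elim: ns W => [|n ns IH] W h /=; first by move=> t /h[].
exists n; apply: IH => t [Wt nH]; have [m] := h t Wt.
by rewrite inE => /orP[/eqP->//|]; exists m.
Qed.

Lemma seq_covered H W n : covered H n W ->
  exists ns : seq G, forall t, W t -> exists2 n, n \in ns & H (t * n^-1).
Proof.
elim: n W => [|n IH] W /=; first by move=> h; exists [::] => t /h.
move=> [a /IH[ns Hns]]; exists (a :: ns) => t Wt.
have [h|h] := pselect (H (t * a^-1)); first by exists a; rewrite ?mem_head.
by have [//|m mn hm] := Hns t; exists m; rewrite // inE mn orbT.
Qed.

Lemma finite_index_covered H K : subgroup H ->
  finite_index H K <-> exists n, covered H n K.
Proof.
move=> sH; split=> [fin|[n /seq_covered[ns Hns]]].
  have [ns Hns] := finite_index_reps sH fin.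
  by exists (size ns); exact: covered_seq.
have [H1 HM HV] := sH.
apply: (@finite_cover G _ _ (fun S n => exists2 x, S = right_coset H x & H (x * n^-1)) ns).
  by move=> _ [x Kx <-]; have [m mn h] := Hns x Kx; exists m => //; exists x.
move=> _ _ m _ _ [x -> hx] [y -> hy].
have hxy : H (x * y^-1) by have := HM _ _ hx (HV _ hy); rewrite invgM invgK mulgA mulgVK.
apply/seteqP; split=> _ [h Hh <-].
  by exists (h * (x * y^-1)); [exact: HM|rewrite -!mulgA mulVg mulg1].
exists (h * (x * y^-1)^-1); first by apply: (HM) => //; exact: HV.
by rewrite invgM invgK -!mulgA mulVg mulg1.
Qed.

Lemma finite_covered1 W : finite_set W <-> exists n, covered [set 1] n W.
Proof.
split=> [/finite_seqP[s ->]|[n /seq_covered[ns Hns]]].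
  by exists (size s); apply: covered_seq => t ts; exists t => //=; rewrite mulgV.
apply: (@sub_finite_set _ _ [set` ns]); last exact: finite_seq.
move=> t /Hns[m mn E] /=; suff -> : t = m by [].
by apply: (mulIg m^-1); rewrite mulgV.
Qed.

(** Equalities of sets are replaced by quantifiers over elements, as transfer requires. *)
Lemma TI_pointwise (C : set G) : TI C <->
  forall g, (exists x, ~ (C (x ^ g^-1) <-> C x)) ->
    forall x, (C x /\ C (x ^ g^-1)) <-> x = 1.
Proof.
split=> [h g [x nx] y|h g ne].
  have E : C `&` conj_set C g = [set 1].
    by apply: h => E; apply: nx; rewrite -{2}E conj_setP.
  have -> : (C y /\ C (y ^ g^-1)) <-> (C `&` conj_set C g) y.
    by split=> -[Cy] => [/conj_setP|/conj_setP].
  by rewrite E.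
have {h} h := h g _; apply/seteqP.
have [|n] := pselect (exists x, ~ (C (x ^ g^-1) <-> C x)).
  by move=> /h{}h; split=> x => [[Cx /conj_setP Cgx]|/h[? ?]];
    [exact/h|split=> //; exact/conj_setP].
case: ne; apply/seteqP; split=> x; rewrite conj_setP => Cx;
  by apply: contrapT => nC; apply: n; exists x => -[? ?]; apply: nC; auto.
Qed.

Lemma norm_pointwise (C : set G) t : normaliser C t <-> forall x, C (x ^ t^-1) <-> C x.
Proof.
split=> [E x|h]; first by rewrite -conj_setP E.
by apply/seteqP; split=> x; rewrite conj_setP h.
Qed.

End Covers.

(** * Formulas along the elementary embedding *)

Section Elementary.
Context (L : language) (T U : Type) (M : structure L T) (N : structure L U)
  (f : T -> U) (e : nat -> T) (x0 : T).
Hypothesis elem : elementary_embedding M N f.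
Let e' := f \o e.

Lemma codef_transfer P Q v : codef M N e e' P Q -> P v <-> Q (f \o v).
Proof.
move=> [phi [H1 H2]]; rewrite H1 H2 elem.
suff -> : f \o inter v e = inter (f \o v) e' by [].
by apply: funext => n; rewrite /inter /=; case: ifP.
Qed.

Lemma codef_closed (P Q : Prop) : codef M N e e' (fun=> P) (fun=> Q) -> P <-> Q.
Proof. exact: (@codef_transfer (fun=> P) (fun=> Q) (fun=> x0)). Qed.

(** [w] need not come from the small structure; only its first [k] values matter, and these are
    quantified away one after another. *)
Lemma codef_exists P Q w : codef M N e e' P Q -> Q w -> exists v, P v.
Proof.
move=> h; have [phi [H1 H2]] := h; have [k Hk] := sat_bound N phi.
have {Hk} Qk v v' : (forall n, n < k -> v n = v' n) -> Q v -> Q v'.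
  move=> E /H2 Qv; apply/H2; apply: (proj1 (Hk _ _ _)) Qv => n nk.
  rewrite /inter; case: ifP => // _; apply: E; apply: leq_ltn_trans nk.
  by rewrite leq_half_double -addnn leqW // leq_addr.
clear H1 H2; elim: k P Q w h Qk => [|k IH] P Q w h Qk Qw.
  exists (fun=> x0); apply/(codef_transfer _ h); exact: Qk Qw.
have h' : codef M N e e' (fun v => exists x, P (scons x v)) (fun v => exists x, Q (scons x v)).
  have scE V (u : nat -> V) : scons (u 0%N) (fun n => u n.+1) = u.
    by apply: funext => -[].
  apply: (codef_ex (P := fun x v => P (scons x v)) (Q := fun x v => Q (scons x v))).
  by apply: codef_ext h => v; rewrite scE.
have [||v [x Px]] := IH _ _ (fun n => w n.+1) h'.
- move=> v v' E [x Qx]; exists x; apply: Qk Qx => -[|n] //= nk; exact: E.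
- by exists (w 0%N); apply: Qk Qw => -[|n].
by exists (scons x v).
Qed.

End Elementary.

Section Transfer.
Context (L : language) (G U : groupType) (M : structure L G) (N : structure L U)
  (f : G -> U) (e : nat -> G).
Hypothesis elem : elementary_embedding M N f.
Let e' := f \o e.
Hypothesis hmul : codef M N e e' (fun v => v 0%N = v 1%N * v 2%N)
  (fun v => v 0%N = v 1%N * v 2%N).
Local Notation codefe := (codef M N e e').
Local Notation cofune := (cofun M N e e').

Lemma cofun_mul2 t t' s s' : cofune t t' -> cofune s s' ->
  cofune (fun v => t v * s v) (fun v => t' v * s' v).
Proof. exact: (cofun_op2 hmul). Qed.

Lemma cofun_one2 : cofune (fun=> 1) (fun=> 1).
Proof.
have := codef_eq (cofun_mul2 (cofun_var M N e e' 0%N) (cofun_var M N e e' 0%N)) (cofun_var M N e e' 0%N).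
by apply: codef_ext => v; split=> [/(canRL (mulKg _))|->]; rewrite ?mulVg ?mulg1.
Qed.

Lemma cofun_inv2 t t' : cofune t t' -> cofune (fun v => (t v)^-1) (fun v => (t' v)^-1).
Proof.
apply: (cofun_fun (op := fun x => x^-1) (op' := fun x => x^-1)).
have := codef_eq (cofun_mul2 (cofun_var M N e e' 0%N) (cofun_var M N e e' 1%N)) cofun_one2.
by apply: codef_ext => v; split=> [/(canRL (mulgK _))|->]; rewrite ?mul1g ?mulVg.
Qed.

Lemma cofun_conj2 t t' s s' : cofune t t' -> cofune s s' ->
  cofune (fun v => t v ^ s v) (fun v => t' v ^ s' v).
Proof. by move=> ht hs; apply: cofun_mul2; [exact: cofun_inv2|exact: cofun_mul2]. Qed.

Lemma cofun_sq2 t t' : cofune t t' -> cofune (fun v => t v ^+ 2) (fun v => t' v ^+ 2).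
Proof. by move=> ht; apply: cofun_mul2. Qed.

Ltac ftt := lazymatch goal with
  | |- cofun _ _ _ _ (fun v => v ?k) _ => exact: cofun_var
  | |- cofun _ _ _ _ (fun v => @?t v * @?s v) _ => apply: cofun_mul2; ftt
  | |- cofun _ _ _ _ (fun v => (@?t v)^-1) _ => apply: cofun_inv2; ftt
  | |- cofun _ _ _ _ (fun v => @?t v ^ @?s v) _ => apply: cofun_conj2; ftt
  | |- cofun _ _ _ _ (fun v => @?t v ^+ 2) _ => apply: cofun_sq2; ftt
  | |- cofun _ _ _ _ (fun=> 1) _ => exact: cofun_one2
  end.
Ltac td2 := lazymatch goal with
  | |- codef _ _ _ _ (fun v => ~ @?P v) _ => apply: codef_not; td2
  | |- codef _ _ _ _ (fun v => @?P v /\ @?Q v) _ => apply: codef_and; td2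
  | |- codef _ _ _ _ (fun v => @?P v <-> @?Q v) _ => apply: codef_iff; td2
  | |- codef _ _ _ _ (fun v => @?t v = @?s v) _ => apply: codef_eq; ftt
  | |- codef _ _ _ _ (fun v => exists x, @?P v x) _ => apply: codef_ex; cbn beta; td2
  | |- codef _ _ _ _ (fun v => @?P v -> @?Q v) _ => apply: codef_imp; td2
  | |- codef _ _ _ _ (fun v => forall x, @?P v x) _ => apply: codef_all; cbn beta; td2
  | hdef_ : codef _ _ _ _ (fun v => ?X (v 0%N)) (fun v => ?Y (v 0%N)) |-
      codef _ _ _ _ (fun v => ?X (@?t v)) _ =>
      apply: (codef_app1 (R := X) (R' := Y)); [exact: hdef_|ftt]
  end.

Lemma codef_covered n (Hp Wp : (nat -> G) -> set G) (Hp' Wp' : (nat -> U) -> set U) :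
  codefe (fun v => Hp (fun n => v n.+1) (v 0%N)) (fun v => Hp' (fun n => v n.+1) (v 0%N)) ->
  codefe (fun v => Wp (fun n => v n.+1) (v 0%N)) (fun v => Wp' (fun n => v n.+1) (v 0%N)) ->
  codefe (fun v => covered (Hp v) n (Wp v)) (fun v => covered (Hp' v) n (Wp' v)).
Proof.
elim: n Hp Wp Hp' Wp' => [|n IH] Hp Wp Hp' Wp' hH hW.
  exact: (codef_all (P := fun x v => ~ Wp v x) (Q := fun x v => ~ Wp' v x) (codef_not hW)).
have hH2 := codef_reindex (fun n => if n is m.+1 then m.+2 else 0%N) hH.
have hW2 := codef_reindex (fun n => if n is m.+1 then m.+2 else 0%N) hW.
have hH3 := codef_reindex (fun n => if n is m.+1 then m.+3 else 0%N) hH.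
apply: (codef_ex (P := fun a v => covered (Hp v) n [set t | Wp v t /\ ~ Hp v (t * a^-1)])
  (Q := fun a v => covered (Hp' v) n [set t | Wp' v t /\ ~ Hp' v (t * a^-1)])).
apply: (IH (fun w => Hp (fun n => w n.+1))
  (fun w => [set t | Wp (fun n => w n.+1) t /\ ~ Hp (fun n => w n.+1) (t * (w 0%N)^-1)])
  (fun w => Hp' (fun n => w n.+1))
  (fun w => [set t | Wp' (fun n => w n.+1) t /\ ~ Hp' (fun n => w n.+1) (t * (w 0%N)^-1)])).
  exact: hH2.
apply: codef_and => //; apply: codef_not.
apply: (codef_subst (P := fun z v => Hp (fun n => v n.+2) z)
  (Q := fun z v => Hp' (fun n => v n.+2) z)) => //.
ftt.
Qed.

(** A subgroup refuting connectedness in [N] is given by a formula, parameters and a bound on the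
    index. The existence of such parameters is first-order, so they also exist in [M]. *)
Lemma connected_transfer (K : set G) (K' : set U) :
  codefe (fun v => K (v 0%N)) (fun v => K' (v 0%N)) ->
  connected M K -> connected N K'.
Proof.
move=> hK conn H [psi [w EH]] sH HK fin.
have [n cn] := proj1 (finite_index_covered _ sH) fin.
apply: contrapT => ne.
have [x0 [Kx0 nHx0]] : exists x, K' x /\ ~ H x.
  apply: contrapT => h; apply: ne; apply/seteqP; split=> // x Kx.
  apply: contrapT => nH; apply: h; by exists x.
pose Hp (v : nat -> G) := [set x | sat M psi (scons x v)].
pose Hp' (v : nat -> U) := [set x | sat N psi (scons x v)].
have scE T (u : nat -> T) : scons (u 0%N) (fun n => u n.+1) = u.
  by apply: funext => -[].
have hH : codefe (fun v => Hp (fun n => v n.+1) (v 0%N))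
              (fun v => Hp' (fun n => v n.+1) (v 0%N)).
  exists (frename double psi).
  have dE T (u d : nat -> T) : inter u d \o double = u.
    by apply: funext => m; rewrite /inter /= odd_double doubleK.
  by split=> v; rewrite /Hp /Hp' /= scE (sat_rename_eq _ _ (dE _ v _)).
have hHs t t' : cofune t t' -> codefe (fun v => Hp v (t v)) (fun v => Hp' v (t' v)).
  exact: (codef_subst (P := fun x v => Hp v x) (Q := fun x v => Hp' v x)).
have hHr s t t' : cofune t t' -> codefe (fun v => Hp (fun n => v (s n)) (t v))
                                  (fun v => Hp' (fun n => v (s n)) (t' v)).
  apply: (codef_subst (P := fun x v => Hp (fun n => v (s n)) x)
    (Q := fun x v => Hp' (fun n => v (s n)) x)).
  exact: (codef_reindex (fun n => if n is m.+1 then (s m).+1 else 0%N) hH).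
pose S1 v := [/\ subgroup (Hp v), Hp v `<=` K & covered (Hp v) n K] /\
  exists x, K x /\ ~ Hp v x.
pose S2 v := [/\ subgroup (Hp' v), Hp' v `<=` K' & covered (Hp' v) n K'] /\
  exists x, K' x /\ ~ Hp' v x.
have hS : codefe S1 S2.
  pose R1 v := (Hp v 1 /\ (forall x y, Hp v x -> Hp v y -> Hp v (x * y)) /\
    (forall x, Hp v x -> Hp v x^-1)) /\ ((forall x, Hp v x -> K x) /\
    (covered (Hp v) n K /\ exists x, K x /\ ~ Hp v x)).
  pose R2 v := (Hp' v 1 /\ (forall x y, Hp' v x -> Hp' v y -> Hp' v (x * y)) /\
    (forall x, Hp' v x -> Hp' v x^-1)) /\ ((forall x, Hp' v x -> K' x) /\
    (covered (Hp' v) n K' /\ exists x, K' x /\ ~ Hp' v x)).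
  have : codefe R1 R2.
    apply: codef_and; first (apply: codef_and; last apply: codef_and).
    + by apply: hHs; exact: cofun_one2.
    + apply: codef_all; apply: codef_all; cbn beta.
      apply: codef_imp; last apply: codef_imp; apply: (hHr (fun n => n.+2)); ftt.
    + apply: codef_all; cbn beta.
      apply: codef_imp; apply: (hHr S); ftt.
    + apply: codef_and; last apply: codef_and.
      * apply: codef_all; cbn beta; apply: codef_imp => //.
      * exact: (codef_covered n (Wp := fun=> K) (Wp' := fun=> K')).
      * apply: codef_ex; cbn beta; apply: codef_and => //; exact: codef_not.
  apply: codef_ext => v; rewrite /R1 /S1 /R2 /S2 /subgroup.
    by split=> [[[? [? ?]] [? [? ?]]]|[[[? ? ?] ? ?] ?]].
  by split=> [[[? [? ?]] [? [? ?]]]|[[[? ? ?] ? ?] ?]].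
have EH' : Hp' w = H by [].
have [|v [[sHv HvK cv] [x [Kx nx]]]] := codef_exists 1 elem hS (w := w).
  by split; [rewrite EH'|exists x0; rewrite EH'].
have E : Hp v = K.
  apply: conn => //; first by exists psi, v.
  by apply/(finite_index_covered _ sHv); exists n.
by apply: nx; rewrite E.
Qed.

Lemma theorem_transfer (C : set G) (C' : set U) ntop :
  codefe (fun v => C (v 0%N)) (fun v => C' (v 0%N)) -> definable N C' ->
  omega_saturated N -> ~ morley_rank_ge N ntop [set: U] ->
  connected M [set: G] -> U2perp G -> (exists i : G, involution i) ->
  subgroup C -> connected M C -> C <> [set: G] -> TI C -> almost_self_normalising C ->
  ~ ([set x : G | strongly_real x] `<=` \bigcup_(g in [set: G]) conj_set C g).
Proof.
move=> hC dC' hsat hfin Gconn u2 hinv Csub Cconn Cprop CTI Casn Creal.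
have tr (P Q : Prop) : codefe (fun=> P) (fun=> Q) -> P -> Q by move=> h; case: (codef_closed 1 elem h).
(* The formula for the product uses finitely many of the parameters [e']; these form the permanent
   part of every base. *)
have [Am hAm] : exists Am : seq U, pred_over N Am [::] (fun v => v 0%N = v 1%N * v 2%N).
  have [phi [_ H2]] := hmul; have [k Hk] := sat_bound N phi.
  exists (mkseq e' k), phi; split=> v.
    rewrite H2; apply: Hk => n nk; rewrite /inter; case: ifP => // _.
    rewrite /base_env cat0s nth_mkseq //; apply: leq_ltn_trans nk.
    by rewrite leq_half_double -addnn leqW // leq_addr.
  rewrite H2; apply: Hk => n nk; rewrite /inter; case: ifP => // _.
  rewrite /base_env cat0s nth_mkseq //; apply: leq_ltn_trans nk.
  by rewrite leq_half_double -addnn leqW // leq_addr.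
have Csub' : subgroup C'.
  have : C' 1 /\ (forall x y, C' x -> C' y -> C' (x * y)) /\ (forall x, C' x -> C' x^-1).
    apply: (tr (C 1 /\ (forall x y, C x -> C y -> C (x * y)) /\
      (forall x, C x -> C x^-1))); first by td2.
    by case: Csub.
  by move=> [? [? ?]].
have TDT : codefe (fun v => [set: G] (v 0%N)) (fun v => [set: U] (v 0%N)) by exact: codef_true.
apply: (@main_false _ _ _ _ hsat _ hfin hAm _ _ C') => //.
- exact: (connected_transfer TDT).
- have [i [i1 i2]] := hinv.
  have [x [x1 x2]] : exists x : U, x <> 1 /\ x ^+ 2 = 1.
    apply: (tr (exists x : G, x <> 1 /\ x ^+ 2 = 1)); first by td2.
    by exists i.
  by exists x.
- exact: (connected_transfer hC).
- have : exists x, ~ C' x.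
    apply: (tr (exists x, ~ C x)); first by td2.
    apply: contrapT => h; apply: Cprop; apply/seteqP; split=> // x _.
    by apply: contrapT => nC; apply: h; exists x.
  by move=> [x nx] E; apply: nx; rewrite E.
- apply/TI_pointwise.
  apply: (tr (forall g, (exists x, ~ (C (x ^ g^-1) <-> C x)) ->
    forall x, (C x /\ C (x ^ g^-1)) <-> x = 1)); first by td2.
  exact/TI_pointwise.
- have [n cn] := proj1 (finite_index_covered _ Csub) Casn.
  apply/(finite_index_covered _ Csub'); exists n.
  have EN (T : groupType) (B : set T) :
      normaliser B = [set t | forall x, B (x ^ t^-1) <-> B x].
    by apply/seteqP; split=> t /norm_pointwise.
  rewrite EN; apply: (tr (covered C n [set t | forall x, C (x ^ t^-1) <-> C x])).
    apply: (codef_covered n (Hp := fun=> C) (Hp' := fun=> C')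
      (Wp := fun=> [set t | forall x, C (x ^ t^-1) <-> C x])
      (Wp' := fun=> [set t | forall x, C' (x ^ t^-1) <-> C' x])) => //.
    by rewrite /mkset; td2.
  by rewrite -EN.
- have [n Hn] : exists n, (forall x y, C x -> C y -> x * y = y * x) ->
      covered [set 1] n [set x | C x /\ x ^+ 2 = 1].
    (* Without commutativity the implication is void and [0] is an arbitrary bound. *)
    have [ab|nab] := pselect (forall x y, C x -> C y -> x * y = y * x); last by exists 0%N.
    suff /finite_covered1[n Hn] : finite_set [set x | C x /\ x ^+ 2 = 1] by exists n.
    apply: contrapT => inf; apply: u2; exists [set x | C x /\ x ^+ 2 = 1]; split=> //.
    have [C1 CM CV] := Csub.
    split=> [|x y [Cx _] [Cy _]|x [_]] //; last exact: ab.
    split=> [|x y [Cx x2] [Cy y2]|x [Cx x2]].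
    + by split=> //; rewrite expg1n.
    + by split; [exact: CM|rewrite expgMn ?x2 ?y2 ?mulg1 //; exact: ab].
    + by split; [exact: CV|rewrite expVgn x2 invg1].
  move=> ab; apply/finite_covered1; exists n; move: ab.
  apply: (tr _ _ _ Hn); apply: codef_imp; first by td2.
  apply: (codef_covered n (Hp := fun=> [set 1]) (Hp' := fun=> [set 1])
    (Wp := fun=> [set x | C x /\ x ^+ 2 = 1])
    (Wp' := fun=> [set x | C' x /\ x ^+ 2 = 1])).
    by rewrite /set1 /mkset; td2.
  by rewrite /mkset; td2.
- move=> _ [x [y [[x1 x2] [y1 y2] ->]]].
  have H : forall x y : U, (x <> 1 /\ x ^+ 2 = 1) -> (y <> 1 /\ y ^+ 2 = 1) ->
      exists g, C' ((x * y) ^ g^-1).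
    apply: (tr (forall x y : G, (x <> 1 /\ x ^+ 2 = 1) -> (y <> 1 /\ y ^+ 2 = 1) ->
      exists g, C ((x * y) ^ g^-1))); first by td2.
    move=> a b [a1 a2] [b1 b2].
    have : [set x : G | strongly_real x] (a * b) by exists a, b.
    by move=> /Creal[g _ /conj_setP h]; exists g.
  have [||g Cg] := H x y => //; exists g => //; exact/conj_setP.
Qed.

End Transfer.

Theorem theoremA (G : groupType) (L : language) (M : structure L G)
    (hG : group_of_finite_morley_rank M)
    (hconn : connected M [set: G])
    (hU2 : U2perp G)
    (hinv : exists i : G, involution i)
    (C : set G)
    (Cdef : definable M C)
    (Csub : subgroup C)
    (Cconn : connected M C)
    (Cproper : C <> [set: G])
    (CTI : TI C)
    (Casn : almost_self_normalising C) :
  ~ ([set x : G | strongly_real x] `<=` \bigcup_(g in [set: G]) conj_set C g).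
Proof.
have [[phm [vm Hm]] [U [N [f [elem hsat [ntop hfin]]]]]] := hG.
have [phC [vC HC]] := Cdef.
pose e := inter vm vC; pose e' := f \o e.
(* [U] carries no group structure yet. The formula for the product defines [R] in [N]; that it is
   the graph of a group operation is transferred axiom by axiom. *)
pose R x y z := sat N phm (scons x (scons y (scons z (f \o vm)))).
have hR : codef M N e e' (fun v => v 0%N = v 1%N * v 2%N)
    (fun v => R (v 1%N) (v 2%N) (v 0%N)).
  (* [phm] reads factor, factor, product, found at variables 1, 2 and 0. As [e] interleaves two
     lists, its parameter [n] is at position [4n + 1]. *)
  pose rho n := match n with 0 => 2 | 1 => 4 | 2 => 0 | n.+3 => n.*2.*2.+1 end%N.
  have E T (v : nat -> T) (d d' : nat -> T) : inter v (inter d d') \o rho =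
      scons (v 1%N) (scons (v 2%N) (scons (v 0%N) d)).
    apply: funext => -[|[|[|n]]] //; rewrite /= /inter /= odd_double /=.
    by rewrite uphalf_double odd_double doubleK.
  have Ef : e' = inter (f \o vm) (f \o vC).
    by apply: funext => n; rewrite /e' /e /inter /=; case: ifP.
  exists (frename rho phm); split=> v.
    by rewrite (sat_rename_eq _ _ (E _ v vm vC)) -Hm; split=> ->.
  by rewrite Ef (sat_rename_eq _ _ (E _ v _ _)).
have hC : codef M N e e' (fun v => C (v 0%N))
    (fun v => [set x | sat N phC (scons x (f \o vC))] (v 0%N)).
  pose rho n := if n is m.+1 then (m.*2.+1).*2.+1 else 0%N.
  have E T (v : nat -> T) (d d' : nat -> T) : inter v (inter d d') \o rho =
      scons (v 0%N) d'.
    apply: funext => -[|n] //; rewrite /= /inter /= odd_double /=.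
    by rewrite uphalf_double /= odd_double /= uphalf_double.
  have Ef : e' = inter (f \o vm) (f \o vC).
    by apply: funext => n; rewrite /e' /e /inter /=; case: ifP.
  exists (frename rho phC); split=> v.
    by rewrite HC /= (sat_rename_eq _ _ (E _ v vm vC)).
  by rewrite Ef /= (sat_rename_eq _ _ (E _ v _ _)).
have tr (P Q : Prop) : codef M N e e' (fun=> P) (fun=> Q) -> P -> Q.
  by move=> h; case: (codef_closed 1 elem h).
have Rex x y : exists z, R x y z.
  move: x y; apply: (tr (forall x y : G, exists z, z = x * y)).
    apply: codef_all; apply: codef_all; apply: codef_ex; cbn beta.
    exact: (codef_reindex (fun n => match n with 0 => 0 | 1 => 2 | 2 => 1 | n => n end%N) hR).
  by move=> x y; exists (x * y).
have Runi x y z z' : R x y z -> R x y z' -> z = z'.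
  move: x y z z'.
  apply: (tr (forall x y z z' : G, z = x * y -> z' = x * y -> z = z')).
    do 4!(apply: codef_all); cbn beta; apply: codef_imp; last apply: codef_imp.
    - exact: (codef_reindex (fun n => match n with 0 => 1 | 1 => 3 | 2 => 2 | n => n end%N) hR).
    - exact: (codef_reindex (fun n => match n with 0 => 0 | 1 => 3 | 2 => 2 | n => n end%N) hR).
    - exact: codef_eqvar.
  by move=> x y z z' -> ->.
have [mu Hmu] := choice (fun p : U * U => Rex p.1 p.2).
pose m x y := mu (x, y).
have hm : codef M N e e' (fun v => v 0%N = v 1%N * v 2%N)
    (fun v => v 0%N = m (v 1%N) (v 2%N)).
  apply: codef_ext hR => v //; split=> [h|->]; last exact: (Hmu (_, _)).
  exact: Runi h (Hmu (_, _)).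
have var n := cofun_var M N e e' n.
have mA : associative m.
  apply: (tr (forall x y z : G, x * (y * z) = x * y * z)); last exact: mulgA.
  do 3!(apply: codef_all); cbn beta.
  by apply: codef_eq; apply: (cofun_op2 hm) => //; apply: (cofun_op2 hm).
have [o [oid ex_inv]] : exists o, (forall x, m o x = x /\ m x o = x) /\
    forall x, exists y, m y x = o /\ m x y = o.
  apply: (tr (exists o : G, (forall x, o * x = x /\ x * o = x) /\
    forall x, exists y, y * x = o /\ x * y = o)).
    apply: codef_ex; cbn beta; apply: codef_and; apply: codef_all; cbn beta;
      last (apply: codef_ex; cbn beta); apply: codef_and; apply: codef_eq => //;
      exact: (cofun_op2 hm).
  exists 1; split=> x; first by rewrite mul1g mulg1.
  by exists x^-1; rewrite mulVg mulgV.
have [iv Hiv] := choice ex_inv.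
have m1 : left_id o m by move=> x; case: (oid x).
have m1' : right_id o m by move=> x; case: (oid x).
have mV : left_inverse o iv m by move=> x; case: (Hiv x).
have mV' : right_inverse o iv m by move=> x; case: (Hiv x).
pose cU : choiceType := HB.pack U (gen_eqMixin U) (gen_choiceMixin U).
pose gU : groupType := HB.pack U (Choice.class cU) (isGroup.Build cU mA m1 m1' mV mV').
apply: (@theorem_transfer L G gU M N f e elem hm C _ ntop hC) => //.
by exists phC, (f \o vC).
Qed.
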